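(* There are absolute constants $c,C>0$ such that for every integer $k\ge 2$ there exists $n_0=n_0(k)$ such that every odd integer $n\ge n_0$ satisfies $$e^{ck}\,n\le \widehat R_{\mathrm{ind}}(C_n;k)\le e^{Ck}\,n .$$ That is, $\widehat R_{\mathrm{ind}}(C_n;k)=e^{\Theta(k)}n$ for all sufficiently large odd $n$.
   Context: $C_n$ is the cycle on $n$ vertices. For a graph $H$ and $k\ge 1$, the $k$-colour induced size-Ramsey number $\widehat R_{\mathrm{ind}}(H;k)$ is the minimum number of edges in a finite graph $G$ such that every $k$-edge-colouring of $G$ (an arbitrary assignment of one of $k$ colours to each edge) contains a monochromatic copy of $H$ which is an induced subgraph of $G$. *)

(* Defs.v *)
From HB Require Import structures.
From mathcomp Require Import all_boot all_order all_algebra.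
From mathcomp Require Import boolp classical_sets reals.

Set Implicit Arguments.
Unset Strict Implicit.
Unset Printing Implicit Defensive.

Record sgraph := SGraph {
  vertex :> finType;
  adj : rel vertex;
  adj_sym : symmetric adj;
  adj_irr : irreflexive adj
}.

Definition edges (G : sgraph) : {set {set G}} :=
  [set [set p.1; p.2] | p : G * G & adj p.1 p.2].

Definition cycle_adj (n : nat) : rel 'I_n :=
  fun i j => (i != j) && ((j == ordS i) || (i == ordS j)).

Lemma cycle_adj_sym (n : nat) : symmetric (@cycle_adj n).
Proof. by move=> i j; rewrite /cycle_adj eq_sym orbC. Qed.

Lemma cycle_adj_irr (n : nat) : irreflexive (@cycle_adj n).
Proof. by move=> i; rewrite /cycle_adj eqxx. Qed.

(* The cycle C_n when 3 <= n; for n <= 2 this is the path on n vertices. *)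
Definition cycle_graph (n : nat) : sgraph :=
  SGraph (@cycle_adj_sym n) (@cycle_adj_irr n).

Definition induced_embedding (H G : sgraph) (phi : H -> G) : Prop :=
  injective phi /\ forall u v : H, adj (phi u) (phi v) = adj u v.

(* A k-edge-colouring of G is given by a map on all vertex subsets; only its
   values on [edges G] are ever inspected. *)
Definition monochromatic (H G : sgraph) (k : nat) (chi : {set G} -> 'I_k)
    (phi : H -> G) : Prop :=
  exists c : 'I_k, forall u v : H, adj u v -> chi [set phi u; phi v]%SET = c.

Definition ind_arrows (G H : sgraph) (k : nat) : Prop :=
  forall chi : {set G} -> 'I_k,
    exists phi : H -> G, induced_embedding phi /\ monochromatic chi phi.

Definition is_ind_size_ramsey (H : sgraph) (k m : nat) : Prop :=
  (exists G : sgraph, ind_arrows G H k /\ #|edges G| = m) /\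
  (forall G : sgraph, ind_arrows G H k -> m <= #|edges G|).

(* The value is 0 if no G satisfies [ind_arrows G H k]; in particular
   [0 < ind_size_ramsey H k] implies that the minimum exists. *)
Definition ind_size_ramsey (H : sgraph) (k : nat) : nat :=
  xget 0 [set m | is_ind_size_ramsey H k m]%classic.

Lemma ind_size_ramseyE (H : sgraph) (k m : nat) :
  is_ind_size_ramsey H k m -> ind_size_ramsey H k = m.
Proof.
move=> Hm; apply: xget_unique => // p [[G [HG <-]] min_p].
by case: Hm => [[G' [HG' <-]] min_m]; apply/eqP; rewrite eqn_leq min_p ?min_m.
Qed.

(* Main.v *)
Require Import Defs.
From HB Require Import structures.
From mathcomp Require Import all_boot all_order all_algebra.
From mathcomp Require Import reals sequences exp.
From mathcomp Require Import zify boolp.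

(** For the lower bound it is enough to colour two kinds of graphs badly.  A graph
    with fewer than [2 n - 1] edges splits into two classes with fewer than [n]
    edges.  In a graph with few edges few vertices have degree at least
    [2 ^ (k - 1)]; one colour is spent on the edges at those vertices and the
    others on a decomposition of the rest, which has chromatic number at most
    [2 ^ (k - 1)], into [k - 1] bipartite graphs, where an odd cycle cannot live
    ([ind_arrows_odd_cycle]).

    The upper bound needs a host graph with [exp (O(k)) * n] edges.  It is made of
    copies of one gadget [F] on [N = 2 ^ (200 * k)] vertices, placed on the
    hyperedges of an [N]-uniform [N]-partite hypergraph with [O(n)] vertices and
    hyperedges, where the constants are powers of [N].

    - The gadget is a sparse random graph in which every set of [N / 2 ^ (17 * k)]
      vertices spans an edge ([random_graph]).  In every [k]-colouring of it some
      two vertices [x], [y] are joined by two monochromatic paths of the same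
      colour, both induced in [F], with [p] and [p + 1] edges for some [p = O(k)]
      ([flexible_pair]): the alternative is that every colour class has large
      independent sets, inside one another, and the last of these spans no edge.
    - Given a colouring of the host graph, the most popular choice of the colour
      and of [x], [y], [p] is shared by a constant proportion of the hyperedges.
      A subfamily [J] of these has large minimum degree at the ports, which are
      the vertices playing the parts of [x] and [y] ([core_exists]).
    - In [J] there is a cyclic sequence of [l] hyperedges, consecutive ones joined
      at ports, that is induced in the whole hypergraph ([hypercycle_exists]).
      Its length [l] is not prescribed, but known up to a factor close enough to
      [1] to ensure [l * p <= n <= l * (p + 1)].  Each of its hyperedges
      contributes one of its two paths, and [n - l * p] of them the longer one;
      together they form an induced monochromatic cycle with exactly [n] vertices
      ([ring_cycle]).

    To find the cyclic sequence one grows trees of hyperedges of [J] that stay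
    induced in the ambient hypergraph.  The hypergraph is sparse, in the sense that
    [t] hyperedges cover at least [(r - 1/4) * t] vertices for every [t] up to a
    constant proportion of [n] (here [r + 1] is the uniformity), and so only a small
    part of the nodes of such a tree can be unable to carry a further hyperedge
    ([stuck_few]).  Depth-first search then yields legs of any desired length
    ([leg_exists]).  Out of legs one builds a spider with many long disjoint legs
    ([spider_exists]), and lets every leg branch a bounded number of times near its
    end ([layers]).  The last few branchings are done for each leg separately, in
    trees that ignore each other; so their total size may exceed the number of
    ports, and two legs meet.  A cycle of the desired length results.  It is
    induced because contacts inside one tree are excluded by construction, whereas
    contacts between the two separate ends would be short cycles, which the
    hypergraph does not have ([closing]). *)

Set Implicit Arguments.
Unset Strict Implicit.
Unset Printing Implicit Defensive.

(** * Counting *)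

Lemma card_bigcup_le (I T : finType) (A : {set I}) (F : I -> {set T}) :
  #|\bigcup_(i in A) F i| <= \sum_(i in A) #|F i|.
Proof.
elim/big_rec2: _ => [|i n B _ le_n]; first by rewrite cards0.
rewrite cardsU; lia.
Qed.

Lemma double_count (I T : finType) (Q : {set I}) (Y : {set T}) (A : I -> {set T}) c d :
  (forall x, x \in Q -> d <= #|A x|) -> (forall x, x \in Q -> A x \subset Y) ->
  (forall y, y \in Y -> #|[set x in Q | y \in A x]| <= c) ->
  d * #|Q| <= c * #|Y|.
Proof.
move=> hd hY hc; rewrite mulnC -sum_nat_const mulnC -sum_nat_const.
apply: (@leq_trans (\sum_(x in Q) \sum_(y in Y) (y \in A x))).
  apply: leq_sum => x xQ; apply: leq_trans (hd x xQ) _.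
  rewrite -sum1_card [leqRHS](big_setID (A x)) /= (setIidPr (hY x xQ)).
  apply: leq_trans (leq_addr _ _); apply/eq_leq/eq_bigr => y yA.
  by rewrite yA.
rewrite exchange_big /=; apply: leq_sum => y yY; apply: leq_trans (hc y yY).
rewrite -sum1_card big_mkcond [leqRHS]big_mkcond /=; apply: leq_sum => x _.
by rewrite inE; case: (x \in Q) => //=; case: (y \in A x).
Qed.

Section Covered.
Variables (E V : finType) (vs : E -> {set V}).
Implicit Types S : {set E}.

Definition covered S := \bigcup_(e in S) vs e.

Lemma covP S u : reflect (exists2 e, e \in S & u \in vs e) (u \in covered S).
Proof. exact: bigcupP. Qed.

Lemma mem_cov S e u : e \in S -> u \in vs e -> u \in covered S.
Proof. by move=> eS ue; apply/covP; exists e. Qed.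

Lemma cov_sub S S' : S \subset S' -> covered S \subset covered S'.
Proof. by move=> sub; apply/subsetP=> u /covP[e /(subsetP sub) eS ue]; apply: mem_cov ue. Qed.

Lemma covU1 e S : covered (e |: S) = vs e :|: covered S.
Proof. by rewrite /covered bigcup_setU big_set1. Qed.

End Covered.

Lemma card_setD_contact (V : finType) (A B : {set V}) v : v \in A -> v \in B -> #|A :\: B| < #|A|.
Proof.
move=> vA vB; rewrite cardsD.
have : 0 < #|A :&: B| by apply/card_gt0P; exists v; rewrite inE vA.
have := subset_leq_card (subsetIl A B); lia.
Qed.

Lemma card_setD_contact2 (V : finType) (A B : {set V}) u v : u != v -> u \in A -> v \in A ->
  u \in B -> v \in B -> #|A :\: B|.+2 <= #|A|.
Proof.
move=> nuv uA vA uB vB; rewrite cardsD.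
have : #|[set u; v]| <= #|A :&: B|.
  by apply/subset_leq_card/subsetP=> x; rewrite !inE => /orP[] /eqP->;
     rewrite ?uA ?vA.
rewrite cards2 nuv; have := subset_leq_card (subsetIl A B); lia.
Qed.

Lemma card_bigcup_bound (I T : finType) (A : {set I}) (F : I -> {set T}) K :
  (forall i, i \in A -> #|F i| <= K) -> #|\bigcup_(i in A) F i| <= #|A| * K.
Proof.
by move=> h; apply: leq_trans (card_bigcup_le _ _) _; rewrite -sum_nat_const leq_sum.
Qed.

Lemma subset_card_exists (T : finType) (A : {set T}) k : k <= #|A| ->
  exists2 B : {set T}, B \subset A & #|B| = k.
Proof.
move=> kA; exists [set x in take k (enum A)].
  by apply/subsetP=> x; rewrite inE => /mem_take; rewrite mem_enum.
rewrite cardsE; have /card_uniqP -> := take_uniq k (enum_uniq A).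
by rewrite size_takel // -cardE.
Qed.

Lemma bin_le_exp2 n k : 'C(n, k) <= 2 ^ n.
Proof.
elim: n k => [|n IH] [|k]; rewrite ?bin0 ?bin0n ?expn_gt0 //.
by rewrite binS expnS mul2n -addnn leq_add.
Qed.

Lemma ffact_le_exp n k : n ^_ k <= n ^ k.
Proof. by elim: k => // k IH; rewrite ffactnSr expnSr leq_mul // leq_subr. Qed.

Lemma exp_le_ffact k j : j <= k -> k ^ j <= (2 * k) ^_ j.
Proof.
elim: j => // j IH jk; rewrite ffactnSr expnSr leq_mul ?IH ?(ltnW jk) //.
by move: jk; clear; lia.
Qed.

Lemma bin_exp_le n k : 'C(n, k) * k ^ k <= (4 * n) ^ k.
Proof.
have h : k ^ k <= 4 ^ k * k`!.
  apply: leq_trans (exp_le_ffact (leqnn k)) _; rewrite -bin_ffact leq_mul2r.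
  by rewrite -[4]/(2 ^ 2) -expnM bin_le_exp2 orbT.
apply: leq_trans (leq_mul (leqnn _) h) _; rewrite mulnCA expnMn leq_mul2l.
by rewrite bin_ffact ffact_le_exp orbT.
Qed.

Lemma geometric_sum (b : nat -> nat) n W : (forall t, t < n -> b t * 4 ^ t.+1 <= W) ->
  3 * 4 ^ n * (\sum_(t < n) b t) + W <= W * 4 ^ n.
Proof.
elim: n => [|n IH] h; first by rewrite big_ord0 muln0 muln1.
rewrite big_ord_recr /= mulnDr.
have h1 := h n (leqnn _).
have : 3 * 4 ^ n * (\sum_(t < n) b t) + W <= W * 4 ^ n.
  by apply: IH => t tn; apply: h; rewrite ltnW.
by move: h1; rewrite !expnS; move: (4 ^ n) (\sum_(_ < _) _) (b n) => P Q c; clear; nia.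
Qed.

Lemma bin_le_exp n k : 'C(n, k) <= n ^ k.
Proof.
apply: leq_trans (ffact_le_exp n k); rewrite -bin_ffact.
by rewrite leq_pmulr // fact_gt0.
Qed.

(** * Induced trees of hyperedges *)

(** The hyperedges [vs e] have two distinguished vertices, the ports
    [pt false e] and [pt true e], which lie in different classes of a partite
    hypergraph.  Trees and cycles are built from the hyperedges of [J] and joined
    at ports only, but they have to be induced with respect to all of [E]. *)
Section Hypergraph.
Variables (E V : finType) (vs : E -> {set V}) (r : nat).
Variables (J : {set E}) (pt : bool -> E -> V) (root : E).

Local Notation cov := (covered vs).

Hypothesis vs_card : forall e, #|vs e| = r.+1.
Hypothesis pt_vs : forall b e, pt b e \in vs e.
Hypothesis pt_neq : forall e e', pt false e != pt true e'.
Hypothesis vs_lin : forall e h, e != h ->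
  {in [predI vs e & vs h] &, forall u u', u = u'}.

Implicit Types (S : {set E}) (wk : E -> seq E).

Lemma pt_negb b e e' : pt (~~ b) e != pt b e'.
Proof. by case: b; rewrite //= eq_sym; exact: pt_neq. Qed.

(** [wk e] is the walk from the root to [e], including [e].  A walk uses the two
    ports alternately, so the parity of its length tells by which port it enters
    its last hyperedge ([bot]) and at which port it may be continued ([top]). *)
Definition top wk e := pt (odd (size (wk e))) e.
Definition bot wk e := pt (~~ odd (size (wk e))) e.
Definition child wk x e := wk e = rcons (wk x) e.

Lemma top_vs wk e : top wk e \in vs e. Proof. exact: pt_vs. Qed.
Lemma bot_top wk e : bot wk e != top wk e. Proof. exact: pt_negb. Qed.

(** Hyperedges of a tree meet only where one hangs on the other, or both hang on a
    third one; [tree_out] makes the tree induced in the ambient hypergraph. *)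
Record tree S wk : Prop := Tree {
  tree_J : {subset S <= J};
  tree_par : forall e, e \in S ->
    (e = root /\ wk e = [:: e]) \/
    exists x, [/\ x \in S, child wk x e & bot wk e = top wk x];
  tree_meet : forall e e' u, e \in S -> e' \in S -> e != e' ->
    u \in vs e -> u \in vs e' ->
    exists x, [/\ x \in S, u = top wk x, e = x \/ child wk x e
                & e' = x \/ child wk x e'];
  tree_out : forall h, h \notin S -> {in [predI vs h & cov S] &, forall u u', u = u'}
}.

Lemma child_parent wk x x' e : (exists w, wk x = rcons w x) -> (exists w, wk x' = rcons w x') ->
  child wk x e -> child wk x' e -> x = x'.
Proof.
move=> [w ew] [w' ew']; rewrite /child => -> /rcons_inj[].
by rewrite ew ew' => /rcons_inj[].
Qed.

Section Tree.
Variables (S : {set E}) (wk : E -> seq E).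
Hypothesis tS : tree S wk.

Lemma wk_rcons e : e \in S -> exists w, wk e = rcons w e.
Proof.
by case/(tree_par tS) => [[_ ->]|[x [_ -> _]]]; [exists [::] | exists (wk x)].
Qed.

Lemma wk_mem e : e \in S -> e \in wk e.
Proof. by case/wk_rcons=> w ->; rewrite mem_rcons mem_head. Qed.

Lemma wk_inj : {in S &, injective wk}.
Proof. by move=> e e' /wk_rcons[w ->] /wk_rcons[w' ->] /rcons_inj[]. Qed.

Lemma wk_gt0 e : e \in S -> 0 < size (wk e).
Proof. by case/wk_rcons=> w ->; rewrite size_rcons. Qed.

Lemma child_bot x e : x \in S -> e \in S -> child wk x e -> bot wk e = top wk x.
Proof.
move=> xS eS ce; case: (tree_par tS eS) => [[_ er]|[x' [x'S ce' ->]]].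
  by have := wk_gt0 xS; move: er; rewrite ce; case: (wk x) => //= ? [].
by congr (top _ _); apply: child_parent ce' ce; exact: wk_rcons.
Qed.

(** A common top of [x] and [y] would also be the top of a hyperedge [z] equal to
    or the parent of each of them; but a child of [z] has the top of [z] as its
    bottom. *)
Lemma top_inj : {in S &, injective (top wk)}.
Proof.
move=> x y xS yS exy; apply/eqP/negPn/negP => nxy.
have [|z [zS exz]] := tree_meet tS xS yS nxy (top_vs wk x).
  by rewrite exy top_vs.
have aux e : e \in S -> top wk e = top wk z -> child wk z e -> False.
  move=> eS et ce; have := bot_top wk e.
  by rewrite (child_bot zS eS ce) et eqxx.
case=> [ex|cx]; last by case: (aux x).
case=> [ey|cy]; last by case: (aux y); rewrite // -exy.
by move: nxy; rewrite ex ey eqxx.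
Qed.

Lemma wk_sub e : e \in S -> {subset wk e <= S}.
Proof.
elim/ltn_ind: {e}(size (wk e)) {-2}e (erefl (size (wk e))) => n IH e sz eS y.
case: (tree_par tS eS) => [[_ ->]|[x [xS ce _]]]; first by rewrite inE => /eqP->.
rewrite ce mem_rcons inE => /orP[/eqP->//|].
by apply: (IH (size (wk x))) => //; rewrite -sz ce size_rcons.
Qed.

Lemma wk_prefix e y : e \in S -> y \in wk e -> exists q, wk e = wk y ++ q.
Proof.
elim/ltn_ind: {e}(size (wk e)) {-2}e (erefl (size (wk e))) => n IH e sz eS.
case: (tree_par tS eS) => [[_ ee]|[x [xS ce _]]].
  by rewrite ee inE => /eqP->; exists [::]; rewrite ee.
rewrite ce mem_rcons inE => /orP[/eqP->|yx]; first by exists [::]; rewrite cats0 ce.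
case: (IH (size (wk x)) _ x) => //; first by rewrite -sz ce size_rcons.
by move=> q ->; exists (rcons q e); rewrite rcons_cat.
Qed.

Lemma wk_uniq e : e \in S -> uniq (wk e).
Proof.
elim/ltn_ind: {e}(size (wk e)) {-2}e (erefl (size (wk e))) => n IH e sz eS.
case: (tree_par tS eS) => [[_ ->]|[x [xS ce _]]]; first by [].
rewrite ce rcons_uniq (IH (size (wk x))) // ?andbT; last by rewrite -sz ce size_rcons.
apply/negP => /(wk_prefix xS)[q]; rewrite ce => /(congr1 size).
by rewrite size_cat size_rcons; lia.
Qed.

Lemma wk_root e : e \in S -> exists q, wk e = root :: q.
Proof.
elim/ltn_ind: {e}(size (wk e)) {-2}e (erefl (size (wk e))) => n IH e sz eS.
case: (tree_par tS eS) => [[-> ->]|[x [xS ce _]]]; first by exists [::].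
case: (IH (size (wk x)) _ x) => //; first by rewrite -sz ce size_rcons.
by move=> q eq; exists (rcons q e); rewrite ce eq.
Qed.

Definition closedS (S' : {set E}) := forall e, e \in S' -> {subset wk e <= S'}.

(** A discarded hyperedge of [S] becomes an outside one.  It touches the rest only
    at the top of its parent, since its own descendants are discarded too. *)
Lemma tree_sub S' : S' \subset S -> closedS S' -> tree S' wk.
Proof.
move=> /subsetP sub cl; split.
- by move=> e /sub /(tree_J tS).
- move=> e eS'; case: (tree_par tS (sub _ eS')) => [|[x [xS ce be]]]; first by left.
  right; exists x; split => //; apply: (cl e eS').
  by rewrite ce mem_rcons inE wk_mem ?orbT.
- move=> e e' u eS eS' ne ue ue'.
  have [x [xS eu hx hx']] := tree_meet tS (sub _ eS) (sub _ eS') ne ue ue'.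
  exists x; split => //.
  case: hx => [<-//|ce]; apply: (cl _ eS).
  by rewrite ce mem_rcons inE wk_mem ?orbT.
- move=> h hS'; case: (boolP (h \in S)) => hS.
    suff aux u : u \in vs h -> u \in cov S' ->
        exists x, [/\ x \in S, u = top wk x & child wk x h].
      move=> u u'; rewrite !inE => /andP[uh uS] /andP[uh' uS'].
      have [x [xS -> cx]] := aux _ uh uS.
      have [x' [xS' -> cx']] := aux _ uh' uS'.
      by congr top; apply: child_parent cx cx'; exact: wk_rcons.
    move=> uh /covP[e eS' ue].
    have ne : h != e by apply: contraNneq hS' => ->.
    have [x [xS eu [hx|cx] [ex|cex]]] := tree_meet tS hS (sub _ eS') ne uh ue.
    + by rewrite hx ex eqxx in ne.
    + by case/negP: hS'; apply: (cl e eS'); rewrite cex hx mem_rcons inE wk_mem ?orbT // -hx.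
    + by exists x.
    + by exists x.
  have sc : cov S' \subset cov S by apply: cov_sub; apply/subsetP.
  move=> u u'; rewrite !inE => /andP[uh /(subsetP sc) uS] /andP[uh' /(subsetP sc) uS'].
  by apply: (tree_out tS hS); rewrite inE /= ?uh ?uS ?uh' ?uS'.
Qed.

Lemma tree_eq wk' : {in S, wk' =1 wk} -> tree S wk'.
Proof.
move=> eqw.
have eqt : {in S, top wk' =1 top wk} by move=> e eS; rewrite /top eqw.
have eqb : {in S, bot wk' =1 bot wk} by move=> e eS; rewrite /bot eqw.
split; first exact: (tree_J tS).
- move=> e eS; case: (tree_par tS eS) => [|[x [xS ce be]]]; first by rewrite eqw //; left.
  by right; exists x; split; rewrite /child ?eqw ?eqb ?eqt.
- move=> e e' u eS eS' ne ue ue'.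
  have [x [xS eu hx hx']] := tree_meet tS eS eS' ne ue ue'.
  by exists x; split => //; rewrite /child ?eqw ?eqt //.
- exact: (tree_out tS).
Qed.

End Tree.

(** The last clause looks one step ahead: a hyperedge [h] with one vertex on [e] and
    another one on the tree would violate [tree_out] once [e] has been added. *)
Definition attachable S wk x e := [/\ e \in J, e \notin S,
  pt (odd (size (wk x))) e = top wk x,
  {in vs e, forall u, u \in cov S -> u = top wk x} &
  forall h u w, h \notin S -> h != e -> u \in vs h -> u \in vs e -> u != top wk x ->
    w \in vs h -> w \in cov S -> False].

Definition upd wk e w := fun y : E => if y == e then w else wk y : seq E.

Lemma tree_attach S wk x e : tree S wk -> x \in S -> attachable S wk x e ->
  tree (e |: S) (upd wk e (rcons (wk x) e)).
Proof.
move=> tS xS [eJ eS epx covx hx]; set wk' := upd _ _ _.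
have eqw : {in S, wk' =1 wk}.
  by move=> y yS; rewrite /wk' /upd; case: eqP => // ye; rewrite ye (negPf eS) in yS.
have wke : wk' e = rcons (wk x) e by rewrite /wk' /upd eqxx.
have eqt : {in S, top wk' =1 top wk} by move=> y yS; rewrite /top eqw.
have tS' := tree_eq tS eqw.
have cxe : child wk' x e by rewrite /child wke eqw.
have meet e' u : e' \in S -> u \in vs e -> u \in vs e' ->
   exists y, [/\ y \in e |: S, u = top wk' y, e = y \/ child wk' y e
                & e' = y \/ child wk' y e'].
  move=> e'S ue ue'; have eu := covx _ ue (mem_cov e'S ue').
  exists x; split; rewrite ?inE ?xS ?orbT ?eqt //; first by right.
  case: (eqVneq e' x) => [|ne]; [by left | right].
  have ux : u \in vs x by rewrite eu top_vs.
  have [y [yS euy h1 h2]] := tree_meet tS' e'S xS ne ue' ux.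
  have exy : x = y by apply: (top_inj tS') => //; rewrite -euy eu eqt.
  by rewrite exy; case: h1 => // e'y; rewrite e'y exy eqxx in ne.
split.
- by move=> y; rewrite !inE => /orP[/eqP->//|/(tree_J tS)].
- move=> y; rewrite !inE => /orP[/eqP->|yS].
    right; exists x; split; rewrite ?inE ?xS ?orbT //.
    by rewrite /bot wke size_rcons /= negbK epx eqt.
  case: (tree_par tS' yS) => [|[z [zS cz bz]]]; first by left.
  by right; exists z; rewrite !inE zS orbT.
- move=> f f' u; rewrite !inE => /orP[/eqP->|fS] /orP[/eqP->|f'S] nf uf uf'.
  + by rewrite eqxx in nf.
  + exact: meet.
  + by have [y [? ? ? ?]] := meet _ _ fS uf' uf; exists y.
  + have [y [? ? ? ?]] := tree_meet tS' fS f'S nf uf uf'.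
    by exists y; rewrite !inE; split => //; apply/orP; right.
- move=> h; rewrite !inE negb_or => /andP[he hS] u u'.
  rewrite covU1 !inE => /andP[uh uc] /andP[uh' uc'].
  have key v v' : v \in vs h -> v' \in vs h -> v \in vs e -> v' \in cov S -> v = v'.
    move=> vh v'h ve v'c; case: (eqVneq v (top wk x)) => [ev|nv]; last first.
      by case: (hx h v v').
    apply: (tree_out tS hS); rewrite !inE /= ?vh ?v'h ?v'c ?andbT //=.
    by rewrite ev (mem_cov xS (top_vs _ _)).
  case/orP: uc => uc; case/orP: uc' => uc'.
  + by apply: (vs_lin he); rewrite inE /= ?uh ?uc ?uh' ?uc'.
  + exact: key.
  + by apply/esym/key.
  + by apply: (tree_out tS hS); rewrite inE /= ?uh ?uc ?uh' ?uc'.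
Qed.

Definition stuck S wk x := forall e, ~ attachable S wk x e.

(** Being stuck is permanent, so that a search may declare a node dead. *)
Lemma stuckS S S' wk wk' x : S \subset S' -> {in S, wk' =1 wk} -> x \in S ->
  stuck S wk x -> stuck S' wk' x.
Proof.
move=> sub eqw xS st e [eJ eS epx covx hx]; apply: (st e).
have sc := cov_sub vs sub.
have et : top wk' x = top wk x by rewrite /top eqw.
split=> //.
- by apply: contraNN eS => /(subsetP sub).
- by rewrite -et -epx eqw.
- by move=> u ue /(subsetP sc) uc; rewrite -et; apply: covx.
move=> h u w hS he uh ue nu wh wc.
case: (boolP (h \in S')) => hS'.
  by case/eqP: nu; rewrite -et; apply: covx => //; apply: mem_cov uh.
by apply: (hx h u w); rewrite // ?et // (subsetP sc).
Qed.

Lemma card_covU1 e S : #|cov (e |: S)| = #|vs e :\: cov S| + #|cov S|.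
Proof.
rewrite covU1 cardsU cardsD; have := subset_leq_card (subsetIl (vs e) (cov S)); lia.
Qed.

Lemma cov_card S : #|cov S| <= r.+1 * #|S|.
Proof.
rewrite mulnC -sum_nat_const; apply: leq_trans (card_bigcup_le _ _) _.
by apply/eq_leq/eq_bigr => e _; exact: vs_card.
Qed.

Variables (d smax : nat).
Hypothesis degJ : forall e b, e \in J -> d <= #|[set e' in J | pt b e' == pt b e]|.
Hypothesis sparse : forall S, #|S| <= smax -> 4 * r * #|S| <= 4 * #|cov S| + #|S|.

(** Of the two obstructions to attaching [e] at [v], the first is a second vertex of
    [e] on the tree, the second a hyperedge [h] closing a cycle with [e]. *)
Definition blocked S e := exists2 v, v \in vs e & v \in cov S /\
  ((exists2 u, u \in vs e & u != v /\ u \in cov S) \/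
   exists h u w, [/\ h \notin S, h != e, u \in vs h, u \in vs e & u != v] /\
                 (w \in vs h /\ w \in cov S)).

(** Add the blocked hyperedges one by one, each together with its [h] where needed.
    One hyperedge then brings at most [r - 1] new vertices, or two of them bring at
    most [2 * r - 1].  So half a vertex is lost per added hyperedge, whereas
    sparsity tolerates the loss of a quarter; the process has to stop while the set
    is still of the order of [#|S|]. *)
Lemma blocked_closure S (L : seq E) : 6 * #|S| + 2 <= smax ->
  (forall e, e \in L -> e \notin S -> blocked S e) ->
  exists Y : {set E}, [/\ S \subset Y, {subset L <= Y}, #|Y| <= 6 * #|S|
    & 2 * #|cov Y| + #|Y| <= 2 * r * #|Y| + 3 * #|S|].
Proof.
move=> Smax; elim: L => [_|e L IH hL].
  exists S; split=> //; first by lia.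
  have := cov_card S; lia.
have [|Y [SY LY Y6 Yex]] := IH; first by move=> f fL; apply: hL; rewrite inE fL orbT.
have sc := subsetP (cov_sub vs SY).
have finish (Y' : {set E}) : Y \subset Y' -> e \in Y' -> #|Y'| <= #|Y| + 2 ->
    2 * #|cov Y'| + #|Y'| <= 2 * r * #|Y'| + 3 * #|S| ->
  exists Y : {set E}, [/\ S \subset Y, {subset e :: L <= Y}, #|Y| <= 6 * #|S|
    & 2 * #|cov Y| + #|Y| <= 2 * r * #|Y| + 3 * #|S|].
  move=> YY' eY' cY' ex; exists Y'; split => //; first exact: subset_trans YY'.
    by move=> f; rewrite inE => /orP[/eqP->//|/LY]; apply: (subsetP YY').
  have /sparse : #|Y'| <= smax by move: cY' Y6 Smax; clear; lia.
  move: ex; clear; nia.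
case: (boolP (e \in Y)) => [eY|eY]; first by apply: (finish Y) => //; lia.
have eS : e \notin S by apply: contraNN eY => /(subsetP SY).
case: (hL e (mem_head _ _) eS) => v ve [vc alt].
have [|] := boolP [exists u, [&& u \in vs e, u != v & u \in cov Y]].
  case/existsP=> u /and3P[ue uv uc].
  apply: (finish (e |: Y)); rewrite ?subsetUr ?setU11 //.
    by rewrite cardsU1 eY add1n addn2 leqnSn.
  rewrite card_covU1 cardsU1 eY.
  have := card_setD_contact2 uv ue ve uc (sc _ vc); rewrite vs_card.
  move: Yex; clear; nia.
move=> none; have only u : u \in vs e -> u != v -> u \notin cov Y.
  by move=> ue uv; apply: contra none => uc; apply/existsP; exists u; rewrite ue uv.
case: alt => [[u ue [uv uc]]|[h [u [w [[hS he uh ue uv] [wh wc]]]]]].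
  by move: (only u ue uv); rewrite sc.
have uc := only u ue uv.
have hY : h \notin Y by apply: contra uc => hY; apply: mem_cov uh.
have heY : h \notin e |: Y by rewrite !inE negb_or he.
apply: (finish (h |: (e |: Y))).
- by apply/subsetP=> f fY; rewrite !inE fY !orbT.
- by rewrite !inE eqxx orbT.
- by rewrite !cardsU1 eY heY !add1n addn2.
rewrite !card_covU1 !cardsU1 eY heY.
have := card_setD_contact ve (sc _ vc); rewrite vs_card.
have uw : u != w by apply: contraNneq uc => ->; exact: sc.
have ucY : u \in cov (e |: Y) by rewrite covU1 inE ue.
have wcY : w \in cov (e |: Y) by rewrite covU1 inE (sc _ wc) orbT.
have := card_setD_contact2 uw uh wh ucY wcY; rewrite vs_card; move: Yex; clear; nia.
Qed.

(** If [x] is stuck then the [d] hyperedges of [J] at its top are all blocked or in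
    [S].  Hence they lie in a closure with at most [6 * #|S|] members, each of which
    is counted at most once for each of its two ports. *)
Lemma stuck_few S wk (Q : {set E}) : tree S wk -> Q \subset S -> 6 * #|S| + 2 <= smax ->
  (forall x, x \in Q -> stuck S wk x) -> d * #|Q| <= 12 * #|S|.
Proof.
move=> tS /subsetP QS Smax st.
pose at_node x := [set e in J | pt (odd (size (wk x))) e == top wk x].
pose L := [seq e <- enum J | [exists x in Q, e \in at_node x]].
case: (@blocked_closure S L Smax).
  move=> e; rewrite mem_filter => /andP[/existsP[x /andP[xQ]]].
  rewrite inE => /andP[eJ /eqP et] _ eS.
  have ve : top wk x \in vs e by rewrite -et.
  exists (top wk x) => //; split; first by apply: (mem_cov (QS _ xQ)); exact: top_vs.
  apply: contrapT => /not_orP[n1 n2]; apply: (st x xQ e); split=> //.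
    move=> u ue uc; apply/eqP/negPn/negP => ux; apply: n1; exists u => //.
  move=> h u w hS he uh ue ux wh wc; apply: n2; exists h, u, w; split=> //.
move=> Y [SY LY Y6 _]; apply: (@leq_trans (2 * #|Y|)); last by lia.
apply: (double_count (A := at_node)) => [x xQ|x xQ|e eY].
- have xS := QS x xQ; apply: leq_trans (degJ (odd (size (wk x))) (tree_J tS xS)) _.
  by apply: subset_leq_card; apply/subsetP=> e; rewrite !inE.
- apply/subsetP=> e ex; apply: LY; rewrite mem_filter mem_enum.
  have eJ : e \in J by move: ex; rewrite inE => /andP[].
  by rewrite eJ andbT; apply/existsP; exists x; rewrite xQ.
- have inj : {in [set x in Q | e \in at_node x] &, injective (fun x => odd (size (wk x)))}.
    move=> x x'; rewrite !inE => /and3P[xQ _ /eqP ex] /and3P[x'Q _ /eqP ex'] eo.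
    by apply: (top_inj tS (QS _ xQ) (QS _ x'Q)); rewrite -ex -ex' eo.
  by rewrite -(card_in_imset inj) -[2]card_bool max_card.
Qed.

(** A path of the tree whose first hyperedge hangs on [x]. *)
Definition leg wk x (l : seq E) :=
  forall j, j < size l -> wk (nth root l j) = wk x ++ take j.+1 l.

Lemma leg_rcons wk x l e : leg wk x l -> wk e = wk x ++ rcons l e -> leg wk x (rcons l e).
Proof.
move=> lg we j; rewrite size_rcons ltnS leq_eqVlt => /orP[/eqP->|jl].
  by rewrite nth_rcons ltnn eqxx we take_oversize ?size_rcons.
by rewrite nth_rcons jl lg // -cats1 takel_cat.
Qed.

Lemma leg_eq wk wk' x l : wk' x = wk x -> {in l, wk' =1 wk} -> leg wk x l -> leg wk' x l.
Proof. by move=> ex el lg j jl; rewrite ex -lg // el // mem_nth. Qed.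

Lemma leg_last wk x l : leg wk x l -> wk (last x l) = wk x ++ l.
Proof.
case/lastP: l => [|l e] lg; first by rewrite cats0.
rewrite last_rcons; have := lg (size l); rewrite size_rcons ltnSn => /(_ isT).
by rewrite nth_rcons ltnn eqxx take_oversize ?size_rcons.
Qed.

Lemma leg_belast wk x l e : leg wk x (rcons l e) -> leg wk x l.
Proof.
move=> lg j jl; have := lg j; rewrite size_rcons ltnS ltnW // => /(_ isT).
by rewrite nth_rcons jl -cats1 takel_cat.
Qed.

Section Leg.
Variables (S B : {set E}) (wk : E -> seq E) (lam : nat).
Hypotheses (tS : tree S wk) (BS : B \subset S).

(** The state of a depth-first search from the nodes of [B]: the tree [R] found so
    far, the current leg [P], and the set [D] of dead nodes.  A new hyperedge is on
    the current leg or dead, so [R] stays small by [stuck_few]. *)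
Record dfs (R : {set E}) (wk' : E -> seq E) (x : E) (P : seq E) (D : {set E}) : Prop := Dfs {
  dfs_tree : tree R wk';
  dfs_sub : S \subset R;
  dfs_wk : {in S, wk' =1 wk};
  dfs_base : x \in B;
  dfs_leg : leg wk' x P;
  dfs_uniq : uniq P;
  dfs_path : {subset P <= R :\: S};
  dfs_live : {in P, forall e, e \notin D};
  dfs_dead : D \subset R;
  dfs_stuck : forall y, y \in D -> stuck R wk' y;
  dfs_card : #|R| <= #|S| + #|D :\: S| + size P;
  dfs_small : 6 * #|R| + 2 <= smax
}.

Hypotheses (d_big : 36 <= d) (B_big : 12 * #|S| < d * #|B|).
Hypothesis small : 12 * (#|S| + lam) + 14 <= smax.

Lemma dfs_room R wk' x P D e : dfs R wk' x P D -> size P <= lam -> e \notin R ->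
  6 * #|e |: R| + 2 <= smax.
Proof.
move=> st Pl eR; rewrite cardsU1 eR.
have := stuck_few (dfs_tree st) (dfs_dead st) (dfs_small st) (dfs_stuck st).
have := dfs_card st; have := subset_leq_card (subsetDl D S).
move: Pl d_big small; clear; nia.
Qed.

Lemma dfs_extend R wk' x P D e : dfs R wk' x P D -> size P < lam ->
  last x P \notin D -> attachable R wk' (last x P) e ->
  dfs (e |: R) (upd wk' e (rcons (wk' (last x P)) e)) x (rcons P e) D.
Proof.
move=> st Pl tipD at_e; have [eJ eR _ _ _] := at_e.
have xR : x \in R by apply: (subsetP (dfs_sub st)); apply: (subsetP BS); exact: dfs_base st.
have tipR : last x P \in R.
  have := mem_last x P; rewrite inE => /orP[/eqP->//|/(dfs_path st)].
  by rewrite inE => /andP[].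
have eS : e \notin S by apply: contraNN eR => /(subsetP (dfs_sub st)).
have eqw : {in R, upd wk' e (rcons (wk' (last x P)) e) =1 wk'}.
  by move=> y yR; rewrite /upd; case: eqP => // ye; rewrite ye (negPf eR) in yR.
have eP : e \notin P.
  by apply: contraNN eR => /(dfs_path st); rewrite inE => /andP[].
split.
- exact: tree_attach (dfs_tree st) tipR at_e.
- by apply/subsetP=> y /(subsetP (dfs_sub st)) yR; rewrite !inE yR orbT.
- by move=> y yS; rewrite eqw ?(dfs_wk st) // (subsetP (dfs_sub st)).
- exact: dfs_base st.
- apply: leg_rcons; last first.
    by rewrite {1}/upd eqxx eqw // (leg_last (dfs_leg st)) rcons_cat.
  apply: leg_eq (dfs_leg st); first by rewrite eqw.
  by move=> y /(dfs_path st); rewrite inE => /andP[_ yR]; rewrite eqw.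
- by rewrite rcons_uniq eP (dfs_uniq st).
- move=> y; rewrite mem_rcons inE => /orP[/eqP->|/(dfs_path st)].
    by rewrite !inE eqxx eS.
  by rewrite !inE => /andP[-> ->]; rewrite orbT.
- move=> y; rewrite mem_rcons inE => /orP[/eqP->|/(dfs_live st)//].
  by apply: contraNN eR => /(subsetP (dfs_dead st)).
- by apply/subsetP=> y /(subsetP (dfs_dead st)) yR; rewrite !inE yR orbT.
- move=> y yD; apply: stuckS eqw _ (dfs_stuck st yD); first exact: subsetUr.
  exact: (subsetP (dfs_dead st)).
- by rewrite cardsU1 eR size_rcons; have := dfs_card st; lia.
- by apply: dfs_room st _ eR; lia.
Qed.

Lemma dfs_kill R wk' x P D : dfs R wk' x P D ->
  last x P \notin D -> stuck R wk' (last x P) ->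
  exists2 P', dfs R wk' x P' (last x P |: D) & size P' <= size P.
Proof.
move=> st tipD tip_stuck.
have xS : x \in S by apply: (subsetP BS); exact: dfs_base st.
have xR := subsetP (dfs_sub st) _ xS.
have stD e : stuck R wk' e -> forall y, y \in e |: D -> stuck R wk' y.
  by move=> se y; rewrite !inE => /orP[/eqP->//|/(dfs_stuck st)].
case/lastP: P st tipD tip_stuck => [|P e] st tipD tip_stuck.
  exists [::] => //; case: st => *; split=> //=; first by rewrite subUset sub1set xR.
  - exact: stD.
  - suff -> : (x |: D) :\: S = D :\: S by [].
    apply/setP=> y; rewrite !inE; case: (boolP (y \in S)) => //= yS.
    by case: eqP => // yx; rewrite yx xS in yS.
rewrite last_rcons in tipD tip_stuck *.
have := dfs_path st; have := dfs_uniq st; rewrite rcons_uniq => /andP[eP uP] pathP.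
have [eS eR] : e \notin S /\ e \in R.
  by have := pathP e; rewrite mem_rcons mem_head !inE => /(_ isT) /andP[].
exists P; last by rewrite size_rcons.
case: st => tR SR eqw xB lg _ _ liveP DR stD' cR sR; split=> //.
- exact: leg_belast lg.
- by move=> y yP; apply: pathP; rewrite mem_rcons inE yP orbT.
- move=> y yP; rewrite !inE negb_or liveP ?mem_rcons ?inE ?yP ?orbT // andbT.
  by apply: contraNneq eP => <-.
- by rewrite subUset sub1set eR.
- exact: stD.
- rewrite (_ : (e |: D) :\: S = e |: (D :\: S)); last first.
    by apply/setP=> y; rewrite !inE; case: eqP => // ->; rewrite eS.
  rewrite cardsU1 !inE (negPf tipD) andbF; move: cR; rewrite size_rcons.
  by rewrite addnS add1n addnS addSn.
Qed.

(** The search extends the current leg while it can; otherwise it declares the end of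
    the leg dead and steps back.  It cannot kill all of [B], because few nodes are
    stuck, and so it finds a leg of length [lam]; whatever else has been explored
    may be discarded. *)
Lemma leg_exists : exists S' wk' x l, [/\ tree S' wk', {in S, wk' =1 wk}, x \in B,
  leg wk' x l & [/\ size l = lam, uniq l, {in l, forall e, e \notin S}
    & S' = S :|: [set e in l]]].
Proof.
have B0 : exists x, x \in B.
  by apply/set0Pn; rewrite -cards_eq0; move: B_big; clear; nia.
(* [#|R| + #|D|] increases with every step of the search *)
suff main n : exists R wk' x P D, [/\ dfs R wk' x P D, size P <= lam &
    size P = lam \/ n <= #|R| + #|D|].
  have [R [wk' [x [P [D [st _ [szP|]]]]]]] := main (#|E| + #|E|).+1; last first.
    by have := max_card R; have := max_card D; clear; lia.
  exists (S :|: [set e in P]), wk', x, P; split; try by case: st.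
    apply: (tree_sub (dfs_tree st)).
      rewrite subUset (dfs_sub st); apply/subsetP=> e; rewrite inE.
      by move/(dfs_path st); rewrite inE => /andP[].
    move=> e; rewrite inE => /orP[eS|]; last first.
      rewrite inE => /(nthP root)[j jP <-]; rewrite (dfs_leg st) //.
      move=> y; rewrite mem_cat => /orP[|/mem_take yP]; last by rewrite !inE yP orbT.
      have xS := subsetP BS _ (dfs_base st).
      by rewrite (dfs_wk st xS) => /(wk_sub tS xS) yS; rewrite inE yS.
    by rewrite (dfs_wk st eS) => y /(wk_sub tS eS) yS; rewrite inE yS.
  split=> //; first exact: dfs_uniq st.
  by move=> e /(dfs_path st); rewrite inE => /andP[].
elim: n => [|n [R [wk' [x [P [D [st szP alt]]]]]]].
  case: B0 => x xB; exists S, wk, x, [::], set0; split=> //; last by right.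
  split=> //; rewrite ?sub0set //; try by move=> y; rewrite inE.
    by rewrite set0D cards0 !addn0.
  by move: small; clear; lia.
case: alt => [szP'|le_n]; first by exists R, wk', x, P, D; split=> //; left.
case: (ltnP (size P) lam) => ltP; last first.
  by exists R, wk', x, P, D; split=> //; left; apply/eqP; rewrite eqn_leq szP.
wlog tipD : x P st szP ltP / last x P \notin D => [hw|].
  case: (boolP (last x P \in D)); last exact: hw.
  case/lastP: P st szP ltP => [|P e] st szP ltP; last first.
    by rewrite last_rcons (negPf (dfs_live st _)) // mem_rcons mem_head.
  move=> _; case: (pickP [pred y in B | y \notin D]) => [y /andP[yB yD]|allD].
    apply: (hw y [::]) => //.
    by case: st => *; split.
  have BD : B \subset D.
    by apply/subsetP=> y yB; have := allD y; rewrite /= yB => /negbFE.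
  have := stuck_few (dfs_tree st) (dfs_dead st) (dfs_small st) (dfs_stuck st).
  have := dfs_card st; rewrite addn0.
  have : #|B| + #|D :\: S| <= #|D|.
    rewrite -(cardsID S D) leq_add2r; apply: subset_leq_card.
    by rewrite subsetI BD.
  by move: B_big d_big; clear; nia.
case: (pselect (stuck R wk' (last x P))) => [tip|].
  have [P' st' szP'] := dfs_kill st tipD tip.
  exists R, wk', x, P', (last x P |: D); split=> //; first exact: leq_trans szP.
  by right; rewrite cardsU1 tipD addnCA.
move=> /existsNP[e /contrapT at_e].
have [_ eR _ _ _] := at_e.
exists (e |: R), (upd wk' e (rcons (wk' (last x P)) e)), x, (rcons P e), D.
split; rewrite ?size_rcons //; first exact: dfs_extend.
by right; rewrite cardsU1 eR.
Qed.

End Leg.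

Lemma uniq_flatten_disjoint (T : eqType) (ss : seq (seq T)) i j e :
  uniq (flatten ss) -> e \in nth [::] ss i -> e \in nth [::] ss j -> i = j.
Proof.
elim: ss i j => [|s ss IH] [|i] [|j] //=; rewrite cat_uniq => /and3P[us dis uss] ei ej.
- case/hasP: dis; exists e => //; apply/flattenP; exists (nth [::] ss j) => //.
  by apply: mem_nth; case: (ltnP j (size ss)) ej => // /(nth_default [::]) ->.
- case/hasP: dis; exists e => //; apply/flattenP; exists (nth [::] ss i) => //.
  by apply: mem_nth; case: (ltnP i (size ss)) ei => // /(nth_default [::]) ->.
- by congr _.+1; apply: IH ej.
Qed.

Section Level.
Variables (S : {set E}) (wk : E -> seq E) (I : finType) (Ix : {set I}).
Variables (B : I -> {set E}) (beta q lam : nat).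
Hypotheses (tS : tree S wk) (BS : forall i, i \in Ix -> B i \subset S).
Hypothesis B_card : forall i, i \in Ix -> #|B i| = beta.
Hypothesis B_dis : {in Ix &, forall i j e, e \in B i -> e \in B j -> i = j}.
Hypothesis d_big : 36 <= d.
Hypothesis B_big : 24 * (#|S| + #|Ix| * q * lam) < d * (beta * #|Ix|).
Hypothesis small : 12 * (#|S| + #|Ix| * q * lam + lam) + 14 <= smax.

(** Disjoint legs of length [lam], at most [q] for each of the bases [B i]. *)
Record legs (S' : {set E}) (wk' : E -> seq E) (L : I -> seq (seq E)) : Prop := Legs {
  legs_tree : tree S' wk';
  legs_sub : S \subset S';
  legs_wk : {in S, wk' =1 wk};
  legs_leg : forall i l, l \in L i -> size l = lam /\ exists2 x, x \in B i & leg wk' x l;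
  legs_size : forall i, size (L i) <= q;
  legs_idx : forall i, L i != [::] -> i \in Ix;
  legs_new : forall i e, e \in flatten (L i) -> e \in S' :\: S;
  legs_uniq : forall i, uniq (flatten (L i));
  legs_dis : forall i j e, e \in flatten (L i) -> e \in flatten (L j) -> i = j;
  legs_card : #|S'| <= #|S| + lam * \sum_i size (L i)
}.

Lemma legs_total S' wk' L : legs S' wk' L -> \sum_i size (L i) <= #|Ix| * q.
Proof.
move=> st; rewrite -sum_nat_const [leqRHS]big_mkcond /=; apply: leq_sum => i _.
case: ifP => [_|iI]; first exact: legs_size st _.
by case: (eqVneq (L i) [::]) => [->//|/(legs_idx st)]; rewrite iI.
Qed.

(** If more than half of the bases still lack a leg, these bases have so many nodes in
    total that they are not all stuck during a search for another leg. *)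
Lemma legs_step S' wk' L : legs S' wk' L ->
  #|Ix| < 2 * #|[set i in Ix | size (L i) < q]| ->
  exists S2 wk2 L2, legs S2 wk2 L2 /\ \sum_i size (L2 i) = (\sum_i size (L i)).+1.
Proof.
move=> st; set F := [set _ in _ | _] => F_big.
have FI : F \subset Ix by apply/subsetP=> i; rewrite inE => /andP[].
pose BB := \bigcup_(i in F) B i.
have BBS' : BB \subset S'.
  apply/bigcupsP=> i /(subsetP FI) iI; apply: subset_trans (legs_sub st); exact: BS.
have cardBB : beta * #|F| <= #|BB|.
  rewrite -[#|BB|]mul1n; apply: (double_count (A := B)).
  - by move=> i /(subsetP FI) iI; rewrite B_card.
  - by move=> i iF; apply: bigcup_sup.
  move=> e _; rewrite leqNgt; apply/negP => /card_gt1P[i [j [iF jF]]].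
  move: iF jF; rewrite inE => /andP[/(subsetP FI) iI ei].
  rewrite inE => /andP[/(subsetP FI) jI ej].
  by rewrite (B_dis iI jI ei ej) eqxx.
have tot := legs_total st; have cS' := legs_card st.
have tot' : lam * \sum_i size (L i) <= #|Ix| * q * lam by rewrite mulnC leq_mul.
have [|||S2 [wk2 [x [l [t2 eqw2 xB lg [szl ul newl eS2]]]]]] :=
  @leg_exists S' BB wk' lam (legs_tree st) BBS'.
- exact: d_big.
- have h2 : d * (beta * #|Ix|) <= d * (beta * (2 * #|F|)) by rewrite !leq_mul // ltnW.
  have h3 := leq_mul (leqnn d) cardBB.
  by move: h2 h3 B_big cS' tot'; clear; nia.
- by move: small cS' tot'; clear; lia.
have [i iF xBi] : exists2 i, i \in F & x \in B i by move/bigcupP: xB.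
have iI := subsetP FI _ iF.
have sumL2 : \sum_j size (if j == i then l :: L i else L j) = (\sum_j size (L j)).+1.
  rewrite (bigD1 i) //= eqxx /= [in RHS](bigD1 i) //= addSn; congr (_ + _).+1.
  by apply: eq_bigr => j /negPf->.
exists S2, wk2, (fun j => if j == i then l :: L i else L j); split; last exact: sumL2.
have SS2 : S' \subset S2 by rewrite eS2 subsetUl.
have lS2 e : e \in l -> e \in S2 :\: S.
  move=> el; rewrite eS2 !inE el orbT andbT.
  by apply: contraNN (newl e el) => /(subsetP (legs_sub st)).
have oldnew j e : e \in flatten (L j) -> e \notin l.
  move=> ej; have := legs_new st ej; rewrite inE => /andP[_ eS'].
  by apply/negP=> /newl; rewrite eS'.
have oldleg j l' : l' \in L j -> size l' = lam /\ exists2 y, y \in B j & leg wk2 y l'.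
  move=> l'L; have [-> [y yB lg']] := legs_leg st l'L; split=> //; exists y => //.
  have jI : j \in Ix by apply: (legs_idx st); case: (L j) l'L.
  apply: leg_eq lg'; first by rewrite eqw2 // (subsetP (legs_sub st)) // (subsetP (BS jI)).
  move=> e el; rewrite eqw2 //.
  have : e \in flatten (L j) by apply/flattenP; exists l'.
  by move/(legs_new st); rewrite inE => /andP[].
split.
- exact: t2.
- exact: subset_trans (legs_sub st) SS2.
- by move=> e eS; rewrite eqw2 ?(legs_wk st) // (subsetP (legs_sub st)).
- move=> j l'; case: eqP => [->|_]; last exact: oldleg.
  rewrite inE => /orP[/eqP->|]; last exact: oldleg.
  by split=> //; exists x.
- move=> j; case: eqP => _; last exact: legs_size st _.
  by move: iF; rewrite inE => /andP[].
- by move=> j; case: (j =P i) => [->//|_]; exact: legs_idx st _.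
- have old j e : e \in flatten (L j) -> e \in S2 :\: S.
    by move/(legs_new st); rewrite !inE => /andP[-> /(subsetP SS2)].
  move=> j e; case: eqP => [_|_]; last exact: old.
  by rewrite /= mem_cat => /orP[|]; [exact: lS2 | exact: old].
- move=> j; case: eqP => [_|_]; last exact: legs_uniq st _.
  rewrite /= cat_uniq ul (legs_uniq st) andbT /=.
  by apply/hasPn=> e; exact: oldnew.
- move=> j j' e; case: (eqVneq j i) => [->|nj]; case: (eqVneq j' i) => [->//|nj'].
  + rewrite /= mem_cat => /orP[el /oldnew|]; first by rewrite el.
    by move=> h1 h2; have := legs_dis st h1 h2.
  + rewrite /= mem_cat => h1 /orP[el|h2]; last by have := legs_dis st h1 h2.
    by have := oldnew _ _ h1; rewrite el.
  + by move=> h1 h2; have := legs_dis st h1 h2.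
- rewrite sumL2 mulnS [lam + _]addnC addnA.
  have : #|S2| <= #|S'| + lam.
    by rewrite eS2 (leq_trans (leq_card_setU _ _)) // leq_add2l cardsE -szl card_size.
  by move=> h; apply: leq_trans h _; rewrite leq_add2r.
Qed.

Lemma level : exists S' wk' L, legs S' wk' L /\
  #|Ix| <= 2 * #|[set i in Ix | size (L i) == q]|.
Proof.
suff main n : exists S' wk' L, legs S' wk' L /\
    (#|Ix| <= 2 * #|[set i in Ix | size (L i) == q]| \/ n <= \sum_i size (L i)).
  have [S' [wk' [L [st [?|]]]]] := main (#|Ix| * q).+1; first by exists S', wk', L.
  by rewrite ltnNge (legs_total st).
elim: n => [|n [S' [wk' [L [st alt]]]]].
  exists S, wk, (fun=> [::]); split; last by right.
  by split=> //=; rewrite ?leq_addr.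
case: alt => [?|le_n]; first by exists S', wk', L; split=> //; left.
case: (ltnP (#|Ix|) (2 * #|[set i in Ix | size (L i) < q]|)) => [big|few].
  have [S2 [wk2 [L2 [st2 e2]]]] := legs_step st big.
  by exists S2, wk2, L2; split=> //; right; rewrite e2.
exists S', wk', L; split=> //; left.
have : #|Ix| <= #|[set i in Ix | size (L i) == q]| + #|[set i in Ix | size (L i) < q]|.
  apply: leq_trans (leq_card_setU _ _); apply/subset_leq_card/subsetP=> i iI.
  by rewrite !inE iI /= -leq_eqVlt (legs_size st).
by move: few; clear; lia.
Qed.

End Level.

Lemma tree_root : root \in J -> tree [set root] (fun e => [:: e]).
Proof.
move=> rJ; split.
- by move=> e; rewrite inE => /eqP->.
- by move=> e; rewrite inE => /eqP->; left.
- by move=> e e' u; rewrite !inE => /eqP-> /eqP->; rewrite eqxx.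
- move=> h; rewrite inE /covered big_set1 => ne u u' h1 h2.
  exact: (vs_lin ne).
Qed.

Lemma uniq_flatten_mem (T : eqType) (ss : seq (seq T)) s :
  uniq (flatten ss) -> s \in ss -> uniq s.
Proof.
elim: ss => //= s' ss IH; rewrite cat_uniq => /and3P[us _ uss].
by rewrite inE => /orP[/eqP->//|]; exact: IH.
Qed.

Variable X : nat.
Hypotheses (X_gt2 : 2 < X) (d_X : 72 + 48 * X ^ 2 < d) (root_J : root \in J).

(** * Spiders and layers *)

(** An upper bound for the length of the walk from the root to the place where a leg
    of the [j]-th level starts. *)
Fixpoint mu u j := if j is j'.+1 then mu u j' + X ^ j' * u else 1.

(** The legs of each level are [X] times as long as those of the level before, on
    which they hang.  Hence the legs of the last level are long in comparison with
    everything that leads to them, wherever they are attached, and the lengths of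
    the walks to their ends are nearly determined. *)
Record spider u j (S : {set E}) wk (I : finType) (Ix : {set I}) (lf : I -> seq E) : Prop :=
  Spider {
  spider_tree : tree S wk;
  spider_card : #|S| <= 3 * (#|Ix| * (X ^ j * u));
  spider_legs : X ^ j <= #|Ix| <= (2 * X) ^ j;
  spider_leg : forall i, i \in Ix ->
    exists x, [/\ x \in S, size (wk x) <= mu u j & leg wk x (lf i)];
  spider_size : forall i, i \in Ix -> size (lf i) = X ^ j * u;
  spider_uniq : forall i, i \in Ix -> uniq (lf i);
  spider_sub : forall i, i \in Ix -> {subset lf i <= S};
  spider_dis : {in Ix &, forall i i' e, e \in lf i -> e \in lf i' -> i = i'}
}.

(** In each step [2 * X] new legs are hung on every old leg; half of the old legs may
    fail to carry that many, and a factor [X] remains. *)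
Lemma spider_exists u j : 0 < u -> 72 * ((2 * X) ^ j * (X ^ j * u)) + 14 <= smax ->
  exists S wk (I : finType) (Ix : {set I}) lf, spider u j S wk Ix lf.
Proof.
move=> u0; have d36 : 36 <= d by move: X_gt2 d_X; clear; nia.
elim: j => [|j IH] small.
  have [||S [wk [x [l [t eqw xB lg [sz un new eS]]]]]] :=
    @leg_exists [set root] [set root] (fun e => [:: e]) u (tree_root root_J) (subxx _) d36.
  - by rewrite cards1; move: d36; clear; lia.
  - by rewrite cards1; move: small u0; clear; lia.
  exists S, wk, unit, [set: unit], (fun=> l); split=> //.
  - rewrite cardsT card_unit expn0 !mul1n eS.
    apply: leq_trans (leq_card_setU _ _) _; rewrite cards1.
    have : #|[set e in l]| <= u by rewrite cardsE -sz card_size.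
    by move: u0; clear; lia.
  - by rewrite cardsT card_unit.
  - move=> _ _; exists root; split; first by rewrite eS !inE eqxx.
      by rewrite eqw // inE.
    by move: xB; rewrite inE => /eqP<-.
  - by rewrite expn0 mul1n.
  - by move=> _ _ e el; rewrite eS !inE el orbT.
  - by move=> [] [].
have [|S [wk [I [Ix [lf sp]]]]] := IH.
  apply: leq_trans small; rewrite leq_add2r leq_mul2l /=.
  rewrite !expnS; have p1 : 0 < 2 * X by move: X_gt2; clear; lia.
  rewrite leq_mul // ?leq_pmull // leq_mul // leq_pmull //; move: X_gt2; clear; lia.
have [t cS /andP[I1 I2] lgs szs uns subs dis] := sp.
set be := X ^ j * u in cS szs *.
have be0 : 0 < be by rewrite muln_gt0 expn_gt0 u0 andbT; move: X_gt2; clear; lia.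
have Ix0 : 0 < #|Ix| by apply: leq_trans I1; rewrite expn_gt0; move: X_gt2; clear; lia.
have eX : X ^ j.+1 * u = X * be by rewrite expnS mulnA.
have [|||||S' [wk' [L [st many]]]] :=
  @level S wk I Ix (fun i => [set e in lf i]) be (2 * X) (X * be) t _ _ _ d36.
- by move=> i iI; apply/subsetP=> e; rewrite inE; exact: subs.
- by move=> i iI; rewrite cardsE -(szs i iI); apply/card_uniqP; exact: uns.
- by move=> i i' iI i'I e; rewrite !inE; exact: dis.
- have : 24 * (3 * (#|Ix| * be) + 2 * X ^ 2 * (#|Ix| * be)) < d * (#|Ix| * be).
    have : 0 < #|Ix| * be by rewrite muln_gt0 Ix0.
    by move: d_X; clear; nia.
  rewrite [be * _]mulnC (_ : #|Ix| * (2 * X) * (X * be) = 2 * X ^ 2 * (#|Ix| * be)); last first.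
    by clear; nia.
  by move: cS; clear; nia.
- have h : #|Ix| * be <= (2 * X) ^ j * be by rewrite leq_mul.
  move: small; rewrite eX expnS.
  have h1 : be <= #|Ix| * be by rewrite leq_pmull.
  have h2 : 2 * X ^ 2 * (#|Ix| * be) <= 2 * X * (2 * X) ^ j * (X * be).
    by move: h; clear; nia.
  have h3 : X * be <= X ^ 2 * (#|Ix| * be) by move: h1 X_gt2; clear; nia.
  have h4 : 3 * (#|Ix| * be) <= X ^ 2 * (#|Ix| * be) by move: X_gt2; clear; nia.
  rewrite (_ : #|Ix| * (2 * X) * (X * be) = 2 * X ^ 2 * (#|Ix| * be)); last first.
    by clear; nia.
  by move: h2 h3 h4 cS; clear; lia.
set good := [set i in Ix | size (L i) == 2 * X] in many.
pose Ix' := setX good [set: 'I_(2 * X)].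
have cI' : #|Ix'| = #|good| * (2 * X) by rewrite cardsX cardsT card_ord.
have goodP i : i \in good -> i \in Ix /\ size (L i) = 2 * X.
  by rewrite inE => /andP[iI /eqP].
pose lf' (p : I * 'I_(2 * X)) := nth [::] (L p.1) p.2.
have lfL p : p \in Ix' -> lf' p \in L p.1.
  by case: p => i c; rewrite inE => /andP[/goodP[_ sz] _]; rewrite mem_nth ?sz.
have lf_flat p : p \in Ix' -> {subset lf' p <= flatten (L p.1)}.
  by move=> pI e ep; apply/flattenP; exists (lf' p) => //; exact: lfL.
exists S', wk', (I * 'I_(2 * X))%type, Ix', lf'; split.
- exact: legs_tree st.
- have tot := leq_mul (leqnn (X * be)) (legs_total st).
  rewrite cI' eX; move: (legs_card st) tot cS many X_gt2; clear.
  rewrite (_ : X * be * (#|Ix| * (2 * X)) = 2 * X ^ 2 * (#|Ix| * be)); last by nia.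
  move=> h1 h2 h3 h4 h5.
  have : #|Ix| * (X ^ 2 * be) <= 2 * #|good| * (X ^ 2 * be) by rewrite leq_mul.
  have : 4 * (#|Ix| * be) <= X ^ 2 * (#|Ix| * be) by rewrite leq_mul //; nia.
  by lia.
- have gI : #|good| <= #|Ix| by apply/subset_leq_card/subsetP=> i /goodP[].
  rewrite cI' !expnS; apply/andP; split; first by move: many I1; clear; nia.
  by rewrite mulnC leq_mul // (leq_trans gI).
- move=> p pI; have [_ [x]] := legs_leg st (lfL p pI).
  rewrite inE => xl lg; have /goodP[iI _] : p.1 \in good by move: pI; rewrite inE => /andP[].
  have xS := subs _ iI _ xl; exists x; split=> //; first exact: (subsetP (legs_sub st)).
  rewrite (legs_wk st xS) /=; have [x0 [x0S sz0 lg0]] := lgs _ iI.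
  move: xl => /(nthP root)[c cl <-]; rewrite lg0 // size_cat leq_add //.
  by rewrite -/be -(szs _ iI) size_takel.
- by move=> p pI; have [-> _] := legs_leg st (lfL p pI).
- by move=> p pI; apply: uniq_flatten_mem (legs_uniq st p.1) (lfL p pI).
- by move=> p pI e /(lf_flat p pI) /(legs_new st); rewrite inE => /andP[].
- move=> [i c] [i' c'] pI p'I e ep ep'.
  have ii := legs_dis st (lf_flat _ pI _ ep) (lf_flat _ p'I _ ep').
  rewrite /= in ii; rewrite -ii in ep' *; congr (_, _); apply: val_inj => /=.
  exact: uniq_flatten_disjoint (legs_uniq st i) ep ep'.
Qed.

(** Legs of length one: in [t] rounds each end set grows by the factor [X ^ t], at most
    half of the indices get lost per round, and the last layer stays a proportion of
    order [1 / X] of the whole tree. *)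
Lemma layers S wk (I : finType) (Ix : {set I}) (C : I -> {set E}) sigma t :
  tree S wk -> (forall i, i \in Ix -> C i \subset S) ->
  (forall i, i \in Ix -> #|C i| = sigma) ->
  {in Ix &, forall i j e, e \in C i -> e \in C j -> i = j} ->
  0 < sigma -> 0 < #|Ix| -> #|S| <= 4 * X * (#|Ix| * sigma) ->
  72 * X * (#|Ix| * (X ^ t * sigma)) + 14 <= smax ->
  exists S' wk' (Ix' : {set I}) (C' : I -> {set E}),
  [/\ tree S' wk', S \subset S', {in S, wk' =1 wk}, Ix' \subset Ix
    & [/\ #|Ix| <= 2 ^ t * #|Ix'|, #|S'| <= 4 * X * (#|Ix'| * (X ^ t * sigma)),
          {in Ix' &, forall i j e, e \in C' i -> e \in C' j -> i = j},
          forall i, i \in Ix' -> #|C' i| = X ^ t * sigma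
        & forall i e, i \in Ix' -> e \in C' i -> e \in S' /\ exists e0 p,
          [/\ e0 \in C i, size p = t, wk' e = wk e0 ++ p & {subset p <= S' :\: S}]]].
Proof.
move=> tS CS Cc Cd s0 I0 cS; have d36 : 36 <= d by move: X_gt2 d_X; clear; nia.
elim: t => [|t IH] small.
  exists S, wk, Ix, C; split=> //; split=> //; rewrite ?expn0 ?mul1n //.
  move=> i e iI eC; split; first exact: subsetP (CS i iI) e eC.
  by exists e, [::]; rewrite cats0.
have X0 : 0 < X by move: X_gt2; clear; lia.
have [|S1 [wk1 [I1 [C1 [t1 SS1 eqw1 II1 [cI1 cS1 dis1 card1 C1P]]]]]] := IH.
  apply: leq_trans small; rewrite leq_add2r leq_mul2l leq_mul2l leq_mul2r leq_pexp2l //.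
  by rewrite !orbT.
set be := X ^ t * sigma in cS1 card1.
have be0 : 0 < be by rewrite muln_gt0 expn_gt0 X0.
have I10 : 0 < #|I1|.
  by move: I0 cI1; case: #|I1| => // ; rewrite muln0 leqn0 => /prednK <-.
have eX : X ^ t.+1 * sigma = X * be by rewrite expnS mulnA.
have [|||||S2 [wk2 [L [st many]]]] :=
  @level S1 wk1 I I1 C1 be (X * be) 1 t1 _ _ _ d36.
- by move=> i iI; apply/subsetP=> e eC; have [] := C1P _ _ iI eC.
- exact: card1.
- exact: dis1.
- have : 24 * (4 * X * (#|I1| * be) + X * (#|I1| * be)) < d * (#|I1| * be).
    have K0 : 0 < #|I1| * be by rewrite muln_gt0 I10.
    have dX : 120 * X < d by move: d_X X_gt2; clear; nia.
    rewrite (_ : 24 * _ = 120 * X * (#|I1| * be)) ?ltn_pmul2r //.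
    by clear; lia.
  rewrite [be * _]mulnC (_ : #|I1| * (X * be) * 1 = X * (#|I1| * be)); last first.
    by clear; nia.
  by move: cS1; clear; nia.
- have h : #|I1| * be <= #|Ix| * be by rewrite leq_mul // subset_leq_card.
  have h0 : 0 < #|I1| * be by rewrite muln_gt0 I10.
  move: small; rewrite eX => small.
  have h1 : X * (X * (#|I1| * be)) <= X * (#|Ix| * (X * be)) by move: h; clear; nia.
  have h2 : 2 * X * (#|I1| * be) <= X * (X * (#|I1| * be)) by move: X_gt2; clear; nia.
  rewrite (_ : #|I1| * (X * be) * 1 = X * (#|I1| * be)); last by clear; nia.
  have h3 : 1 <= X * (#|I1| * be) by move: h0 X0; clear; nia.
  by move: cS1 small h1 h2 h3; clear; nia.
set good := [set i in I1 | size (L i) == X * be] in many.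
have goodP i : i \in good -> i \in I1 /\ size (L i) = X * be.
  by rewrite inE => /andP[iI /eqP].
have I1S i : i \in I1 -> C1 i \subset S1.
  by move=> iI; apply/subsetP=> e eC; have [] := C1P _ _ iI eC.
exists S2, wk2, good, (fun i => [set e in flatten (L i)]).
split; [exact: legs_tree st | exact: subset_trans (legs_sub st) | | |split].
- by move=> e eS; rewrite (legs_wk st) ?eqw1 // (subsetP SS1).
- by apply: subset_trans II1; apply/subsetP=> i /goodP[].
- by rewrite expnS; move: many cI1; clear; nia.
- have tot := leq_mul (leqnn 1) (legs_total st); rewrite eX.
  move: (legs_card st) tot cS1 many; clear -X_gt2.
  rewrite (_ : 1 * (#|I1| * (X * be)) = X * (#|I1| * be)); last by nia.
  move=> h1 h2 h3 h4.
  have : #|I1| * (X * be) <= 2 * #|good| * (X * be) by rewrite leq_mul.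
  have : #|good| * (X * be) * 3 <= #|good| * (X * be) * X by rewrite leq_mul.
  by lia.
- by move=> i j /goodP[iI _] /goodP[jI _] e; rewrite !inE => h1 h2; have := legs_dis st h1 h2.
- move=> i /goodP[iI szL]; rewrite cardsE; have /card_uniqP -> := legs_uniq st i.
  have /all_pred1P e1 : all (pred1 1) (shape (L i)).
    by apply/allP=> _ /mapP[l lL ->]; have [/= -> _] := legs_leg st lL.
  by rewrite size_flatten e1 sumn_nseq size_map mul1n szL eX.
- move=> i e /goodP[iI szL]; rewrite inE => eL.
  have := legs_new st eL; rewrite inE => /andP[eS1 eS2]; split=> //.
  have /flattenP[l lL el] := eL.
  have [szl [x xC lg]] := legs_leg st lL.
  have le : l = [:: e] by case: l szl el {lL lg} => [|y [|]] //= _; rewrite inE => /eqP->.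
  have [xS1 [e0 [p [e0C szp wkx psub]]]] := C1P _ _ iI xC.
  exists e0, (rcons p e); split=> //; first by rewrite size_rcons szp.
    have := lg 0; rewrite le /= => -> //.
    by rewrite (legs_wk st xS1) wkx -catA cats1.
  move=> y; rewrite mem_rcons inE => /orP[/eqP->|/psub].
    by rewrite inE eS2 andbT; apply: contraNN eS1 => /(subsetP SS1).
  by rewrite !inE => /andP[-> yS1]; rewrite (subsetP (legs_sub st)).
Qed.

Variable g : nat.
Hypothesis girth : forall S, 0 < #|S| <= g -> r * #|S| < #|cov S|.

(** * Closing a cycle of hyperedges *)

(** The first hypothesis says that [S] is connected and without cycles, or at least
    that it covers as few vertices as such a set does.  Adding a hyperedge with two
    contacts would violate the girth condition. *)
Lemma acyclic_contact S h : #|cov S| <= r * #|S| + 1 -> #|S| < g -> h \notin S ->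
  {in [predI vs h & cov S] &, forall u u', u = u'}.
Proof.
move=> conn Sg hS u u'; rewrite !inE => /andP[uh uc] /andP[uh' uc'].
apply/eqP/negPn/negP => ne.
have := @girth (h |: S); rewrite cardsU1 hS => /(_ Sg).
have := card_setD_contact2 ne uh uh' uc uc'.
rewrite card_covU1 vs_card; move: conn; clear; nia.
Qed.

(** The alternation of ports prevents the walk from turning back. *)
Definition port_walk b (es : seq E) := forall j, j.+1 < size es ->
  nth root es j != nth root es j.+1 /\
  pt (b (+) odd j) (nth root es j) = pt (b (+) odd j) (nth root es j.+1).

(** A walk that is not longer than the girth cannot return to itself: the part already
    walked covers at most [r * n + 1] vertices, so the next hyperedge touches it
    at the common port only, by [acyclic_contact]. *)
Lemma port_walk_path b es : size es <= g -> port_walk b es ->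
  [/\ uniq es, #|cov [set e in es]| <= r * #|[set e in es]| + 1
    & forall i j u, i < j -> j < size es -> u \in vs (nth root es i) ->
        u \in vs (nth root es j) -> j = i.+1 /\ u = pt (b (+) odd i) (nth root es i)].
Proof.
elim/last_ind: es => [|es f IH]; first by rewrite set_nil /covered big_set0 cards0.
rewrite size_rcons => sg pw.
have [||un conn meet] := IH; first exact: ltnW.
  move=> j js; have := pw j; rewrite size_rcons !nth_rcons ltnS (ltnW js) js.
  by apply.
case: (posnP (size es)) => [/size0nil e0|n0].
  rewrite e0 /=; split=> //; last by move=> i [|j].
  by rewrite (_ : [set e in [:: f]] = [set f]) ?cards1 ?/covered ?big_set1 ?vs_card
             ?muln1 ?addn1 //; apply/setP=> x; rewrite !inE.
set n := size es in sg n0 meet pw; have n1 : n.-1.+1 = n by rewrite prednK.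
have [] := pw n.-1; rewrite ?size_rcons ?n1 // !nth_rcons ?ltnn ?eqxx -/n.
rewrite (_ : n.-1 < n) ?n1 //; set e := nth root es n.-1 => nef.
set v := pt _ e => ev.
have ve : v \in vs e by exact: pt_vs.
have vf : v \in vs f by rewrite ev pt_vs.
have es_e : e \in es by rewrite mem_nth // -/n n1.
have meet_v i : i < n -> v \in vs (nth root es i) -> i = n.-1.
  move=> i_n vi; apply/eqP; rewrite eqn_leq -ltnS n1 i_n leqNgt; apply/negP => lt_i.
  have n1n : n.-1 < n by rewrite n1.
  have [ei evi] := meet i n.-1 v lt_i n1n vi ve.
  have [|_] := pw i; first by rewrite size_rcons ltnS.
  rewrite !nth_rcons -/n i_n -ei n1n -/e -evi => evi'.
  move: (pt_neq e e); move: evi'; rewrite {1}/v ei /=.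
  by case: (b) (odd i) => [] [] /= ->; rewrite eqxx.
have fes : f \notin es.
  apply/negP=> /(nthP root)[i i_n fi]; rewrite -/n in i_n.
  have := meet_v i i_n; rewrite fi => /(_ vf) ei.
  by move: nef; rewrite /e -ei fi eqxx.
have vc : v \in cov [set y in es] by apply: (mem_cov _ ve); rewrite inE.
have fS : f \notin [set y in es] by rewrite inE.
have cS : #|[set y in es]| = n by rewrite cardsE; apply/card_uniqP.
have contact u : u \in vs f -> u \in cov [set y in es] -> u = v.
  move=> uf uc; apply: (acyclic_contact conn _ fS); rewrite ?cS //.
    by rewrite inE /= uf uc.
  by rewrite inE /= vf vc.
split; first by rewrite rcons_uniq fes.
  rewrite (_ : [set y in rcons es f] = f |: [set y in es]); last first.
    by apply/setP=> y; rewrite !inE mem_rcons inE.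
  rewrite card_covU1 cardsU1 fS.
  have := card_setD_contact vf vc; rewrite vs_card; move: conn; clear; nia.
move=> i j u ij; rewrite ltnS leq_eqVlt => /orP[/eqP ej|jn]; last first.
  by rewrite !nth_rcons -/n jn (ltn_trans ij jn); exact: meet.
rewrite ej -/n in ij *; rewrite !nth_rcons -/n ij ltnn eqxx => ui uf.
have uv : u = v.
  by apply: contact => //; apply: (mem_cov _ ui); rewrite inE mem_nth.
have ei : i = n.-1 by apply: meet_v; rewrite -?uv.
by rewrite ei uv n1.
Qed.

Lemma wk_nth S wk e i : tree S wk -> e \in S -> i < size (wk e) ->
  wk (nth root (wk e) i) = take i.+1 (wk e).
Proof.
move=> t eS i_sz; have [y ey] : exists y, nth root (wk e) i = y by eexists.
have yw : y \in wk e by rewrite -ey mem_nth.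
have [q eq] := wk_prefix t eS yw; have [w ew] := wk_rcons t (wk_sub t eS yw).
have w_sz : size w < size (wk e) by rewrite eq ew size_cat size_rcons addSn ltnS leq_addr.
have -> : i = size w.
  apply/eqP; rewrite -(nth_uniq root i_sz w_sz (wk_uniq t eS)) ey eq ew.
  by rewrite nth_cat size_rcons ltnS leqnn nth_rcons ltnn eqxx.
rewrite eq ew nth_cat size_rcons ltnS leqnn nth_rcons ltnn eqxx ew take_cat.
by rewrite size_rcons ltnn subnn take0 cats0.
Qed.

Lemma wk_nth_size S wk e i : tree S wk -> e \in S -> i < size (wk e) ->
  size (wk (nth root (wk e) i)) = i.+1.
Proof. by move=> t eS i_sz; rewrite (wk_nth t) // size_takel. Qed.

Lemma wk_link S wk e i : tree S wk -> e \in S -> i.+1 < size (wk e) ->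
  pt (odd i.+1) (nth root (wk e) i) = pt (odd i.+1) (nth root (wk e) i.+1).
Proof.
move=> t eS i_sz; set y := nth _ _ i; set y' := nth _ _ _.
have [yS y'S] : y \in S /\ y' \in S by split; apply: (wk_sub t eS); rewrite mem_nth // ltnW.
have sy : size (wk y) = i.+1 by rewrite (wk_nth_size t eS) // ltnW.
have sy' : size (wk y') = i.+2 by rewrite (wk_nth_size t eS).
have cyy : child wk y y'.
  by rewrite /child /y' /y !(wk_nth t eS) // 1?ltnW // (take_nth root).
by have := child_bot t yS y'S cyy; rewrite /bot /top sy sy' /= negbK.
Qed.

Lemma pt_parity b b' e e' : pt b e = pt b' e' -> b = b'.
Proof. by case: b b' => [] [] // h; have := pt_neq e e'; have := pt_neq e' e; rewrite h eqxx. Qed.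

(** From depth [a] along [W] to its end, and back along [W'] to depth [a']. *)
Definition zigzag a a' (W W' : seq E) := drop a W ++ rev (drop a' W').

Lemma nth_zigzag a a' W W' t : a <= size W -> a' <= size W' ->
  t < size (zigzag a a' W W') ->
  nth root (zigzag a a' W W') t =
  if t < size W - a then nth root W (a + t) else nth root W' (size W' - (t - (size W - a)).+1).
Proof.
move=> aW aW'; rewrite /zigzag size_cat size_rev !size_drop => t_sz.
rewrite nth_cat size_drop; case: ltnP => h; first by rewrite nth_drop.
rewrite nth_rev size_drop ?nth_drop; last by move: t_sz h; clear; lia.
by congr nth; move: t_sz h aW'; clear; lia.
Qed.

Section Join.
Variables (S1 S2 : {set E}) (wk1 wk2 : E -> seq E) (e1 e2 : E) (a a' : nat).
Hypotheses (t1 : tree S1 wk1) (t2 : tree S2 wk2) (e1S : e1 \in S1) (e2S : e2 \in S2).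
Hypotheses (aW : a < size (wk1 e1)) (aW' : a' < size (wk2 e2)).
Hypothesis tops : top wk1 e1 = top wk2 e2.

Let D := zigzag a a' (wk1 e1) (wk2 e2).

Lemma size_zigzag : size D = (size (wk1 e1) - a) + (size (wk2 e2) - a').
Proof. by rewrite size_cat size_rev !size_drop. Qed.

Lemma nth_last_wk S wk e : tree S wk -> e \in S -> nth root (wk e) (size (wk e)).-1 = e.
Proof. by move=> t eS; have [w ->] := wk_rcons t eS; rewrite nth_last last_rcons. Qed.

Lemma zigzag_link t : t.+1 < size D ->
  pt (odd (a + t).+1) (nth root D t) = pt (odd (a + t).+1) (nth root D t.+1).
Proof.
have par : odd (size (wk1 e1)) = odd (size (wk2 e2)) := pt_parity tops.
move=> t_sz; rewrite (nth_zigzag (ltnW aW) (ltnW aW') (ltnW t_sz)).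
rewrite (nth_zigzag (ltnW aW) (ltnW aW') t_sz); move: t_sz; rewrite size_zigzag => t_sz.
case: (ltnP t (size (wk1 e1) - a)) => h1; case: (ltnP t.+1 (size (wk1 e1) - a)) => h2.
- rewrite addnS; apply: (wk_link t1 e1S); move: h2; clear; lia.
- have -> : a + t = (size (wk1 e1)).-1 by move: h1 h2; clear; lia.
  have -> : t.+1 - (size (wk1 e1) - a) = 0 by move: h1 h2; clear; lia.
  rewrite subn1 (nth_last_wk t1 e1S) (nth_last_wk t2 e2S) prednK ?(wk_gt0 t1) // {2}par.
  exact: tops.
- by move: h1 h2; clear; lia.
- rewrite subSn //; set t' := t - (size (wk1 e1) - a).
  have [m em] : exists m, size (wk2 e2) = t'.+2 + m.
    by exists (size (wk2 e2) - t'.+2); move: t_sz h1; rewrite /t'; clear; lia.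
  have -> : size (wk2 e2) - t'.+1 = m.+1 by rewrite em; clear; lia.
  have -> : size (wk2 e2) - t'.+2 = m by rewrite em; clear; lia.
  have -> : odd (a + t).+1 = odd m.+1.
    have -> : (a + t).+1 = size (wk1 e1) + t'.+1 by rewrite /t'; move: h1 aW; clear; lia.
    by rewrite oddD par em oddD /=; case: (odd t') (odd m) => [] [].
  by apply/esym/(wk_link t2 e2S); rewrite em; clear; lia.
Qed.

Lemma zigzag_neq t : e1 != e2 -> t.+1 < size D -> nth root D t != nth root D t.+1.
Proof.
move=> ne t_sz; rewrite (nth_zigzag (ltnW aW) (ltnW aW') (ltnW t_sz)).
rewrite (nth_zigzag (ltnW aW) (ltnW aW') t_sz); move: t_sz; rewrite size_zigzag => t_sz.
case: (ltnP t (size (wk1 e1) - a)) => h1; case: (ltnP t.+1 (size (wk1 e1) - a)) => h2.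
- have i1 : a + t < size (wk1 e1) by move: h1; clear; lia.
  have i2 : a + t.+1 < size (wk1 e1) by move: h2; clear; lia.
  by rewrite (nth_uniq root i1 i2 (wk_uniq t1 e1S)) eqn_add2l neq_ltn ltnSn.
- have -> : a + t = (size (wk1 e1)).-1 by move: h1 h2; clear; lia.
  have -> : t.+1 - (size (wk1 e1) - a) = 0 by move: h1 h2; clear; lia.
  by rewrite subn1 (nth_last_wk t1 e1S) (nth_last_wk t2 e2S).
- by move: h1 h2; clear; lia.
- set i := _ - _.+1; set j := _ - _.+1.
  have i1 : i < size (wk2 e2) by rewrite /i; move: t_sz h1 aW'; clear; lia.
  have i2 : j < size (wk2 e2) by rewrite /j; move: t_sz h1 aW'; clear; lia.
  rewrite (nth_uniq root i1 i2 (wk_uniq t2 e2S)).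
  by apply/eqP; rewrite /i /j; move: t_sz h1; clear; lia.
Qed.

Lemma zigzag_mem y : y \in D -> (exists i, [/\ a <= i, i < size (wk1 e1) & y = nth root (wk1 e1) i])
  \/ (exists i, [/\ a' <= i, i < size (wk2 e2) & y = nth root (wk2 e2) i]).
Proof.
case/(nthP root)=> t t_sz <-; rewrite (nth_zigzag (ltnW aW) (ltnW aW') t_sz).
move: t_sz; rewrite size_zigzag => t_sz; case: ltnP => h; [left|right].
  by exists (a + t); split=> //; move: h; clear; lia.
by exists (size (wk2 e2) - (t - (size (wk1 e1) - a)).+1); split=> //; move: t_sz h aW'; clear; lia.
Qed.

End Join.

(** The walks of [e] and [x] share their first [a] hyperedges and together form a
    subtree.  A hyperedge outside touches that subtree at most once; one in the
    common part touches the two branches only at its own top. *)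
Lemma branch_contact S wk e x a : tree S wk -> e \in S -> x \in S ->
  a <= size (wk e) -> a <= size (wk x) -> take a (wk e) = take a (wk x) ->
  let P y := (exists i, [/\ a <= i, i < size (wk e) & y = nth root (wk e) i])
          \/ (exists i, [/\ a <= i, i < size (wk x) & y = nth root (wk x) i]) in
  forall h y y' u u', ~ P h -> P y -> P y' -> u \in vs h -> u \in vs y ->
    u' \in vs h -> u' \in vs y' -> u = u'.
Proof.
move=> t eS xS ae ax etake P h y y' u u' nPh Py Py' uh uy u'h u'y.
pose S' := [set z in wk e] :|: [set z in wk x].
have S'S : S' \subset S.
  by apply/subsetP=> z; rewrite !inE => /orP[]; exact: wk_sub.
have clS' : closedS wk S'.
  move=> z; rewrite !inE => /orP[zw|zw] z' z'z; rewrite !inE.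
    by have [q ->] := wk_prefix t eS zw; rewrite mem_cat z'z.
  by have [q ->] := wk_prefix t xS zw; rewrite mem_cat z'z orbT.
have tS' := tree_sub t S'S clS'.
have PS' z : P z -> z \in S'.
  by case=> [] [i [_ i_sz ->]]; rewrite !inE mem_nth ?orbT.
have P_sz z : P z -> a < size (wk z).
  by case=> [] [i [ai i_sz ->]]; rewrite (wk_nth_size t).
case: (boolP (h \in S')) => hS'; last first.
  apply: (tree_out tS' hS'); rewrite inE /= ?uh ?u'h /=.
    by apply: (mem_cov _ uy); exact: PS'.
  by apply: (mem_cov _ u'y); exact: PS'.
have h_sz : size (wk h) <= a.
  move: hS'; rewrite !inE => /orP[] /(nthP root)[i i_sz hi].
    by rewrite -hi (wk_nth_size t) // ltnNge; apply/negP => ai; apply: nPh; left; exists i.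
  by rewrite -hi (wk_nth_size t) // ltnNge; apply/negP => ai; apply: nPh; right; exists i.
have only z v : P z -> v \in vs h -> v \in vs z -> v = top wk h.
  move=> Pz vh vz; have a_sz := P_sz z Pz.
  have hz : h != z by apply: contraTneq a_sz => <-; rewrite -leqNgt.
  have hS := subsetP S'S _ hS'; have zS := subsetP S'S _ (PS' z Pz).
  have [w [wS ev [hw|chw] alt]] := tree_meet t hS zS hz vh vz; first by rewrite hw.
  suff : size (wk z) <= size (wk h) by move: a_sz h_sz; clear; lia.
  by case: alt => [->|->]; rewrite chw !size_rcons.
by rewrite (only y u) // (only y' u').
Qed.

(** A closed walk through alternating ports, with nodes
    [pt (b (+) odd t) (nth root C t)], that is induced in the ambient hypergraph. *)
Record hypercycle b (C : seq E) : Prop := Hypercycle {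
  hc_J : {subset C <= J};
  hc_even : ~~ odd (size C);
  hc_link : forall t, t < size C -> pt (b (+) odd t.+1) (nth root C t) =
    pt (b (+) odd t.+1) (nth root C (t.+1 %% size C));
  hc_node : forall t t', t < size C -> t' < size C ->
    pt (b (+) odd t) (nth root C t) = pt (b (+) odd t') (nth root C t') -> t = t';
  hc_meet : forall e e' u, e \in C -> e' \in C -> e != e' -> u \in vs e -> u \in vs e' ->
    exists b', u = pt b' e;
  hc_out : forall h e e' u u', h \notin C -> e \in C -> e' \in C ->
    u \in vs h -> u \in vs e -> u' \in vs h -> u' \in vs e' -> u = u'
}.

Lemma tree_ports S wk e e' u : tree S wk -> e \in S -> e' \in S -> e != e' ->
  u \in vs e -> u \in vs e' -> exists b, u = pt b e.
Proof.
move=> t eS e'S ne ue ue'.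
have [x [xS -> [->|ce] _]] := tree_meet t eS e'S ne ue ue'; first by eexists.
by rewrite -(child_bot t xS eS ce); eexists.
Qed.

Lemma common_prefix S wk x1 x2 : tree S wk -> x1 \in S -> x2 \in S -> exists a,
  [/\ 0 < a, a <= size (wk x1), a <= size (wk x2), take a (wk x1) = take a (wk x2)
   & forall i j, a <= i -> i < size (wk x1) -> a <= j -> j < size (wk x2) ->
       nth root (wk x1) i <> nth root (wk x2) j].
Proof.
move=> t x1S x2S.
pose P a := [&& a <= size (wk x1), a <= size (wk x2) & take a (wk x1) == take a (wk x2)].
have P1 : P 1.
  rewrite /P !(wk_gt0 t) //=.
  by have [q1 ->] := wk_root t x1S; have [q2 ->] := wk_root t x2S; rewrite /= !take0.
have exP : exists n, P n by exists 1.
have ubP n : P n -> n <= size (wk x1) by case/and3P.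
have [a /and3P[a1 a2 /eqP ea] amax] := ex_maxnP exP ubP.
exists a; split=> //; first exact: amax.
move=> i j ai i_sz aj j_sz eij.
have e12 : take i.+1 (wk x1) = take j.+1 (wk x2) by rewrite -!(wk_nth t) // eij.
have ij : i = j by have := congr1 size e12; rewrite !size_takel // => -[].
have := amax i.+1; rewrite /P i_sz -ij in e12 *; rewrite ij j_sz -ij e12 eqxx.
by move=> /(_ isT); rewrite ltnNge ai.
Qed.

(** Two trees [S1] and [S2] extend [S], independently of each other, and a walk in
    [S1] ends at the same vertex as a walk in [S2].  All but the last [k] hyperedges
    of each walk are in [S].  Therefore two hyperedges of the resulting cycle are in
    the same tree, unless both are new; in that case they belong to a walk of
    length [2 * k], which is less than the girth. *)
Section Closing.
Variables (S S1 S2 : {set E}) (wk wk1 wk2 : E -> seq E) (x1 x2 e1 e2 : E) (q1 q2 : seq E) (k : nat).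
Hypotheses (t0 : tree S wk) (t1 : tree S1 wk1) (t2 : tree S2 wk2).
Hypotheses (SS1 : S \subset S1) (SS2 : S \subset S2).
Hypotheses (eqw1 : {in S, wk1 =1 wk}) (eqw2 : {in S, wk2 =1 wk}).
Hypotheses (x1S : x1 \in S) (x2S : x2 \in S).
Hypotheses (e1S : e1 \in S1) (e2S : e2 \in S2).
Hypotheses (wke1 : wk1 e1 = wk x1 ++ q1) (wke2 : wk2 e2 = wk x2 ++ q2).
Hypotheses (szq1 : size q1 = k) (szq2 : size q2 = k) (k0 : 0 < k) (kg : 2 * k < g).
Hypotheses (q1new : {subset q1 <= S1 :\: S}) (q2new : {subset q2 <= S2 :\: S}).
Hypotheses (tops : top wk1 e1 = top wk2 e2) (e12 : e1 != e2).

Let W := wk1 e1.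
Let W' := wk2 e2.
Let Dq := zigzag (size (wk x1)) (size (wk x2)) W W'.

Lemma szW : size W = size (wk x1) + k. Proof. by rewrite /W wke1 size_cat szq1. Qed.
Lemma szW' : size W' = size (wk x2) + k. Proof. by rewrite /W' wke2 size_cat szq2. Qed.

Lemma W_old i : i < size (wk x1) -> nth root W i = nth root (wk x1) i /\ nth root W i \in S.
Proof.
move=> h; rewrite /W wke1 nth_cat h; split=> //.
by apply: (wk_sub t0 x1S); rewrite mem_nth.
Qed.

Lemma W'_old i : i < size (wk x2) -> nth root W' i = nth root (wk x2) i /\ nth root W' i \in S.
Proof.
move=> h; rewrite /W' wke2 nth_cat h; split=> //.
by apply: (wk_sub t0 x2S); rewrite mem_nth.
Qed.

Lemma W_new i : size (wk x1) <= i -> i < size W -> nth root W i \in S1 /\ nth root W i \notin S.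
Proof.
rewrite szW => h1 h2; rewrite /W wke1 nth_cat ltnNge h1 /=.
have i_sz : i - size (wk x1) < size q1 by rewrite szq1; move: h1 h2; clear; lia.
by have := q1new (mem_nth root i_sz); rewrite inE => /andP[-> ->].
Qed.

Lemma W'_new i : size (wk x2) <= i -> i < size W' -> nth root W' i \in S2 /\ nth root W' i \notin S.
Proof.
rewrite szW' => h1 h2; rewrite /W' wke2 nth_cat ltnNge h1 /=.
have i_sz : i - size (wk x2) < size q2 by rewrite szq2; move: h1 h2; clear; lia.
by have := q2new (mem_nth root i_sz); rewrite inE => /andP[-> ->].
Qed.

Lemma szDq : size Dq = 2 * k.
Proof. rewrite size_zigzag -/W -/W' szW szW'; clear; lia. Qed.

Lemma Dq_walk : port_walk (~~ odd (size (wk x1))) Dq.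
Proof.
have aW : size (wk x1) < size W by rewrite szW; move: k0; clear; lia.
have aW' : size (wk x2) < size W' by rewrite szW'; move: k0; clear; lia.
move=> t t_sz; split; first exact: zigzag_neq t1 t2 e1S e2S aW aW' _ e12 t_sz.
rewrite (_ : _ (+) _ = odd (size (wk x1) + t).+1); last by rewrite /= oddD addNb.
exact: (zigzag_link t1 t2 e1S e2S aW aW' tops t_sz).
Qed.

(** [Dq] is a walk shorter than the girth, so the new part of [W] touches that of [W']
    only at the common end vertex of [W] and [W']. *)
Lemma new_contact i j u : size (wk x1) <= i -> i < size W -> size (wk x2) <= j -> j < size W' ->
  u \in vs (nth root W i) -> u \in vs (nth root W' j) ->
  [/\ i.+1 = size W, j.+1 = size W', exists b, u = pt b (nth root W i)
    & exists b, u = pt b (nth root W' j)].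
Proof.
have szg : size Dq <= g by rewrite szDq ltnW.
have [uD conn meet] := port_walk_path szg Dq_walk.
move=> ai iW aj jW' ui uj.
have aW : size (wk x1) <= size W by rewrite szW leq_addr.
have aW' : size (wk x2) <= size W' by rewrite szW' leq_addr.
have [hi hj hij] : [/\ i - size (wk x1) < size Dq, k + (size W' - j.+1) < size Dq &
    i - size (wk x1) < k + (size W' - j.+1)].
  by rewrite szDq szW szW' in iW jW' *; split; move: ai iW aj jW' k0; clear; lia.
have ei : nth root Dq (i - size (wk x1)) = nth root W i.
  rewrite nth_zigzag // -/W szW in iW *.
  by rewrite ifT ?subnKC //; move: ai iW; clear; lia.
have ej : nth root Dq (k + (size W' - j.+1)) = nth root W' j.
  rewrite nth_zigzag // -/W -/W' szW szW' in jW' *.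
  rewrite ifF; last by apply/negbTE; rewrite -leqNgt; clear; lia.
  by congr nth; move: aj jW'; clear; lia.
have [e_ij eu] := meet _ _ u hij hj (etrans (congr1 (fun e => u \in vs e) ei) ui)
  (etrans (congr1 (fun e => u \in vs e) ej) uj).
split.
- by rewrite szW szW' in iW jW' e_ij *; move: ai iW aj jW' e_ij; clear; lia.
- by rewrite szW szW' in iW jW' e_ij *; move: ai iW aj jW' e_ij; clear; lia.
- by rewrite eu ei; eexists.
- have iD : (i - size (wk x1)).+1 < size Dq by rewrite -e_ij.
  have [_ lk] := Dq_walk iD; by rewrite eu lk -e_ij ?ej //; eexists.
Qed.

Lemma new_out h e e' u u' : h \notin Dq -> e \in Dq -> e' \in Dq ->
  u \in vs h -> u \in vs e -> u' \in vs h -> u' \in vs e' -> u = u'.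
Proof.
have szg : size Dq <= g by rewrite szDq ltnW.
have [uD conn _] := port_walk_path szg Dq_walk.
move=> hD eD e'D uh ue u'h u'e; apply: (acyclic_contact conn (h := h)).
- by rewrite cardsE; have /card_uniqP -> := uD; rewrite szDq.
- by rewrite inE.
- by rewrite inE /= uh; apply: mem_cov ue; rewrite inE.
- by rewrite inE /= u'h; apply: mem_cov u'e; rewrite inE.
Qed.

Variable a : nat.
Hypotheses (a0 : 0 < a) (a1 : a <= size (wk x1)) (a2 : a <= size (wk x2)).
Hypothesis ea : take a (wk x1) = take a (wk x2).
Hypothesis adiff : forall i j, a <= i -> i < size (wk x1) -> a <= j -> j < size (wk x2) ->
  nth root (wk x1) i <> nth root (wk x2) j.

Let C := zigzag a a W W'.

Let aW : a < size W. Proof. by rewrite szW; move: a1 k0; clear; lia. Qed.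
Let aW' : a < size W'. Proof. by rewrite szW'; move: a2 k0; clear; lia. Qed.
Let par : odd (size W) = odd (size W'). Proof. exact: pt_parity tops. Qed.

Let prefW i : i < a -> nth root W i = nth root W' i.
Proof.
move=> ia; have i1 := leq_trans ia a1; have i2 := leq_trans ia a2.
have [-> _] := W_old i1; have [-> _] := W'_old i2.
by rewrite -(nth_take root ia (wk x1)) ea nth_take.
Qed.

Let old_distinct i j : a <= i -> i < size (wk x1) -> a <= j -> j < size (wk x2) ->
  nth root W i <> nth root W' j.
Proof.
by move=> ai i_sz aj j_sz; have [-> _] := W_old i_sz; have [-> _] := W'_old j_sz; exact: adiff.
Qed.

Let W_S1 i : i < size W -> nth root W i \in S1.
Proof. by move=> h; apply: (wk_sub t1 e1S); rewrite mem_nth. Qed.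
Let W'_S2 i : i < size W' -> nth root W' i \in S2.
Proof. by move=> h; apply: (wk_sub t2 e2S); rewrite mem_nth. Qed.

Let top1_old y : y \in S -> top wk1 y = top wk y.
Proof. by move=> yS; rewrite /top eqw1. Qed.
Let top2_old y : y \in S -> top wk2 y = top wk y.
Proof. by move=> yS; rewrite /top eqw2. Qed.

Let Cmem y : y \in C -> (exists i, [/\ a <= i, i < size W & y = nth root W i])
  \/ (exists i, [/\ a <= i, i < size W' & y = nth root W' i]).
Proof. exact: zigzag_mem. Qed.

(** The node where the cycle enters its t-th hyperedge. *)
Let nodeE t : t < size C ->
  (t < size W - a /\ pt (odd a (+) odd t) (nth root C t) = top wk1 (nth root W (a + t).-1))
  \/ (size W - a <= t /\ pt (odd a (+) odd t) (nth root C t) =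
       top wk2 (nth root W' (size W' - (t - (size W - a)).+1))).
Proof.
move=> t_sz; rewrite /C (nth_zigzag (ltnW aW) (ltnW aW') t_sz); move: t_sz; rewrite size_zigzag -/W -/W' => t_sz.
case: ltnP => h; [left|right]; split=> //; rewrite -oddD.
  have at0 : 0 < a + t by rewrite addn_gt0 a0.
  have atW : (a + t).-1.+1 < size W by rewrite prednK //; move: h; clear; lia.
  have := wk_link t1 e1S atW; rewrite prednK // => <-.
  by rewrite /top (wk_nth_size t1 e1S (ltnW atW)) prednK.
set m := _ - _.+1; have mW : m < size W' by rewrite /m; move: aW' t_sz; clear; lia.
rewrite /top (wk_nth_size t2 e2S) //; congr pt.
have -> : odd (a + t) = odd (size W + (t - (size W - a))).
  by congr odd; move: h aW; clear; lia.
have [t' et'] : exists t', t - (size W - a) = t' by eexists.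
have eW' : size W' = m + t'.+1 by rewrite /m et'; move: t_sz h; rewrite -et'; clear; lia.
by rewrite et' oddD par eW' oddD /=; case: (odd m) (odd t') => [] [].
Qed.

Let cross i m : i.+1 < size W -> a <= i.+1 -> a <= m -> m < size W' ->
  top wk1 (nth root W i) <> top wk2 (nth root W' m).
Proof.
move=> iW ai am mW' etop.
have u1 : top wk1 (nth root W i) \in vs (nth root W i) by exact: top_vs.
have u2 : top wk1 (nth root W i) \in vs (nth root W' m) by rewrite etop top_vs.
case: (ltnP m (size (wk x2))) => m2.
  have [_ mS] := W'_old m2.
  have em : nth root W i = nth root W' m.
    apply: (top_inj t1); [exact: W_S1 (ltnW iW) | exact: (subsetP SS1) |].
    by rewrite etop top1_old // top2_old.
  case: (ltnP i (size (wk x1))) => i1; last first.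
    by have [_] := W_new i1 (ltnW iW); rewrite em mS.
  move: ai; rewrite leq_eqVlt => /orP[/eqP ai|ai]; last exact: old_distinct em.
  have ia : i < a by rewrite ai.
  have iW' := ltn_trans ia aW'.
  move: em; rewrite (prefW ia) => /eqP; rewrite (nth_uniq root iW' mW' (wk_uniq t2 e2S)).
  by move=> /eqP im; move: am; rewrite -im ai ltnn.
have [mS2 mS] := W'_new m2 mW'.
case: (ltnP i (size (wk x1))) => i1.
  have [_ iS] := W_old i1.
  have em : nth root W i = nth root W' m.
    apply: (top_inj t2) => //; first exact: (subsetP SS2).
    by rewrite -etop top1_old // top2_old.
  by move: mS; rewrite -em iS.
have [iW1 _ _ _] := new_contact i1 (ltnW iW) m2 mW' u1 u2.
by move: iW; rewrite iW1 ltnn.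
Qed.

Lemma closing : hypercycle (odd a) C.
Proof.
have szC : size C = (size W - a) + (size W' - a) by exact: size_zigzag.
have [u1 u2] := (wk_uniq t1 e1S, wk_uniq t2 e2S).
split.
- move=> y /Cmem[] [i [_ i_sz ->]]; first by apply: (tree_J t1); exact: W_S1.
  by apply: (tree_J t2); exact: W'_S2.
- by rewrite szC oddD !oddB ?(ltnW aW) ?(ltnW aW') // par addbb.
- move=> t t_sz; rewrite -oddD addnS; case: (ltnP t.+1 (size C)) => h.
    by rewrite modn_small //; exact: (zigzag_link t1 t2 e1S e2S aW aW' tops h).
  have et : t.+1 = size C by apply/eqP; rewrite eqn_leq t_sz h.
  have oa : odd (a + t).+1 = odd a.
    by rewrite -addnS et szC !oddD !oddB ?(ltnW aW) ?(ltnW aW') // par addbb addbF.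
  rewrite oa et modnn.
  have C0 : nth root C 0 = nth root W a.
    by rewrite nth_zigzag ?(ltnW aW) ?(ltnW aW') ?subn_gt0 ?aW ?addn0 // -et.
  have Ct : nth root C t = nth root W' a.
    rewrite nth_zigzag ?(ltnW aW) ?(ltnW aW') // -/W -/W' ifF; last first.
      by apply/negbTE; rewrite -leqNgt; move: et aW'; rewrite szC; clear; lia.
    by congr nth; move: et aW' aW; rewrite szC; clear; lia.
  rewrite C0 Ct.
  have aa : a.-1.+1 = a by rewrite prednK.
  have := @wk_link _ _ _ a.-1 t1 e1S; rewrite aa => /(_ aW) <-.
  have := @wk_link _ _ _ a.-1 t2 e2S; rewrite aa => /(_ aW') <-.
  by rewrite -/W -/W' prefW // aa.
- move=> t t' t_sz t'_sz; have := nodeE t_sz; have := nodeE t'_sz.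
  move: t_sz t'_sz; rewrite szC => t_sz t'_sz.
  case=> [[h' ->]|[h' ->]]; case=> [[h ->]|[h ->]].
  + move=> /(top_inj t1 (W_S1 _) (W_S1 _)) e.
    have i1 : (a + t).-1 < size W by move: h; clear; lia.
    have i2 : (a + t').-1 < size W by move: h'; clear; lia.
    move: (e i1 i2) => /eqP; rewrite nth_uniq // => /eqP; move: a0; clear; lia.
  + move=> /esym /cross[] //; move: h' t_sz a0 aW' h; clear; lia.
  + move=> /cross[] //; move: h t'_sz a0 aW' h'; clear; lia.
  + move=> /(top_inj t2 (W'_S2 _) (W'_S2 _)) e.
    set i := _ - _.+1 in e; set i' := _ - _.+1 in e.
    have i1 : i < size W' by rewrite /i; move: aW'; clear; lia.
    have i2 : i' < size W' by rewrite /i'; move: aW'; clear; lia.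
    move: (e i1 i2) => /eqP; rewrite nth_uniq // => /eqP.
    by rewrite /i /i'; move: t_sz t'_sz h h'; clear; lia.
- move=> e e' u eC e'C ne ue ue'.
  case: (Cmem eC) => [] [i [ai iW ei]]; case: (Cmem e'C) => [] [j [aj jW ej]].
  + by apply: (tree_ports t1 _ _ ne ue ue'); rewrite ?ei ?ej; exact: W_S1.
  + case: (ltnP j (size (wk x2))) => j2.
      apply: (tree_ports t1 _ _ ne ue ue'); first by rewrite ei W_S1.
      by rewrite ej (subsetP SS1) //; have [] := W'_old j2.
    case: (ltnP i (size (wk x1))) => i1.
      apply: (tree_ports t2 _ _ ne ue ue'); last by rewrite ej W'_S2.
      by rewrite ei (subsetP SS2) //; have [] := W_old i1.
    rewrite ei ej in ue ue' *.
    by have [_ _ ? _] := new_contact i1 iW j2 jW ue ue'.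
  + case: (ltnP i (size (wk x2))) => i2.
      apply: (tree_ports t1 _ _ ne ue ue'); last by rewrite ej W_S1.
      by rewrite ei (subsetP SS1) //; have [] := W'_old i2.
    case: (ltnP j (size (wk x1))) => j1.
      apply: (tree_ports t2 _ _ ne ue ue'); first by rewrite ei W'_S2.
      by rewrite ej (subsetP SS2) //; have [] := W_old j1.
    rewrite ei ej in ue ue' *.
    by have [_ _ _ ?] := new_contact j1 jW i2 iW ue' ue.
  + by apply: (tree_ports t2 _ _ ne ue ue'); rewrite ?ei ?ej; exact: W'_S2.
- move=> h e e' u u' hC eC e'C uh ue u'h u'e.
  have b1 : take a (wk1 e1) = take a (wk1 x2) by rewrite (eqw1 x2S) wke1 takel_cat.
  have b2 : take a (wk2 e2) = take a (wk2 x1) by rewrite (eqw2 x1S) wke2 takel_cat // ea.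
  have s1 : a <= size (wk1 x2) by rewrite eqw1.
  have s2 : a <= size (wk2 x1) by rewrite eqw2.
  have C_W i : a <= i -> i < size W -> nth root W i \in C.
    move=> ai iW; have h' : i - a < size (drop (a) W).
      by rewrite size_drop; move: ai iW; clear; lia.
    by have := mem_nth root h'; rewrite nth_drop subnKC // mem_cat => ->.
  have C_W' i : a <= i -> i < size W' -> nth root W' i \in C.
    move=> ai iW; have h' : i - a < size (drop (a) W').
      by rewrite size_drop; move: ai iW; clear; lia.
    by have := mem_nth root h'; rewrite nth_drop subnKC // mem_cat mem_rev => ->; rewrite orbT.
  have side1 := branch_contact t1 e1S (subsetP SS1 _ x2S) (ltnW aW) s1 b1.
  have side2 := branch_contact t2 e2S (subsetP SS2 _ x1S) (ltnW aW') s2 b2.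
  rewrite (eqw1 x2S) in side1; rewrite (eqw2 x1S) in side2.
  have nP1 : ~ ((exists i, [/\ a <= i, i < size W & h = nth root W i])
          \/ (exists i, [/\ a <= i, i < size (wk x2) & h = nth root (wk x2) i])).
    case=> [] [i [ai i_sz eh]]; move: hC; rewrite eh; first by rewrite C_W.
    have [<- _] := W'_old i_sz; rewrite C_W' //.
    by rewrite szW' (leq_trans i_sz) // leq_addr.
  have nP2 : ~ ((exists i, [/\ a <= i, i < size W' & h = nth root W' i])
          \/ (exists i, [/\ a <= i, i < size (wk x1) & h = nth root (wk x1) i])).
    case=> [] [i [ai i_sz eh]]; move: hC; rewrite eh; first by rewrite C_W'.
    have [<- _] := W_old i_sz; rewrite C_W //.
    by rewrite szW (leq_trans i_sz) // leq_addr.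
  have DC y : y \in Dq -> y \in C.
    have aq : size (wk x1) < size W by rewrite szW; move: k0; clear; lia.
    have aq' : size (wk x2) < size W' by rewrite szW'; move: k0; clear; lia.
    move=> yD; case: (zigzag_mem aq aq' yD) => [] [i [ai i_sz ->]].
      by apply: C_W => //; exact: leq_trans a1 ai.
    by apply: C_W' => //; exact: leq_trans a2 ai.
  have hD : h \notin Dq by apply: contra hC; exact: DC.
  have D_W i : size (wk x1) <= i -> i < size W -> nth root W i \in Dq.
    move=> ai iW; have h' : i - size (wk x1) < size (drop (size (wk x1)) W).
      by rewrite size_drop; move: ai iW; clear; lia.
    by have := mem_nth root h'; rewrite nth_drop subnKC // mem_cat => ->.
  have D_W' i : size (wk x2) <= i -> i < size W' -> nth root W' i \in Dq.
    move=> ai iW; have h' : i - size (wk x2) < size (drop (size (wk x2)) W').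
      by rewrite size_drop; move: ai iW; clear; lia.
    by have := mem_nth root h'; rewrite nth_drop subnKC // mem_cat mem_rev => ->; rewrite orbT.
  case: (Cmem eC) => [] [i [ai iW ei]]; case: (Cmem e'C) => [] [j [aj jW ej]].
  + by apply: (side1 h e e') => //; left; [exists i|exists j].
  + case: (ltnP j (size (wk x2))) => j2.
      apply: (side1 h e e') => //; [left; by exists i|right; exists j; split=> //].
      by have [<- _] := W'_old j2.
    case: (ltnP i (size (wk x1))) => i1.
      apply: (side2 h e e') => //; [right; exists i; split=> //|left; by exists j].
      by have [<- _] := W_old i1.
    by apply: (new_out hD) uh ue u'h u'e; rewrite ?ei ?ej ?D_W ?D_W'.
  + case: (ltnP i (size (wk x2))) => i2.
      apply: (side1 h e e') => //; [right; exists i; split=> //|left; by exists j].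
      by have [<- _] := W'_old i2.
    case: (ltnP j (size (wk x1))) => j1.
      apply: (side2 h e e') => //; [left; by exists i|right; exists j; split=> //].
      by have [<- _] := W_old j1.
    by apply: (new_out hD) uh ue u'h u'e; rewrite ?ei ?ej ?D_W ?D_W'.
  + by apply: (side2 h e e') => //; left; [exists i|exists j].
Qed.

End Closing.
(** A geometric sum with ratio [X > 2] is dominated by its last term. *)
Lemma mu_le u j : mu u j.+1 <= 1 + 2 * (X ^ j * u).
Proof.
elim: j => [|j IH]; first by rewrite /= expn0 mul1n; clear; lia.
rewrite [mu _ _]/= -/(mu u j.+1); apply: leq_trans (leq_add IH (leqnn _)) _.
rewrite expnS -mulnA; move: X_gt2; clear; nia.
Qed.

(** If the last hyperedges agree, then the walks already met at the vertex where they
    entered it, and both may be cut back.  This ends while some new hyperedges are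
    left, because the tops of [x1] and [x2] differ. *)
Lemma peel S S1 S2 wk wk1 wk2 x1 x2 k :
  tree S wk -> tree S1 wk1 -> tree S2 wk2 -> S \subset S1 -> S \subset S2 ->
  {in S, wk1 =1 wk} -> {in S, wk2 =1 wk} -> x1 \in S -> x2 \in S -> x1 != x2 ->
  forall e1 e2 q1 q2, e1 \in S1 -> e2 \in S2 ->
  wk1 e1 = wk x1 ++ q1 -> wk2 e2 = wk x2 ++ q2 -> size q1 = k -> size q2 = k ->
  {subset q1 <= S1 :\: S} -> {subset q2 <= S2 :\: S} -> top wk1 e1 = top wk2 e2 ->
  exists k' e1' e2' q1' q2', [/\ 0 < k' <= k, e1' \in S1, e2' \in S2 &
    [/\ wk1 e1' = wk x1 ++ q1', wk2 e2' = wk x2 ++ q2', size q1' = k', size q2' = k' &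
    [/\ {subset q1' <= S1 :\: S}, {subset q2' <= S2 :\: S}, top wk1 e1' = top wk2 e2' &
        e1' != e2']]].
Proof.
move=> t0 t1 t2 SS1 SS2 eqw1 eqw2 x1S x2S x12.
elim: k => [|k IH] e1 e2 q1 q2 e1S e2S w1 w2 s1 s2 n1 n2 tops.
  have e1x : e1 = x1.
    apply: (wk_inj t1) => //; first exact: (subsetP SS1).
    by rewrite w1 (size0nil s1) cats0 eqw1.
  have e2x : e2 = x2.
    apply: (wk_inj t2) => //; first exact: (subsetP SS2).
    by rewrite w2 (size0nil s2) cats0 eqw2.
  case/eqP: x12; apply: (top_inj t0) => //.
  by move: tops; rewrite e1x e2x /top eqw1 ?eqw2.
case: (eqVneq e1 e2) => [e12|ne]; last first.
  by exists k.+1, e1, e2, q1, q2; rewrite leqnn; split=> //; split=> //; split.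
case/lastP: q1 s1 w1 n1 => // q1 f1; rewrite size_rcons => -[s1] w1 n1.
case/lastP: q2 s2 w2 n2 => // q2 f2; rewrite size_rcons => -[s2] w2 n2.
have [i1 i2] : size (wk x1 ++ q1) < size (wk1 e1) /\ size (wk x2 ++ q2) < size (wk2 e2).
  by rewrite w1 w2 -!rcons_cat !size_rcons !ltnSn.
have l1 : 0 < size (wk x1 ++ q1) by rewrite size_cat addn_gt0 (wk_gt0 t0).
have l2 : 0 < size (wk x2 ++ q2) by rewrite size_cat addn_gt0 (wk_gt0 t0).
set p1 := last x1 q1; set p2 := last x2 q2.
have np1 : nth root (wk1 e1) (size (wk x1 ++ q1)).-1 = p1.
  rewrite w1 -rcons_cat nth_rcons prednK // leqnn nth_last last_cat /p1.
  by have [w ew] := wk_rcons t0 x1S; rewrite ew last_rcons.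
have np2 : nth root (wk2 e2) (size (wk x2 ++ q2)).-1 = p2.
  rewrite w2 -rcons_cat nth_rcons prednK // leqnn nth_last last_cat /p2.
  by have [w ew] := wk_rcons t0 x2S; rewrite ew last_rcons.
have wp1 : wk1 p1 = wk x1 ++ q1.
  rewrite -np1 (wk_nth t1 e1S) ?prednK //; last by rewrite ltnW.
  by rewrite w1 -rcons_cat -cats1 takel_cat // take_size.
have wp2 : wk2 p2 = wk x2 ++ q2.
  rewrite -np2 (wk_nth t2 e2S) ?prednK //; last by rewrite ltnW.
  by rewrite w2 -rcons_cat -cats1 takel_cat // take_size.
have p1S : p1 \in S1 by rewrite -np1 (wk_sub t1 e1S) // mem_nth // (leq_ltn_trans _ i1) // leq_pred.
have p2S : p2 \in S2 by rewrite -np2 (wk_sub t2 e2S) // mem_nth // (leq_ltn_trans _ i2) // leq_pred.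
have par := pt_parity tops.
have f1e : f1 = e1.
  by have := nth_last_wk t1 e1S; rewrite nth_last w1 -rcons_cat last_rcons.
have f2e : f2 = e2.
  by have := nth_last_wk t2 e2S; rewrite nth_last w2 -rcons_cat last_rcons.
have c1 : child wk1 p1 e1 by rewrite /child wp1 w1 f1e rcons_cat.
have c2 : child wk2 p2 e2 by rewrite /child wp2 w2 f2e rcons_cat.
have [|||k' [e1' [e2' [q1' [q2' [/andP[k0 kk] ? ? ?]]]]]] := IH p1 p2 q1 q2 p1S p2S wp1 wp2 s1 s2.
- by move=> y yq; apply: n1; rewrite mem_rcons inE yq orbT.
- by move=> y yq; apply: n2; rewrite mem_rcons inE yq orbT.
- rewrite -(child_bot t1 p1S e1S c1) -(child_bot t2 p2S e2S c2).
  by rewrite /bot -e12 par e12.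
by exists k', e1', e2', q1', q2'; rewrite k0 ltnW.
Qed.

(** Walks that run into disjoint legs separate no later than at the start of the leg
    that starts deeper; so a cycle made of them keeps almost all of both legs. *)
Lemma branch_depth S wk x1 x2 y1 y2 l1 l2 i j a m :
  tree S wk -> leg wk x1 l1 -> leg wk x2 l2 -> i < size l1 -> j < size l2 ->
  y1 = nth root l1 i -> y2 = nth root l2 j -> size (wk x1) <= m -> size (wk x2) <= m ->
  (forall e, e \in l1 -> e \in l2 -> False) ->
  a <= size (wk y1) -> a <= size (wk y2) -> take a (wk y1) = take a (wk y2) -> a <= m.
Proof.
move=> t; wlog le12 : x1 x2 y1 y2 l1 l2 i j / size (wk x1) <= size (wk x2) => [hw|].
  case: (leqP (size (wk x1)) (size (wk x2))) => h; first exact: hw.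
  move=> lg1 lg2 il jl e1 e2 m1 m2 dis a1 a2 ea.
  by apply: (hw x2 x1 y2 y1 l2 l1 j i (ltnW h)) => // e h1 h2; exact: (dis e).
move=> lg1 lg2 il jl -> -> m1 m2 dis; rewrite lg1 // lg2 // => a1 a2 ea.
rewrite leqNgt; apply/negP => am; set n := size (wk x2) in le12 m2.
have na : n < a by exact: leq_ltn_trans am.
have e12 : nth root (wk x1 ++ take i.+1 l1) n = nth root (wk x2 ++ take j.+1 l2) n.
  by rewrite -(nth_take root na (wk x1 ++ _)) ea nth_take.
move: e12 a1; rewrite !nth_cat ltnNge le12 /= ltnn subnn size_cat => e12 a1.
apply: (dis (nth root (take j.+1 l2) 0)); last by rewrite (mem_take (mem_nth _ _)) // size_takel.
rewrite -e12; have /mem_take // : nth root (take i.+1 l1) (n - size (wk x1)) \in take i.+1 l1.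
by apply: mem_nth; rewrite ltn_subLR // (leq_trans na a1).
Qed.

(** Only the last [sigma] hyperedges of each leg of the spider serve as a base for the
    layers, so that the length of a walk to an end node is known up to [O(sigma)].
    The first [h.+2] layers are grown in one tree for all legs, the other ones in a
    tree of its own for each leg.  Thus no tree exceeds [smax] although the end
    nodes outnumber the vertices [PV] available for them, and two of the trees have
    an end node in common. *)
Lemma hypercycle_exists (PV : {set V}) u h (sigma := X ^ h * u) :
  (forall b e, pt b e \in PV) -> 0 < u -> 2 ^ h.+1 <= X -> h.+2 <= X ->
  72 * X * (X ^ h.+2 * (X ^ h.+2 * sigma)) + 14 <= smax ->
  #|PV| * 2 ^ h.+2 < X ^ h.+1 * (X ^ h.+2 * (X ^ h.+2 * sigma)) ->
  2 * (h.+2 + h.+2) < g ->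
  exists b C, [/\ hypercycle b C, 2 * (X * sigma) <= size C + 6 * sigma + 2
    & size C <= 2 * (X * sigma) + 4 * sigma + 2 + 2 * (h.+2 + h.+2)].
Proof.
move=> ptPV u0 two_X hX small pigeon gbig.
have X0 : 0 < X by move: X_gt2; clear; lia.
have s0 : 0 < sigma by rewrite muln_gt0 expn_gt0 X0.
set JJ := h.+2 in small pigeon gbig hX *.
have elam : X ^ h.+1 * u = X * sigma by rewrite expnS mulnA.
have esig : X ^ h * u = sigma by [].
clearbody sigma.
have KX : (2 * X) ^ h.+1 <= X ^ JJ by rewrite expnMn /JJ [in leqRHS]expnS leq_mul.
have XJ0 : 0 < X ^ JJ by rewrite expn_gt0 X0.
have [|S [wk [I [Ix [lf sp]]]]] := @spider_exists u h.+1 u0.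
  apply: leq_trans small; rewrite leq_add2r elam -mulnA leq_mul2l /=.
  have : (2 * X) ^ h.+1 * (X * sigma) <= X ^ JJ * (X * sigma) by rewrite leq_mul.
  have : X ^ JJ * (X * sigma) <= X ^ JJ * (X * (X ^ JJ * sigma)).
    by rewrite !leq_mul2l leq_pmull // !orbT.
  by clear; lia.
have [t cS /andP[K1 K2] lgs szs uns subs dis] := sp; rewrite elam in cS szs.
pose seg i := [set e in drop (X * sigma - sigma) (lf i)].
have sX : sigma <= X * sigma by rewrite leq_pmull.
have seg_lf i e : e \in seg i -> e \in lf i by rewrite inE => /mem_drop.
have segS i : i \in Ix -> seg i \subset S.
  by move=> iI; apply/subsetP=> e /seg_lf; exact: subs.
have seg_card i : i \in Ix -> #|seg i| = sigma.
  move=> iI; rewrite cardsE; have /card_uniqP -> := drop_uniq (X * sigma - sigma) (uns i iI).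
  by rewrite size_drop szs // subKn.
have seg_dis : {in Ix &, forall i j e, e \in seg i -> e \in seg j -> i = j}.
  by move=> i j iI jI e /seg_lf ei /seg_lf ej; exact: (dis i j iI jI e).
have Ix0 : 0 < #|Ix| by apply: leq_trans K1; rewrite expn_gt0 X0.
have IxX : #|Ix| <= X ^ JJ by exact: leq_trans K2 KX.
have [||S' [wk' [I1 [C1 [t' SS' eqw' II1 [cI1 cS' dis1 card1 C1P]]]]]] :=
  @layers S wk I Ix seg sigma JJ t segS seg_card seg_dis s0 Ix0.
- by move: cS; clear; lia.
- apply: leq_trans small; rewrite leq_add2r leq_mul2l; apply/orP; right.
  by rewrite leq_mul.
have s10 : 0 < X ^ JJ * sigma by rewrite muln_gt0 XJ0.
(* the part of the tree that leads to the i-th end set *)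
pose T i := S :|: \bigcup_(e in C1 i) [set y in wk' e].
have TS' i : i \in I1 -> T i \subset S'.
  move=> iI; rewrite subUset SS'; apply/bigcupsP=> e eC; apply/subsetP=> y.
  by rewrite inE; apply: (wk_sub t'); have [] := C1P _ _ iI eC.
have Tcl i : i \in I1 -> closedS wk' (T i).
  move=> iI y; rewrite inE => /orP[yS|/bigcupP[e eC]].
    by rewrite eqw' // => z zy; rewrite inE (wk_sub t yS).
  rewrite inE => ye z zy; rewrite inE; apply/orP; right; apply/bigcupP; exists e => //.
  have [eS' _] := C1P _ _ iI eC; have [q eq] := wk_prefix t' eS' ye.
  by rewrite inE eq mem_cat zy.
have tT i : i \in I1 -> tree (T i) wk' by move=> iI; apply: (tree_sub t' (TS' _ iI)); exact: Tcl.
have T_card i : i \in I1 -> #|T i| <= 4 * X * (X ^ JJ * sigma).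
  move=> iI.
  have : #|T i| <= #|S| + JJ * #|C1 i|.
    apply: (@leq_trans #|S :|: \bigcup_(e in C1 i) ([set y in wk' e] :\: S)|).
      apply/subset_leq_card/subsetP=> y; rewrite !inE; case: (boolP (y \in S)) => //= yS.
      move=> /bigcupP[e eC ye]; apply/bigcupP; exists e => //.
      by move: ye; rewrite !inE yS.
    apply: leq_trans (leq_card_setU _ _) _; rewrite leq_add2l.
    apply: leq_trans (card_bigcup_le _ _) _; rewrite mulnC -sum_nat_const.
    apply: leq_sum => e eC; have [_ [e0 [p [e0C szp ew _]]]] := C1P _ _ iI eC.
    have e0S : e0 \in S.
      exact: (subsetP (segS i (subsetP II1 _ iI)) _ e0C).
    apply: (@leq_trans #|[set y in p]|); last by rewrite cardsE -szp card_size.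
    apply/subset_leq_card/subsetP=> y; rewrite !inE ew mem_cat => /andP[yS /orP[|//]].
    by move/(wk_sub t e0S); rewrite (negPf yS).
  rewrite card1 // => h1; apply: leq_trans h1 _.
  have h2 : #|Ix| * (X * sigma) <= X ^ JJ * (X * sigma) by rewrite leq_mul.
  have h3 : JJ * (X ^ JJ * sigma) <= X * (X ^ JJ * sigma) by rewrite leq_mul.
  by move: cS h2 h3; clear; lia.
have C1T i : i \in I1 -> C1 i \subset T i.
  move=> iI; apply/subsetP=> e eC; rewrite inE; apply/orP; right; apply/bigcupP.
  by exists e; rewrite // inE (wk_mem t') //; have [] := C1P _ _ iI eC.
pose end_set i (S2 : {set E}) wk2 (C2 : {set E}) := [/\ tree S2 wk2, S \subset S2,
  {in S, wk2 =1 wk}, #|C2| = X ^ JJ * (X ^ JJ * sigma) &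
  forall e, e \in C2 -> e \in S2 /\ exists e0 p, [/\ e0 \in seg i, size p = JJ + JJ,
     wk2 e = wk e0 ++ p & {subset p <= S2 :\: S}]].
have ends i : i \in I1 -> exists S2 wk2 C2, end_set i S2 wk2 C2.
  move=> iI.
  have [||||||S2 [wk2 [U2 [C2 [t2 TS2 eqw2 UU2 [cU2 _ _ card2 C2P]]]]]] :=
    @layers (T i) wk' unit setT (fun=> C1 i) (X ^ JJ * sigma) JJ (tT i iI) _ _ _ s10.
  - by move=> _ _; exact: C1T.
  - by move=> _ _; exact: card1.
  - by move=> [] [].
  - by rewrite cardsT card_unit.
  - by rewrite cardsT card_unit mul1n T_card.
  - by rewrite cardsT card_unit mul1n.
  have ttU : tt \in U2.
    apply/negPn/negP => nt; move: cU2; rewrite cardsT card_unit (_ : U2 = set0) ?cards0 ?muln0 //.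
    by apply/setP=> -[]; rewrite inE (negPf nt).
  have SS2 : S \subset S2 by apply: subset_trans TS2; exact: subsetUl.
  exists S2, wk2, (C2 tt); split=> //.
  - by move=> y yS; rewrite eqw2 ?eqw' // inE yS.
  - exact: card2.
  move=> e eC2; have [eS2 [e1 [p2 [e1C sz2 w2 n2]]]] := C2P _ _ ttU eC2; split=> //.
  have [e1S' [e0 [p1 [e0C sz1 w1 n1]]]] := C1P _ _ iI e1C.
  exists e0, (p1 ++ p2); split=> //.
  - by rewrite size_cat sz1 sz2.
  - by rewrite w2 w1 catA.
  move=> y; rewrite mem_cat => /orP[yp|/n2]; last by rewrite !inE negb_or => /andP[/andP[-> _] ->].
  have := n1 y yp; rewrite !inE => /andP[-> _] /=; apply: (subsetP TS2).
  rewrite inE; apply/orP; right; apply/bigcupP; exists e1 => //.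
  by rewrite inE w1 mem_cat yp orbT.
have [f fP] : exists f : I -> {set E} * (E -> seq E) * {set E},
    forall i, i \in I1 -> end_set i (f i).1.1 (f i).1.2 (f i).2.
  have [|f fP] := @boolp.choice I ({set E} * (E -> seq E) * {set E})%type
    (fun i y => i \in I1 -> end_set i y.1.1 y.1.2 y.2); last by exists f.
  move=> i; case: (boolP (i \in I1)) => [iI|niI]; last by exists (set0, wk, set0).
  by have [S2 [wk2 [C2 es]]] := ends i iI; exists (S2, wk2, C2).
(* otherwise the end nodes of different trees would be different members of [PV] *)
have [i [j [e1 [e2 [iI jI ij [e1C e2C tops]]]]]] : exists i j e1 e2,
    [/\ i \in I1, j \in I1, i != j & [/\ e1 \in (f i).2, e2 \in (f j).2 &
     top (f i).1.2 e1 = top (f j).1.2 e2]].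
  apply: contrapT => none.
  have : (X ^ JJ * (X ^ JJ * sigma)) * #|I1| <= 1 * #|PV|.
    apply: (double_count (A := fun i => [set top (f i).1.2 e | e in (f i).2])).
    - move=> i iI; have [t2 _ _ c2 C2P] := fP i iI; rewrite -c2 card_in_imset //.
      by move=> e e' eC e'C; apply: (top_inj t2); [have [] := C2P e eC|have [] := C2P e' e'C].
    - by move=> i iI; apply/subsetP=> _ /imsetP[e _ ->]; exact: ptPV.
    move=> v _; rewrite leqNgt; apply/negP => /card_gt1P[i [j [iv jv ij]]].
    move: iv jv; rewrite !inE => /andP[iI /imsetP[e eC ev]] /andP[jI /imsetP[e' e'C e'v]].
    by apply: none; exists i, j, e, e'; split=> //; split=> //; rewrite -ev.
  set A := X ^ JJ * _ in pigeon *; rewrite mul1n => h1.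
  have h2 : X ^ h.+1 * A <= 2 ^ JJ * #|I1| * A by rewrite leq_mul // (leq_trans K1).
  have h3 : A * #|I1| * 2 ^ JJ <= #|PV| * 2 ^ JJ by rewrite leq_mul.
  by move: pigeon h2 h3; clear; lia.
have [t1 SS1 eqw1 _ C1P'] := fP i iI; have [t2 SS2 eqw2 _ C2P'] := fP j jI.
have [e1S [y1 [p1 [y1s szp1 w1 n1]]]] := C1P' e1 e1C.
have [e2S [y2 [p2 [y2s szp2 w2 n2]]]] := C2P' e2 e2C.
have [iIx jIx] := (subsetP II1 _ iI, subsetP II1 _ jI).
have y1S := subsetP (segS i iIx) _ y1s; have y2S := subsetP (segS j jIx) _ y2s.
have y12 : y1 != y2.
  by apply: contraNneq ij => ey; apply/eqP/(seg_dis i j iIx jIx y1 y1s); rewrite ey.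
have [k [g1 [g2 [q1 [q2 [/andP[k0 kJ] g1S g2S [v1 v2 sq1 sq2 [m1 m2 tops' g12]]]]]]]] :=
  peel t t1 t2 SS1 SS2 eqw1 eqw2 y1S y2S y12 e1S e2S w1 w2 szp1 szp2 n1 n2 tops.
have kg : 2 * k < g by apply: leq_ltn_trans gbig; rewrite leq_mul2l.
have [a [a0 a1 a2 ea adiff]] := common_prefix t y1S y2S.
have C_sz : size (zigzag a a ((f i).1.2 g1) ((f j).1.2 g2)) =
    (size (wk y1) + k - a) + (size (wk y2) + k - a).
  by rewrite size_cat size_rev !size_drop v1 v2 !size_cat sq1 sq2.
exists (odd a), (zigzag a a ((f i).1.2 g1) ((f j).1.2 g2)).
split; first by apply: (closing t t1 t2 SS1 SS2 eqw1 eqw2 y1S y2S g1S g2S v1 v2 sq1 sq2).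
all: rewrite C_sz.
all: have [b1 [_ mu1 lg1]] := lgs i iIx; have [b2 [_ mu2 lg2]] := lgs j jIx.
all: move: (y1s) (y2s); rewrite !inE => /(nthP root)[s1 s1_sz ey1] /(nthP root)[s2 s2_sz ey2].
all: rewrite nth_drop in ey1; rewrite nth_drop in ey2.
all: rewrite size_drop szs // subKn // in s1_sz; rewrite size_drop szs // subKn // in s2_sz.
all: have i1 : X * sigma - sigma + s1 < size (lf i) by rewrite szs //; move: s1_sz sX; clear; lia.
all: have i2 : X * sigma - sigma + s2 < size (lf j) by rewrite szs //; move: s2_sz sX; clear; lia.
all: have sy1 : size (wk y1) = size (wk b1) + (X * sigma - sigma + s1).+1
       by rewrite -ey1 lg1 // size_cat size_takel.
all: have sy2 : size (wk y2) = size (wk b2) + (X * sigma - sigma + s2).+1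
       by rewrite -ey2 lg2 // size_cat size_takel.
all: have am : a <= mu u h.+1 by apply: (branch_depth t lg1 lg2 i1 i2 _ _ mu1 mu2 _ a1 a2 ea);
       [rewrite ey1|rewrite ey2|move=> e h1 h2; case/eqP: ij; exact: (dis i j iIx jIx e h1 h2)].
all: have := mu_le u h; rewrite esig sy1 sy2.
- by move: am sX; clear; lia.
- by move: am mu1 mu2 s1_sz s2_sz sX kJ; clear; lia.
Qed.

End Hypergraph.

(** * A sparse random hypergraph *)

(** The vertices form [N] classes of size [M].  Hyperedge [i] contains the vertex
    [f (i, a)] of class [a], for a random function [f]; probabilities are expressed
    by numbers of functions. *)
Section RandomHypergraph.
Variables (N m M' : nat).
Local Notation M := M'.+1.
Local Notation X := ('I_m * 'I_N)%type.
Implicit Types (f : {ffun X -> 'I_M}) (S : {set 'I_m}).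

Definition hedge f i : {set 'I_N * 'I_M} := [set (a, f (i, a)) | a : 'I_N].

Lemma mem_hedge f i a v : ((a, v) \in hedge f i) = (f (i, a) == v).
Proof.
apply/imsetP/eqP => [[b _ [-> ->]]//|<-]; by exists a.
Qed.

Lemma card_hedge f i : #|hedge f i| = N.
Proof. by rewrite card_imset ?card_ord // => a b []. Qed.

(** The repeats of [S] are its missing vertices, by [repeats_cov].  As each of them
    repeats an entry of a hyperedge with a smaller index, it is determined by the
    entries that are not repeats. *)
Definition repeats f S : {set X} := [set x | (x.1 \in S) &&
  [exists i, [&& i \in S, i < x.1 & f (i, x.2) == f x]]].

Lemma repeats_cov f S : N * #|S| <= #|covered (hedge f) S| + #|repeats f S|.
Proof.
have -> : N * #|S| = #|setX S [set: 'I_N]| by rewrite cardsX cardsT card_ord mulnC.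
rewrite -(cardsID (repeats f S) (setX S setT)) [leqLHS]addnC; apply: leq_add; last first.
  by apply/subset_leq_card/subsetIr.
have inj : {in setX S [set: 'I_N] :\: repeats f S &, injective (fun x => (x.2, f x))}.
  move=> [i a] [j b]; rewrite !inE /= !andbT => /andP[ri iS] /andP[rj jS] [ab fab].
  subst b; congr (_, _); apply/val_inj/eqP/negPn/negP => ij.
  move: ij; rewrite neq_ltn => /orP[ij|ij].
    by move: rj; rewrite jS /= => /existsPn/(_ i); rewrite iS ij fab eqxx.
  by move: ri; rewrite iS /= => /existsPn/(_ j); rewrite jS ij fab eqxx.
rewrite -(card_in_imset inj); apply/subset_leq_card/subsetP=> _ /imsetP[[i a] h ->].
move: h; rewrite !inE /= !andbT => /andP[_ iS]; apply: (mem_cov iS).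
by rewrite mem_hedge.
Qed.

(** Following the pointers [p], which decrease the index, recovers [f] from its
    restriction to the complement of [Rep]. *)
Lemma few_pointed (Rep : {set X}) (p : {ffun X -> 'I_m}) :
  #|[set f : {ffun X -> 'I_M} | [forall (x | x \in Rep), (p x < x.1) && (f x == f (p x, x.2))]]| * M ^ #|Rep|
  <= M ^ (m * N).
Proof.
set A := [set f : _ | _].
pose restrict f : {ffun X -> 'I_M} := [ffun x => if x \in Rep then ord0 else f x].
have inj : {in A &, injective restrict}.
  move=> f f'; rewrite !inE => /forallP fA /forallP f'A /ffunP eff'; apply/ffunP => -[i a].
  elim/ltn_ind: {i}(val i) {-2}i (erefl (val i)) => n IH i ei.
  have := eff' (i, a); rewrite !ffunE; case: (boolP ((i, a) \in Rep)) => // ia _.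
  have := fA (i, a); rewrite ia => /andP[lt_p /eqP->].
  have := f'A (i, a); rewrite ia => /andP[_ /eqP->].
  by apply: (IH (p (i, a))) => //; rewrite -ei.
rewrite -(card_in_imset inj).
have sub : [set restrict f | f in A] \subset pffun_on ord0 (mem (~: Rep)) predT.
  apply/subsetP=> _ /imsetP[f _ ->]; apply/pffun_onP; split=> //.
  by apply/subsetP=> x; rewrite !inE ffunE; case: (x \in Rep); rewrite ?eqxx.
apply: leq_trans (leq_mul (subset_leq_card sub) (leqnn _)) _.
rewrite card_pffun_on card_ord -expnD leq_pexp2l //.
by rewrite addnC cardsC card_prod !card_ord.
Qed.

(** The union bound over the positions of [r] repeats and over their pointers. *)
Lemma few_crowded S t r : #|S| = t -> 0 < t ->
  #|[set f : {ffun X -> 'I_M} | #|covered (hedge f) S| + r <= N * t]| * M ^ r <= 'C(N * t, r) * t ^ r * M ^ (m * N).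
Proof.
move=> St t0; have [i0 i0S] : exists i, i \in S by apply/card_gt0P; rewrite St.
pose Reps := [set Rep : {set X} | Rep \subset setX S setT & #|Rep| == r].
have cardReps : #|Reps| = 'C(N * t, r).
  by rewrite /Reps cards_draws cardsX cardsT card_ord St mulnC.
pose P (Rep : {set X}) := [set p in pffun_on i0 (mem Rep) (mem S)].
pose A (Rep : {set X}) (p : {ffun X -> 'I_m}) :=
  [set f : {ffun X -> 'I_M} | [forall (x | x \in Rep), (p x < x.1) && (f x == f (p x, x.2))]].
apply: (@leq_trans (#|\bigcup_(Rep in Reps) \bigcup_(p in P Rep) A Rep p| * M ^ r)).
  rewrite leq_mul2r; apply/orP; right; apply/subset_leq_card/subsetP=> f.
  rewrite inE => crowd.
  have : r <= #|repeats f S|.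
    have := repeats_cov f S; rewrite St => h; rewrite -(leq_add2l #|covered (hedge f) S|).
    exact: leq_trans h.
  case/subset_card_exists => Rep RepS cRep; apply/bigcupP; exists Rep.
    rewrite inE cRep eqxx andbT; apply: subset_trans RepS _.
    by apply/subsetP=> x; rewrite !inE => /andP[->].
  pose good (x : X) (i : 'I_m) := [&& i \in S, i < x.1 & f (i, x.2) == f x].
  pose p : {ffun X -> 'I_m} := [ffun x => if x \in Rep then odflt i0 [pick i | good x i] else i0].
  have pP x : x \in Rep -> good x (p x).
    move=> xR; rewrite ffunE xR; case: pickP => //= none.
    have /(subsetP RepS) := xR; rewrite inE => /andP[_ /existsP[i gi]].
    by have := none i; rewrite /good gi.
  apply/bigcupP; exists p.
    rewrite inE; apply/pffun_onP; split=> [|_ /imageP[x /pP/and3P[? _ _] ->]] //.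
      by apply/subsetP=> x; rewrite !inE ffunE; case: (x \in Rep); rewrite ?eqxx.
  rewrite inE; apply/forallP=> x; apply/implyP=> /pP/and3P[_ -> /eqP->].
  by rewrite eqxx.
have bound Rep : Rep \in Reps -> #|\bigcup_(p in P Rep) A Rep p| * M ^ r <= t ^ r * M ^ (m * N).
  rewrite inE => /andP[RepS /eqP cRep].
  have cP : #|P Rep| = t ^ r by rewrite cardsE card_pffun_on cRep St.
  rewrite -cP; apply: leq_trans (leq_mul (card_bigcup_le _ _) (leqnn _)) _.
  rewrite big_distrl -sum_nat_const /=; apply: leq_sum => p _.
  by rewrite -cRep; exact: few_pointed.
apply: leq_trans (leq_mul (card_bigcup_le _ _) (leqnn _)) _.
rewrite big_distrl -cardReps -mulnA -sum_nat_const /=; exact: leq_sum.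
Qed.

Variables (D s g : nat).
Hypotheses (mD : m = D * M) (N0 : 0 < N) (D0 : 0 < D).

Local Notation Omega := (M ^ (m * N)).

Lemma bin_exp_le' n t r : 0 < t -> t <= r -> 'C(n * t, r) <= (4 * n) ^ r.
Proof.
move=> t0 tr; have r0 : 0 < r by exact: leq_trans tr.
rewrite -(leq_pmul2r (_ : 0 < r ^ r)) ?expn_gt0 ?r0 //.
apply: leq_trans (bin_exp_le _ _) _; rewrite -expnMn leq_exp2r //.
by rewrite mulnA leq_mul2l tr orbT.
Qed.

Lemma crowded_union t r : 0 < t ->
  #|[set f : {ffun X -> 'I_M} |
      [exists (S : {set 'I_m} | #|S| == t), #|covered (hedge f) S| + r <= N * t]]| * M ^ r
  <= 'C(m, t) * ('C(N * t, r) * t ^ r * Omega).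
Proof.
move=> t0; pose T := [set S : {set 'I_m} | #|S| == t].
have cT : #|T| = 'C(m, t) by have := card_draws 'I_m t; rewrite card_ord.
pose F (S : {set 'I_m}) :=
  [set f : {ffun X -> 'I_M} | #|covered (hedge f) S| + r <= N * t].
apply: (@leq_trans (#|\bigcup_(S in T) F S| * M ^ r)).
  rewrite leq_mul2r; apply/orP; right; apply/subset_leq_card/subsetP=> f.
  rewrite inE => /existsP[S /andP[St cr]]; apply/bigcupP; exists S; rewrite ?inE //.
apply: leq_trans (leq_mul (card_bigcup_le _ _) (leqnn _)) _.
rewrite big_distrl -cT -sum_nat_const /=; apply: leq_sum => S; rewrite inE => /eqP St.
exact: few_crowded.
Qed.

(** With [t + t / 4] repeats the [D * M] hyperedges lead to a choice of [M ^ t] sets,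
    against the probability [M ^ - (t + t / 4)]; the remaining power of [M] beats
    [t ^ (t / 4)] and all constants, up to [t = s].  The factor [4 ^ t] allows
    for a summation over [t]. *)
Lemma few_dense t : 0 < t -> t <= s -> s * (256 * D * N ^ 2) ^ 4 <= M ->
  #|[set f : {ffun X -> 'I_M} | [exists (S : {set 'I_m} | #|S| == t),
     #|covered (hedge f) S| + (t + (t %/ 4).+1) <= N * t]]| * 4 ^ t <= Omega.
Proof.
move=> t0 ts sM; have := crowded_union (t + (t %/ 4).+1) t0.
set b := #|_|; set q := (t %/ 4).+1 => hb.
have qt : q <= t by rewrite /q; move: t0; clear; lia.
have tq : t <= 4 * q by rewrite /q; clear; lia.
pose A := 64 * D * N ^ 2.
have A0 : 0 < A by rewrite /A !muln_gt0 D0 ?expn_gt0 ?N0.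
have h1 : b * M ^ q <= A ^ t * t ^ q * Omega.
  have tt0 : 0 < t ^ t * M ^ t by rewrite muln_gt0 !expn_gt0 t0.
  rewrite -(leq_pmul2r tt0).
  have -> : b * M ^ q * (t ^ t * M ^ t) = b * M ^ (t + q) * t ^ t.
    by rewrite expnD; clear; lia.
  apply: leq_trans (leq_mul hb (leqnn _)) _.
  have hC : 'C(N * t, t + q) <= (4 * N) ^ (t + t).
    apply: leq_trans (bin_exp_le' _ t0 (leq_addr _ _)) _.
    by rewrite leq_pexp2l ?muln_gt0 ?N0 // leq_add2l.
  have hm := bin_exp_le m t.
  have -> : 'C(m, t) * ('C(N * t, t + q) * t ^ (t + q) * Omega) * t ^ t =
     ('C(m, t) * t ^ t) * 'C(N * t, t + q) * (t ^ t * t ^ q * Omega).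
    by rewrite expnD; clear; lia.
  apply: leq_trans (leq_mul (leq_mul hm hC) (leqnn _)) _; apply/eq_leq.
  rewrite mD /A (_ : 64 * D * N ^ 2 = 4 * D * ((4 * N) * (4 * N))); last by clear; nia.
  rewrite (_ : 4 * (D * M) = 4 * D * M); last by rewrite mulnA.
  by rewrite expnD !(expnMn _ _ t); clear; lia.
have h2 : t ^ q * (4 * A) ^ t <= M ^ q.
  have : t * (4 * A) ^ 4 <= M.
    apply: leq_trans sM; rewrite leq_mul // leq_exp2r // /A; clear; lia.
  move=> h; apply: (@leq_trans ((t * (4 * A) ^ 4) ^ q)); last by rewrite leq_exp2r.
  rewrite [leqRHS]expnMn leq_mul2l -expnM; apply/orP; right.
  by apply: leq_pexp2l tq; rewrite muln_gt0 A0.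
have h3 := leq_mul (leqnn b) h2.
have p0 : 0 < A ^ t * t ^ q by rewrite muln_gt0 !expn_gt0 A0 t0.
rewrite -(leq_pmul2l p0); apply: leq_trans (_ : b * (t ^ q * (4 * A) ^ t) <= _).
  by rewrite expnMn; apply/eq_leq; clear; lia.
exact: leq_trans h3 h1.
Qed.

(** The average number of sets of [t] hyperedges containing a cycle is bounded
    independently of [M]. *)
Lemma few_short t : 0 < t ->
  \sum_f #|[set S : {set 'I_m} | (#|S| == t) && (#|covered (hedge f) S| + t <= N * t)]|
  <= (16 * D * N) ^ t * Omega.
Proof.
move=> t0; pose T := [set S : {set 'I_m} | #|S| == t].
pose F (S : {set 'I_m}) :=
  [set f : {ffun X -> 'I_M} | #|covered (hedge f) S| + t <= N * t].
have cT : #|T| = 'C(m, t) by have := card_draws 'I_m t; rewrite card_ord.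
have -> : \sum_f #|[set S : {set 'I_m} | (#|S| == t) && (#|covered (hedge f) S| + t <= N * t)]|
    = \sum_(S in T) #|F S|.
  under eq_bigr => f _ do rewrite -sum1_card big_mkcond /=.
  rewrite exchange_big [RHS]big_mkcond /=; apply: eq_bigr => S _.
  rewrite inE; case: eqP => St; last first.
    by apply: big1 => f _; rewrite inE; case: eqP => // /St.
  rewrite -sum1_card [RHS]big_mkcond /=; apply: eq_bigr => f _.
  by rewrite !inE St eqxx.
have Mt : 0 < M ^ t by rewrite expn_gt0.
rewrite -(leq_pmul2r Mt) big_distrl /=.
apply: (@leq_trans (\sum_(S in T) 'C(N * t, t) * t ^ t * Omega)).
  by apply: leq_sum => S; rewrite inE => /eqP St; exact: few_crowded.
rewrite sum_nat_const cT.
have hC := bin_exp_le' N t0 (leqnn t); have hm := bin_exp_le m t.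
rewrite (_ : _ * (_ * _ * _) = ('C(m, t) * t ^ t) * 'C(N * t, t) * Omega); last by clear; lia.
apply: leq_trans (leq_mul (leq_mul hm hC) (leqnn _)) _; apply/eq_leq.
rewrite mD (_ : 16 * D * N = 4 * D * (4 * N)); last by clear; lia.
rewrite (_ : 4 * (D * M) = 4 * D * M); last by rewrite mulnA.
by rewrite !(expnMn _ _ t); clear; lia.
Qed.

(** Most functions have no dense set, and some of these have few short cycles; remove
    one hyperedge from each set of at most [g] hyperedges that contains a cycle. *)
Lemma sparse_hypergraph : s * (256 * D * N ^ 2) ^ 4 <= M -> 4 * (g * (16 * D * N) ^ g) <= m ->
  exists (f : {ffun X -> 'I_M}) (I : {set 'I_m}), m <= 2 * #|I| /\
   forall S : {set 'I_m}, S \subset I ->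
    (#|S| <= s -> 4 * N.-1 * #|S| <= 4 * #|covered (hedge f) S| + #|S|) /\
    (0 < #|S| <= g -> N.-1 * #|S| < #|covered (hedge f) S|).
Proof.
move=> sM gm; pose cg := g * (16 * D * N) ^ g.
have m0 : 0 < m by rewrite mD muln_gt0 D0.
pose short f t := [set S : {set 'I_m} | (#|S| == t) && (#|covered (hedge f) S| + t <= N * t)].
pose bad t := [set f : {ffun X -> 'I_M} | [exists (S : {set 'I_m} | #|S| == t),
     #|covered (hedge f) S| + (t + (t %/ 4).+1) <= N * t]].
pose Bad := \bigcup_(t in [set: 'I_s]) bad t.+1.
have W0 : 0 < Omega by rewrite expn_gt0.
have BadW : 3 * #|Bad| <= Omega.
  have h1 : #|Bad| <= \sum_(t < s) #|bad t.+1|.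
    apply: leq_trans (card_bigcup_le _ _) _; apply/eq_leq.
    by apply: eq_bigl => t; rewrite inE.
  have := @geometric_sum (fun t => #|bad t.+1|) s Omega.
  move=> /(_ (fun t ts => few_dense (ltn0Sn t) ts sM)) h2.
  have p0 : 0 < 4 ^ s by rewrite expn_gt0.
  rewrite -(leq_pmul2r p0) (leq_trans _ (leq_trans (leq_addr _ _) h2)) //.
  by rewrite mulnAC leq_mul2l h1 orbT.
have total : \sum_f \sum_(t < g) #|short f t.+1| <= cg * Omega.
  rewrite exchange_big /= /cg -mulnA -[g in g * _]card_ord -sum_nat_const.
  apply: leq_sum => t _; apply: leq_trans (few_short (ltn0Sn t)) _.
  by rewrite leq_mul2r leq_pexp2l ?muln_gt0 ?D0 ?N0 ?orbT.
have [f [fBad fshort]] : exists f, f \notin Bad /\ \sum_(t < g) #|short f t.+1| <= 2 * cg.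
  apply: contrapT => none.
  have h1 : #|~: Bad| * (2 * cg).+1 <= \sum_f \sum_(t < g) #|short f t.+1|.
    rewrite -sum_nat_const [leqLHS]big_mkcond /=; apply: leq_sum => f _.
    rewrite inE; case: (boolP (f \in Bad)) => //= fB.
    by rewrite ltnNge; apply/negP => le_f; apply: none; exists f.
  have h2 : #|Bad| + #|~: Bad| = Omega by rewrite cardsC card_ffun card_prod !card_ord.
  have h3 := leq_trans h1 total.
  have h4 : 2 * Omega <= 3 * #|~: Bad| by move: h2 BadW; clear; lia.
  have h5 : 2 * Omega * (2 * cg).+1 <= 3 * #|~: Bad| * (2 * cg).+1 by rewrite leq_mul.
  have h6 : cg * Omega = Omega * cg by rewrite mulnC.
  by move: W0 h3 h5 h6; clear; lia.
pose i0 : 'I_m := Ordinal m0.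
pose pk (S : {set 'I_m}) := odflt i0 [pick x in S].
pose Short := \bigcup_(t in [set: 'I_g]) short f t.+1.
have cShort : #|Short| <= 2 * cg.
  apply: leq_trans fshort; apply: leq_trans (card_bigcup_le _ _) _; apply/eq_leq.
  by apply: eq_bigl => t; rewrite inE.
pose R := [set pk S | S in Short].
exists f, (~: R); split.
  have cR : #|R| <= 2 * cg by apply: leq_trans cShort; exact: leq_imset_card.
  have : #|R| + #|~: R| = m by rewrite cardsC card_ord.
  move: gm cR; rewrite -/cg; move: #|R| #|~: R| (cg) => y z c; clear; lia.
have NS x : N * x = x + N.-1 * x by rewrite -{1}(prednK N0) mulSn.
move=> S SR; split.
  move=> Ss; case: (posnP #|S|) => [->|S0]; first by rewrite !muln0.
  have : ~~ (#|covered (hedge f) S| + (#|S| + (#|S| %/ 4).+1) <= N * #|S|).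
    apply/negP=> cr; case/negP: fBad; apply/bigcupP.
    have lt : #|S|.-1 < s by rewrite prednK.
    by exists (Ordinal lt); rewrite ?inE //= prednK //; apply/existsP; exists S; rewrite eqxx.
  rewrite -ltnNge (NS #|S|); have := leq_divM #|S| 4; rewrite -mulnA.
  move: (#|S| %/ 4) (N.-1 * #|S|) #|covered _ S| => q p c; clear; lia.
move=> /andP[S0 Sg]; rewrite ltnNge; apply/negP => cS.
have : pk S \in R.
  apply: imset_f; apply/bigcupP; have lt : #|S|.-1 < g by rewrite prednK.
  exists (Ordinal lt); rewrite ?inE //= prednK // eqxx /=.
  by rewrite (NS #|S|) [leqLHS]addnC leq_add2l.
have pS : pk S \in S.
  rewrite /pk; case: pickP => //= none.
  by case/card_gt0P: S0 => x xS; have := none x; rewrite xS.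
by have := subsetP SR _ pS; rewrite inE => /negPf->.
Qed.

End RandomHypergraph.

(** * Flexible pairs in a colour class *)

(** The lexicographic order of the paths from the root enumerates the vertices of a
    tree in preorder. *)
Fixpoint lexle (s t : seq nat) :=
  match s, t with
  | [::], _ => true
  | _ :: _, [::] => false
  | a :: s', b :: t' => (a < b) || (a == b) && lexle s' t'
  end.

Lemma lexle_total : total lexle.
Proof.
elim=> [|a s IH] [|b t] //=; case: (ltngtP a b) => //= _; exact: IH.
Qed.

Lemma lexle_trans : transitive lexle.
Proof.
move=> t s u; elim: s t u => [|a s IH] [|b t] [|c u] //=.
case/orP=> [ab|/andP[/eqP<- st]]; case/orP=> [bc|/andP[/eqP<- tu]].
- by rewrite (ltn_trans ab bc).
- by rewrite ab.
- by rewrite bc.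
- by rewrite eqxx (IH t u st tu) orbT.
Qed.

Lemma lexle_anti : antisymmetric lexle.
Proof.
elim=> [|a s IH] [|b t] //=; case: (ltngtP a b) => //= -> st.
by rewrite (IH t st).
Qed.

Lemma lexle_cat u v : lexle u (u ++ v).
Proof. by elim: u => //= a u ->; rewrite eqxx orbT. Qed.

(** So the descendants of a vertex form an interval. *)
Lemma lexle_prefix u v t : lexle u t -> lexle t (u ++ v) -> exists t', t = u ++ t'.
Proof.
elim: u t => [|a u IH] [|b t] //=; first by exists [::].
  by exists (b :: t).
case: (ltngtP a b) => //= <- ut tuv.
by have [t' ->] := IH t ut tuv; exists t'.
Qed.

Section Sparse.
Variables (V : finType) (F : rel V) (s0 : nat).
Hypothesis F_sym : symmetric F.
Hypothesis F_irr : irreflexive F.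
Hypothesis F_sparse : forall S : {set V}, #|S| <= s0 ->
  #|[set p : V * V | [&& p.1 \in S, p.2 \in S & F p.1 p.2]]| <= 3 * #|S|.

Implicit Types S T W : {set V}.

Definition attached S := [set y | (y \notin S) && (1 < #|[set x in S | F x y]|)].

(** If there were [3 * #|S| + 1] such vertices, each would contribute four ordered
    pairs, and the union with [S] would violate [F_sparse]. *)
Lemma attached_few S : (4 * #|S|).+1 <= s0 -> #|attached S| <= 3 * #|S|.
Proof.
move=> Ss; rewrite leqNgt; apply/negP => /subset_card_exists[R RA cR].
have dis : [disjoint S & R].
  apply/pred0P => y /=; apply/negP => /andP[yS /(subsetP RA)].
  by rewrite inE yS.
have cSR : #|S :|: R| = (4 * #|S|).+1 by rewrite cardsU (disjoint_setI0 dis) cards0 cR; lia.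
have := F_sparse (S := S :|: R); rewrite cSR => /(_ Ss).
pose A y := [set p : V * V | ((p.1 \in S) && (p.2 == y) || (p.2 \in S) && (p.1 == y)) && F p.1 p.2].
set PP := [set p | _] => cPP.
have : 4 * #|R| <= 1 * #|PP|; last by rewrite mul1n cR; move: cPP; clear; lia.
apply: (double_count (A := A)).
- move=> y yR; have := subsetP RA _ yR; rewrite inE => /andP[yS].
  set B := [set x in S | F x y] => B2.
  pose in1 (x : V) : V * V := (x, y); pose in2 (x : V) : V * V := (y, x).
  have sub : in1 @: B :|: in2 @: B \subset A y.
    apply/subsetP=> p; rewrite inE => /orP[] /imsetP[x]; rewrite inE => /andP[xS xy ->];
      rewrite inE /= ?xS ?eqxx ?xy ?orbT //=.
    by rewrite F_sym.
  apply: leq_trans (subset_leq_card sub).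
  have d2 : in1 @: B :&: in2 @: B = set0.
    apply/setP=> p; rewrite !inE; apply/negP=> /andP[/imsetP[x xB ->] /imsetP[x' x'B [xy _]]].
    by move: xB; rewrite inE xy (negPf yS).
  by rewrite cardsU d2 cards0 subn0 !card_imset; [move: B2; clear; lia | move=> ? ? [] | move=> ? ? []].
- move=> y yR; apply/subsetP=> -[a b]; rewrite !inE /= => /andP[ab Fab].
  by rewrite Fab; case/orP: ab => /andP[-> /eqP->]; rewrite yR ?orbT.
- move=> p _; rewrite leqNgt; apply/negP => /card_gt1P[y [y' [yp y'p ne]]].
  move: yp y'p; rewrite !inE => /andP[yR /andP[h _]] /andP[y'R /andP[h' _]].
  have nS z : z \in R -> z \notin S by move/(subsetP RA); rewrite inE => /andP[].
  case/orP: h h' => /andP[pS /eqP py] /orP[] /andP[p'S /eqP p'y'].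
  + by rewrite -py p'y' eqxx in ne.
  + by have := nS _ yR; rewrite -py p'S.
  + by have := nS _ yR; rewrite -py p'S.
  + by rewrite -py p'y' eqxx in ne.
Qed.

Lemma contacts_few S : (4 * #|S|).+1 <= s0 ->
  #|[set p : V * V | [&& p.1 \in S, F p.1 p.2 & p.2 \in S :|: attached S]]| <= 12 * #|S|.
Proof.
move=> Ss; have cA := attached_few Ss.
have cU : #|S :|: attached S| <= 4 * #|S|.
  by apply: leq_trans (leq_card_setU _ _) _; move: cA; clear; lia.
have Us : #|S :|: attached S| <= s0 by apply: leq_trans cU (ltnW Ss).
have sub : [set p : V * V | [&& p.1 \in S, F p.1 p.2 & p.2 \in S :|: attached S]] \subset
  [set p | [&& p.1 \in S :|: attached S, p.2 \in S :|: attached S & F p.1 p.2]].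
  by apply/subsetP=> p; rewrite !inE => /and3P[-> -> ->].
apply: leq_trans (subset_leq_card sub) _; apply: leq_trans (F_sparse Us) _.
by move: cU; clear; lia.
Qed.

Section ColourClass.
Variable Gam : rel V.
Hypothesis Gam_sym : symmetric Gam.
Hypothesis Gam_F : forall x y, Gam x y -> F x y.

(** The edges are in the colour class [Gam], but the path is induced in the whole
    graph [F]. *)
Definition ipath x y (P : seq V) := [/\ uniq P, 0 < size P, nth x P 0 = x, last x P = y &
  (forall i, i.+1 < size P -> Gam (nth x P i) (nth x P i.+1)) /\
  (forall i j, i < j -> j < size P -> F (nth x P i) (nth x P j) -> j = i.+1)].

(** The condition for extending an induced path [P] from its end [y] to [z]. *)
Definition clean (P : seq V) y z := [&& Gam y z, z \notin P & all (fun w => F w z ==> (w == y)) P].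

Lemma ipath1 x : ipath x x [:: x].
Proof. by split=> //; split=> [[]|i [|j]]. Qed.

Lemma ipath_rcons x y z P : ipath x y P -> clean P y z -> ipath x z (rcons P z).
Proof.
move=> [uP P0 h l [gP iP]] /and3P[yz zP /allP cl].
have lastP : nth x P (size P).-1 = y by rewrite nth_last.
split; rewrite ?rcons_uniq ?zP ?size_rcons ?last_rcons //; first by rewrite nth_rcons P0.
split=> [i|i j ij]; rewrite ltnS leq_eqVlt => /orP[/eqP ei|lt].
- rewrite !nth_rcons -ei ltnS leqnn ltnn eqxx; move: lastP.
  by rewrite -ei /= => ->.
- by rewrite !nth_rcons lt (ltnW lt); exact: gP.
- rewrite !nth_rcons ei ltnn eqxx -ei ij => Fz; have iP' : i < size P by rewrite -ei.
  have := cl _ (mem_nth x iP'); rewrite Fz /= -lastP nth_uniq ?prednK //.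
  by move=> /eqP ->; rewrite ei prednK.
- by rewrite !nth_rcons lt (ltn_trans ij lt); exact: iP.
Qed.

(** A cycle running through [P] can be lengthened by one, through [Q]. *)
Definition flexible n := exists x y P Q, [/\ ipath x y P, ipath x y Q,
  size Q = (size P).+1 & size Q <= n].

Section Ball.
Variables (W : {set V}) (x : V) (L : nat).
Hypothesis xW : x \in W.
Hypothesis VL : #|V| <= 2 ^ L.
Hypothesis s0L : 8 * L.+1 + 1 <= s0.
Hypothesis rigid : ~ flexible L.+2.

(** Breadth-first search within [W] that only uses edges by which the path [pth z]
    from the root stays induced in [F]; [bfs_sat] says that the levels before the
    last one have been processed. *)
Record bfs n (T : {set V}) (pth : V -> seq V) : Prop := Bfs {
  bfs_root : x \in T /\ pth x = [:: x];
  bfs_sub : T \subset W;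
  bfs_step : forall z, z \in T -> z = x \/
    exists y, [/\ y \in T, clean (pth y) y z & pth z = rcons (pth y) z];
  bfs_size : forall z, z \in T -> size (pth z) <= n.+1;
  bfs_sat : forall z z', z \in T -> z' \in W -> clean (pth z) z z' ->
    z' \in T /\ size (pth z') <= (size (pth z)).+1 \/ size (pth z) = n.+1
}.

Definition frontier T (pth : V -> seq V) :=
  [set z' in W | (z' \notin T) && [exists z in T, clean (pth z) z z']].

Lemma bfs_grow n T pth : bfs n T pth -> exists pth', bfs n.+1 (T :|: frontier T pth) pth'.
Proof.
move=> [[xT px] TW step sz sat].
pose par z' := odflt x [pick z in T | clean (pth z) z z'].
pose pth' v := if v \in T then pth v else rcons (pth (par v)) v.
have parP z' : z' \in frontier T pth -> par z' \in T /\ clean (pth (par z')) (par z') z'.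
  rewrite inE => /and3P[_ _ /existsP[z hz]]; rewrite /par; case: pickP => [y /andP[]//|none].
  by have := none z; rewrite hz.
have pT z : z \in T -> pth' z = pth z by rewrite /pth' => ->.
have fT z : z \in frontier T pth -> z \notin T by rewrite inE => /and3P[].
have szpar z : z \in frontier T pth -> size (pth (par z)) = n.+1.
  move=> zf; have [pT' cl] := parP z zf.
  have zW : z \in W by move: zf; rewrite inE => /and3P[].
  by case: (sat _ _ pT' zW cl) => // -[zT _]; have := fT z zf; rewrite zT.
exists pth'; split.
- by rewrite inE xT pT.
- by rewrite subUset TW; apply/subsetP=> z; rewrite inE => /and3P[].
- move=> z; rewrite inE => /orP[zT|zf].
    case: (step z zT) => [|[y [yT cl e]]]; first by left.
    by right; exists y; rewrite inE yT !pT.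
  right; exists (par z); have [pT' cl] := parP z zf.
  by rewrite inE pT' pT // /pth' (negPf (fT z zf)).
- move=> z; rewrite inE => /orP[zT|zf]; first by rewrite pT // ltnW // ltnS sz.
  by rewrite /pth' (negPf (fT z zf)) size_rcons szpar.
- move=> z z'; rewrite inE => /orP[zT|zf] z'W; last first.
    by move=> _; right; rewrite /pth' (negPf (fT z zf)) size_rcons szpar.
  rewrite pT // => cl; left; case: (boolP (z' \in T)) => z'T.
    rewrite inE z'T pT //; split=> //.
    case: (sat _ _ zT z'W cl) => [[]//|->]; exact: leqW (sz _ z'T).
  have z'f : z' \in frontier T pth.
    by rewrite inE z'W z'T; apply/existsP; exists z; rewrite zT.
  rewrite inE z'f orbT; split=> //.
  rewrite /pth' (negPf z'T) size_rcons szpar //.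
  case: (sat _ _ zT z'W cl) => [[z'T' _]|->//]; by rewrite z'T' in z'T.
Qed.

(** As long as the frontier exceeds the tree, the tree doubles in each round. *)
Lemma bfs_stop : exists n T pth, [/\ bfs n T pth, n <= L & #|frontier T pth| <= #|T|].
Proof.
have main n : n <= L -> (exists n T pth, [/\ bfs n T pth, n <= L & #|frontier T pth| <= #|T|]) \/
    exists T pth, bfs n T pth /\ 2 ^ n <= #|T|.
  elim: n => [|n IH] nL.
    right; exists [set x], (fun=> [:: x]); rewrite cards1; split=> //; split.
    - by rewrite inE.
    - by rewrite sub1set.
    - by move=> z; rewrite inE => /eqP; left.
    - by [].
    - by right.
  case: IH => [|?|[T [pth [st big]]]]; [exact: ltnW | by left |].
  case: (leqP #|frontier T pth| #|T|) => h; [left | right].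
    by exists n, T, pth; split=> //; exact: ltnW.
  have [pth' st'] := bfs_grow st; exists (T :|: frontier T pth), pth'; split=> //.
  rewrite cardsU (_ : _ :&: _ = set0) ?cards0 ?subn0; last first.
    by apply/setP=> z; rewrite !inE; case: (z \in T); rewrite ?andbF.
  by rewrite expnS; move: big h; clear; lia.
case: (main L (leqnn L)) => // -[T [pth [st big]]].
exists L, T, pth; split=> //; rewrite (_ : frontier _ _ = set0) ?cards0 //.
have TT : T = setT by apply/eqP; rewrite eqEcard subsetT cardsT (leq_trans VL).
by apply/setP=> z; rewrite TT !inE andbF.
Qed.

Section Tree.
Variables (n : nat) (T : {set V}) (pth : V -> seq V).
Hypotheses (st : bfs n T pth) (nL : n <= L).

Lemma pth_rcons z : z \in T -> exists w, pth z = rcons w z.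
Proof.
by case/(bfs_step st) => [->|[y [_ _ ->]]]; [exists [::]; have [_] := bfs_root st | exists (pth y)].
Qed.

Lemma pth_mem z : z \in T -> z \in pth z.
Proof. by case/pth_rcons=> w ->; rewrite mem_rcons mem_head. Qed.

Lemma pth_ind (Q : V -> Prop) : Q x ->
  (forall y z, y \in T -> z \in T -> Q y -> clean (pth y) y z -> pth z = rcons (pth y) z -> Q z) ->
  forall z, z \in T -> Q z.
Proof.
move=> Qx Qs z; elim/ltn_ind: {z}(size (pth z)) {-2}z (erefl (size (pth z))) => k IH z sz zT.
case: (bfs_step st zT) => [->//|[y [yT cl e]]]; apply: (Qs y) => //.
by apply: (IH (size (pth y))) => //; rewrite -sz e size_rcons.
Qed.

Lemma pth_ipath z : z \in T -> ipath x z (pth z).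
Proof.
move: z; apply: pth_ind => [|y z _ _ ip cl ->]; last exact: ipath_rcons cl.
by have [_ ->] := bfs_root st; exact: ipath1.
Qed.

Lemma pth_prefix z : z \in T -> forall w, w \in pth z -> w \in T /\ exists q, pth z = pth w ++ q.
Proof.
move: z; apply: pth_ind => [w|y z yT zT IH cl e w].
  have [xT ->] := bfs_root st; rewrite inE => /eqP->; split=> //.
  by have [_ ->] := bfs_root st; exists [::].
rewrite e mem_rcons inE => /orP[/eqP->|/IH[wT [q ->]]].
  by split=> //; exists [::]; rewrite e cats0.
by split=> //; exists (rcons q z); rewrite rcons_cat.
Qed.

(** Neighbours of [z] that are adjacent in [F] to another vertex of its path. *)
Definition bad z := [set z' in W | Gam z z' && [exists w, [&& w \in pth z, w != z & F w z']]].

Lemma clean_or_bad z z' : z \in T -> z' \in T -> Gam z z' ->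
  odd (size (pth z)) = odd (size (pth z')) -> z' \notin bad z -> clean (pth z) z z'.
Proof.
move=> zT z'T zz' par nb; apply/and3P; split=> //.
  apply/negP => z'z; have [_ [q eq]] := pth_prefix zT z'z.
  have ip := pth_ipath zT; have [u sz0 _ lz [_ ind]] := ip.
  have [w ew] := pth_rcons z'T.
  have nz' : nth x (pth z) (size w) = z'.
    by rewrite eq ew nth_cat size_rcons ltnS leqnn nth_rcons ltnn eqxx.
  have nz : nth x (pth z) (size (pth z)).-1 = z by rewrite nth_last.
  case: (posnP (size q)) => [/size0nil q0|q0].
    have zz : z = z'.
      have [w2 ew2] := pth_rcons zT.
      by move: eq; rewrite q0 cats0 ew ew2 => /rcons_inj[].
    by have := Gam_F zz'; rewrite zz F_irr.
  have szz : size (pth z) = (size w).+1 + size q by rewrite eq ew size_cat size_rcons.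
  have := ind (size w) (size (pth z)).-1; rewrite nz nz' F_sym (Gam_F zz') szz /=.
  rewrite addSn /= ltnS leqnn -addn1 leq_add2l q0 => /(_ isT isT isT) /eqP.
  rewrite eqn_add2l => /eqP q1.
  by move: par; rewrite szz q1 addn1 ew size_rcons /=; case: (odd _).
apply/allP=> w wz; apply/implyP=> wz'; apply/negPn/negP => nwz; case/negP: nb.
have z'W := subsetP (bfs_sub st) _ z'T.
by rewrite inE z'W zz' /=; apply/existsP; exists w; rewrite wz nwz.
Qed.

(** Otherwise the edge extends both paths, so the levels of [z] and [z'] differ by at
    most one, hence are equal.  Then [pth z'] and [rcons (pth z) z'] have the
    same ends and consecutive lengths, which rigidity excludes. *)
Lemma parity_edge z z' : z \in T -> z' \in T -> Gam z z' ->
  odd (size (pth z)) = odd (size (pth z')) -> (z' \in bad z) || (z \in bad z').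
Proof.
move=> zT z'T zz' par; apply/negPn/negP; rewrite negb_or => /andP[nb nb'].
have cl := clean_or_bad zT z'T zz' par nb.
have z'z : Gam z' z by rewrite Gam_sym.
have cl' := clean_or_bad z'T zT z'z (esym par) nb'.
have le y y' : y \in T -> y' \in T -> clean (pth y) y y' ->
    odd (size (pth y)) = odd (size (pth y')) -> size (pth y') <= size (pth y).
  move=> yT y'T c; case: (bfs_sat st yT (subsetP (bfs_sub st) _ y'T) c) => [[_]|->].
    rewrite leq_eqVlt ltnS => /orP[/eqP->|//] /=; by case: (odd _).
  by move=> _; exact: (bfs_size st).
have esz : size (pth z) = size (pth z').
  by apply/eqP; rewrite eqn_leq (le z' z) // (le z z').
apply: rigid; exists x, z', (pth z'), (rcons (pth z) z').
rewrite size_rcons esz; split=> //; [exact: pth_ipath | exact: ipath_rcons (pth_ipath zT) cl |].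
by rewrite ltnS (leq_trans (bfs_size st z'T)).
Qed.

(** A bad neighbour of [z] is in [S] or has two neighbours there. *)
Lemma bad_count (S : {set V}) (Y : seq V) : uniq Y -> {subset Y <= T} ->
  (4 * #|S|).+1 <= s0 -> (forall z, z \in Y -> {subset pth z <= S}) ->
  \sum_(z <- Y) #|bad z| <= 12 * #|S|.
Proof.
move=> uY YT Ss YS; apply: leq_trans (contacts_few Ss).
have -> : \sum_(z <- Y) #|bad z| = #|[set p : V * V | (p.1 \in Y) && (p.2 \in bad p.1)]|.
  rewrite big_uniq //= -sum1_card.
  under eq_bigr => z _ do rewrite -sum1_card.
  by rewrite pair_big_dep /=; apply: eq_bigl => p; rewrite [RHS]inE.
apply/subset_leq_card/subsetP=> -[z z']; rewrite !inE /=.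
case/and3P => zY z'W /andP[zz' /existsP[w /and3P[wz nwz wz']]].
have zS : z \in S by apply: (YS z zY); rewrite pth_mem // YT.
have wS := YS z zY w wz; rewrite zS (Gam_F zz') /=.
case: (boolP (z' \in S)) => //= _; apply/card_gt1P; exists z, w.
by rewrite !inE zS wS (Gam_F zz') wz' eq_sym.
Qed.

Let code z := [seq val (enum_rank v) | v <- pth z].
Let srt := sort (fun z z' => lexle (code z) (code z')) (enum T).

Let code_inj : {in T &, injective code}.
Proof.
move=> z z' zT z'T /inj_map e; have {}e : pth z = pth z' by apply: e => v v' /val_inj /enum_rank_inj.
have [w ew] := pth_rcons zT; have [w' ew'] := pth_rcons z'T.
by move: e; rewrite ew ew' => /rcons_inj[].
Qed.

Let srt_mem z : (z \in srt) = (z \in T).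
Proof. by rewrite mem_sort mem_enum. Qed.

Let srt_pair : pairwise (fun z z' => lexle (code z) (code z')) srt.
Proof.
rewrite -sorted_pairwise; first by apply: sort_sorted => z z'; exact: lexle_total.
by move=> y z t; exact: lexle_trans.
Qed.

(** An ancestor of [z] that comes before the block also comes before [y0]; it is then
    a prefix of [pth y0], because the descendants of a vertex form an interval. *)
Lemma block_closed L1 y0 Y L3 : srt = L1 ++ (y0 :: Y) ++ L3 -> forall z, z \in y0 :: Y ->
  {subset pth z <= [set v in (y0 :: Y) ++ pth y0]}.
Proof.
move=> e z zY w wz.
have inT v : v \in y0 :: Y -> v \in T by move=> vY; rewrite -srt_mem e !mem_cat vY orbT.
have zT := inT z zY; have y0T : y0 \in T by rewrite inT ?mem_head.
have [wT [q eq]] := pth_prefix zT wz.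
have := srt_pair; rewrite e !pairwise_cat => /and3P[r1 _ /and3P[r3 p2 _]].
rewrite inE mem_cat.
have wcz : lexle (code w) (code z) by rewrite /code eq map_cat lexle_cat.
case/orP: (lexle_total (code y0) (code w)) => h.
  have : w \in srt by rewrite srt_mem.
  rewrite e mem_cat (mem_cat _ (y0 :: Y)) => /or3P[w1|->//|w3].
    have h' : lexle (code w) (code y0) by apply: (allrelP r1); rewrite // mem_cat mem_head.
    have /code_inj -> // : code w = code y0 by apply: lexle_anti; rewrite h'.
    by rewrite mem_head.
  have h' : lexle (code z) (code w) by apply: (allrelP r3).
  have /code_inj -> // : code w = code z by apply: lexle_anti; rewrite wcz.
  by rewrite zY.
have y0z : lexle (code y0) (code w ++ [seq val (enum_rank v) | v <- q]).
  rewrite -map_cat -eq; move: zY p2; rewrite inE /= => /orP[/eqP->|zY /andP[/allP/(_ _ zY)//]].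
  by move: (lexle_cat (code y0) [::]); rewrite cats0.
have [t et] := lexle_prefix h y0z.
have : val (enum_rank w) \in code y0.
  by rewrite et mem_cat; apply/orP; left; apply/mapP; exists w; rewrite ?pth_mem.
by move=> /mapP[v vy /val_inj /enum_rank_inj ->]; rewrite vy orbT.
Qed.

(** Sparsity is only available for sets of at most [s0] vertices, so [T] is cut into
    blocks of [L.+1] vertices that are consecutive in preorder.  A block becomes
    closed under taking ancestors by adding the path to its first vertex, which at
    most doubles its size. *)
Lemma bad_total : \sum_(z in T) #|bad z| <= 36 * #|T|.
Proof.
have usrt : uniq srt by rewrite sort_uniq enum_uniq.
have cT : size srt = #|T| by rewrite size_sort -cardE.
have -> : \sum_(z in T) #|bad z| = \sum_(z <- srt) #|bad z|.
  by rewrite big_uniq //=; apply: eq_bigl => z; rewrite srt_mem.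
case: (leqP #|T| L.+1) => TL.
  apply: (@leq_trans (12 * #|T|)); last by rewrite leq_mul2r orbT.
  apply: bad_count => // [z|| z]; rewrite ?srt_mem //.
    by move: TL s0L; clear; lia.
  by move=> zT w wz; have [] := pth_prefix zT wz.
have main k L1 L2 : size L2 <= k -> srt = L1 ++ L2 ->
    \sum_(z <- L2) #|bad z| <= 12 * (2 * size L2 + L.+1).
  elim: k L1 L2 => [|k IH] L1 L2; first by rewrite leqn0 => /eqP/size0nil->; rewrite big_nil.
  move=> szk e.
  have block y0 Y L3 : size (y0 :: Y) <= L.+1 -> L2 = (y0 :: Y) ++ L3 ->
      \sum_(z <- y0 :: Y) #|bad z| <= 12 * (size (y0 :: Y) + L.+1).
    move=> szY e2; have e3 : srt = L1 ++ (y0 :: Y) ++ L3 by rewrite -e2.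
    have y0T : y0 \in T by rewrite -srt_mem e3 !mem_cat mem_head orbT.
    have cS : #|[set v in (y0 :: Y) ++ pth y0]| <= size (y0 :: Y) + L.+1.
      rewrite cardsE (leq_trans (card_size _)) // size_cat leq_add2l.
      by rewrite (leq_trans (bfs_size st y0T)).
    apply: leq_trans (_ : 12 * #|[set v in (y0 :: Y) ++ pth y0]| <= _); last by rewrite leq_mul2l.
    apply: bad_count (block_closed e3).
    - by move: usrt; rewrite e3 !cat_uniq => /and3P[_ _ /and3P[]].
    - by move=> z zY; rewrite -srt_mem e3 !mem_cat zY orbT.
    - by move: cS szY s0L; clear; lia.
  case: L2 e szk block => [|y0 Y] e szk block; first by rewrite big_nil.
  case: (leqP (size (y0 :: Y)) L.+1) => szY.
    apply: leq_trans (block y0 Y [::] szY _) _; first by rewrite cats0.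
    by clear; lia.
  have e2 : y0 :: Y = (y0 :: take L Y) ++ drop L Y by rewrite /= cat_take_drop.
  have szt : size (y0 :: take L Y) = L.+1 by rewrite /= size_takel //; move: szY => /=; clear; lia.
  rewrite e2 big_cat /=; apply: leq_trans (leq_add (block y0 (take L Y) (drop L Y) _ e2) (IH (L1 ++ y0 :: take L Y) _ _ _)) _.
  - by rewrite szt.
  - by move: szk; rewrite /= size_drop; clear; lia.
  - by rewrite e -catA -e2.
  have szt' : size (take L Y) = L by case: szt.
  by rewrite /= size_cat szt'; clear; lia.
apply: leq_trans (main (size srt) [::] srt (leqnn _) erefl) _; rewrite cT.
by move: TL; clear; lia.
Qed.

End Tree.

(** In the larger parity class of the tree, an edge of [Gam] is bad for one of its ends,
    so the average degree is bounded and there is an independent set [A] of positive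
    proportion.  The neighbours of [A] within [W] are in the tree, in its frontier or
    bad, which makes them few. *)
Lemma ball : exists A Z : {set V}, [/\ A != set0, A \subset W, A \subset Z,
  #|Z| <= 2 ^ 17 * #|A| & {in A &, forall z z', ~~ Gam z z'} /\
  {in A & W, forall z z', Gam z z' -> z' \in Z}].
Proof.
have [n [T [pth [st nL fr]]]] := bfs_stop.
have tot := bad_total st nL; set bad' := bad pth in tot.
have [b bigb] : exists b, #|T| <= 2 * #|[set z in T | odd (size (pth z)) == b]|.
  have : #|T| <= #|[set z in T | odd (size (pth z)) == true]| +
                 #|[set z in T | odd (size (pth z)) == false]|.
    apply: leq_trans (leq_card_setU _ _); apply/subset_leq_card/subsetP=> z zT.
    by rewrite !inE zT; case: (odd _).
  move=> h; case: (leqP #|[set z in T | odd (size (pth z)) == false]|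
                       #|[set z in T | odd (size (pth z)) == true]|) => h'; [exists true|exists false].
    by apply: leq_trans h _; rewrite mul2n -addnn leq_add2l.
  by apply: leq_trans h _; rewrite mul2n -addnn leq_add2r ltnW.
set A0 := [set _ in _ | _] in bigb.
have A0T : A0 \subset T by apply/subsetP=> z; rewrite inE => /andP[].
pose nbr z := [set z' in A0 | Gam z z'].
have deg_sum : \sum_(z in A0) #|nbr z| <= 144 * #|A0|.
  pose back z := [set z' in A0 | z \in bad' z'].
  have h1 z : z \in A0 -> #|nbr z| <= #|bad' z| + #|back z|.
    move=> zA; apply: leq_trans (leq_card_setU _ _); apply/subset_leq_card/subsetP=> z'.
    rewrite inE => /andP[z'A zz'].
    have [zT p] : z \in T /\ odd (size (pth z)) = b.
      by move: zA; rewrite inE => /andP[-> /eqP].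
    have [z'T p'] : z' \in T /\ odd (size (pth z')) = b.
      by move: z'A; rewrite inE => /andP[-> /eqP].
    have := parity_edge st nL zT z'T zz' (etrans p (esym p')).
    rewrite -/bad' in_setU => /orP[->//|h]; apply/orP; right.
    by apply/setIdP.
  have h2 : \sum_(z in A0) #|back z| <= \sum_(z in T) #|bad' z|.
    have -> : \sum_(z in A0) #|back z| = \sum_(z in A0) \sum_(z' in A0) (z \in bad' z').
      apply: eq_bigr => z _; rewrite -sum1_card big_mkcond [RHS]big_mkcond /=.
      by apply: eq_bigr => z' _; rewrite inE; case: (z' \in A0); case: (z \in _).
    rewrite exchange_big /= [leqRHS](big_setID A0) /= (setIidPr A0T).
    apply: leq_trans (leq_addr _ _); apply: leq_sum => z' _.
    rewrite -sum1_card [leqRHS]big_mkcond [leqLHS]big_mkcond /=; apply: leq_sum => z _.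
    by case: (z \in A0); case: (z \in _).
  have h3 : \sum_(z in A0) #|bad' z| <= \sum_(z in T) #|bad' z|.
    by rewrite [leqRHS](big_setID A0) /= (setIidPr A0T) leq_addr.
  have h4 : \sum_(z in A0) #|nbr z| <= \sum_(z in A0) (#|bad' z| + #|back z|) by exact: leq_sum.
  by rewrite big_split /= in h4; move: h2 h3 h4 tot bigb; clear; lia.
(* at least half of [A0] has at most twice the average degree *)
pose B := [set z in A0 | #|nbr z| <= 288].
have cB : #|A0| <= 2 * #|B|.
  have h1 : 289 * #|A0 :\: B| <= \sum_(z in A0) #|nbr z|.
    rewrite (big_setID B) /=; apply: leq_trans (leq_addl _ _); rewrite mulnC -sum_nat_const.
    by apply: leq_sum => z; rewrite !inE => /andP[nz zA]; rewrite ltnNge; apply: contra nz => ->; rewrite zA.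
  have h2 := cardsID B A0; rewrite (setIidPr _) in h2; last by apply/subsetP=> z; rewrite inE => /andP[].
  by move: h1 h2 deg_sum; clear; lia.
pose indep (A : {set V}) := (A \subset B) && [forall z in A, forall z' in A, ~~ Gam z z'].
have ind0 : indep set0 by rewrite /indep sub0set; apply/forallP=> z; rewrite inE.
have [A /maxsetP[/andP[AB /forallP indA] maxA] _] := maxset_exists ind0.
have {}indA : {in A &, forall z z', ~~ Gam z z'}.
  by move=> z z' zA z'A; have := indA z; rewrite zA => /forallP/(_ z'); rewrite z'A.
have Gam_irr z : ~~ Gam z z by apply: contraT => /negPn/Gam_F; rewrite F_irr.
(* a maximal independent subset of [B] dominates [B] *)
have cA : #|B| <= 289 * #|A|.
  have sub : B \subset \bigcup_(z in A) (z |: nbr z).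
    apply/subsetP=> v vB; case: (boolP (v \in A)) => vA.
      by apply/bigcupP; exists v => //; rewrite !inE eqxx.
    have [z zA zv] : exists2 z, z \in A & Gam z v.
      apply: contrapT => none.
      have noz z : z \in A -> ~~ Gam z v.
        by move=> zA; apply/negP => zv; apply: none; exists z.
      have : v |: A = A.
        apply: maxA; last exact: subsetUr.
        rewrite /indep subUset sub1set vB AB /=; apply/forallP=> z; apply/implyP=> zA.
        apply/forallP=> z'; apply/implyP=> z'A; move: zA z'A; rewrite !inE.
        case/predU1P=> [->|zA] /predU1P[->|z'A] //; last exact: indA.
          by rewrite Gam_sym noz.
        exact: noz.
      by move=> e; move: vA; rewrite -e !inE eqxx.
    apply/bigcupP; exists z => //; rewrite !inE zv andbT.
    by move: vB; rewrite !inE => /andP[->]; rewrite orbT.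
  apply: leq_trans (subset_leq_card sub) _; rewrite mulnC; apply: card_bigcup_bound => z zA.
  rewrite (leq_trans (leq_card_setU _ _)) // cards1 add1n ltnS.
  by have := subsetP AB _ zA; rewrite inE => /andP[].
have AT : A \subset T.
  by apply: subset_trans AB _; apply: subset_trans A0T; apply/subsetP=> z; rewrite inE => /andP[].
exists A, (T :|: frontier T pth :|: \bigcup_(z in A) bad' z); split.
- rewrite -card_gt0; have : 0 < #|T| by apply/card_gt0P; exists x; have [] := bfs_root st.
  by move: bigb cB cA; clear; lia.
- exact: subset_trans AT (bfs_sub st).
- by rewrite -setUA; apply: subset_trans AT (subsetUl _ _).
- have h1 : #|\bigcup_(z in A) bad' z| <= 36 * #|T|.
    apply: leq_trans (card_bigcup_le _ _) _; apply: leq_trans tot.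
    by rewrite [leqRHS](big_setID A) /= (setIidPr AT) leq_addr.
  have h2 := leq_card_setU (T :|: frontier T pth) (\bigcup_(z in A) bad' z).
  have h3 := leq_card_setU T (frontier T pth).
  have {}h2 := leq_trans h2 (leq_add (leq_trans h3 (leq_add (leqnn _) fr)) h1).
  have h4 : #|T| <= 2 ^ 11 * #|A|.
    apply: (@leq_trans (1156 * #|A|)); first by move: bigb cB cA; clear; lia.
    by rewrite leq_mul2r [1156 <= _](_ : _ = true) ?orbT.
  apply: (@leq_trans (2 ^ 6 * #|T|)); first by move: h2; clear; lia.
  by rewrite (expnD 2 6 11) -mulnA leq_mul2l h4 orbT.
split=> // z z' zA z'W zz'; rewrite !inE.
have zT := subsetP AT _ zA.
case: (boolP (z' \in T)) => //= z'T; apply/orP.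
case: (boolP (z' \in bad' z)) => zb; [right|left].
  by apply/bigcupP; exists z.
rewrite z'W /=; apply/existsP; exists z; rewrite zT /=; apply/and3P; split=> //.
  by apply: contra z'T => /(pth_prefix st zT)[].
apply/allP=> w wz; apply/implyP=> wz'; apply: contraR zb => nwz.
by rewrite inE z'W zz'; apply/existsP; exists w; rewrite wz nwz.
Qed.

End Ball.
(** Take the set [A] of a ball, remove its surroundings [Z] from [W], and repeat. *)
Lemma large_independent (L : nat) (W : {set V}) : #|V| <= 2 ^ L -> 8 * L.+1 + 1 <= s0 ->
  ~ flexible L.+2 ->
  exists2 U : {set V}, U \subset W & #|W| <= 2 ^ 17 * #|U| /\ {in U &, forall z z', ~~ Gam z z'}.
Proof.
move=> VL s0L rigid.
elim/ltn_ind: {W}#|W| {-2}W (erefl #|W|) => n IH W cW.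
case: (posnP #|W|) => [W0|/card_gt0P[x xW]].
  exists set0; rewrite ?sub0set // W0; split=> // z z'; by rewrite inE.
have [A [Z [An0 AW AZ cZ [indA nbrA]]]] := ball xW VL s0L rigid.
have lt : #|W :\: Z| < n.
  rewrite -cW; case/set0Pn: An0 => z zA; apply: (card_setD_contact (v := z)).
    exact: (subsetP AW). exact: (subsetP AZ).
have [U UW [cU indU]] := IH _ lt (W :\: Z) erefl.
have UZ z : z \in U -> z \in W /\ z \notin Z by move/(subsetP UW); rewrite inE => /andP[].
exists (A :|: U); first by rewrite subUset AW (subset_trans UW) ?subsetDl.
have dis : A :&: U = set0.
  by apply/setP=> z; rewrite !inE; apply/negP=> /andP[/(subsetP AZ) zZ /UZ[_]]; rewrite zZ.
split.
  move: (2 ^ 17) cZ cU => K cZ cU.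
  rewrite cardsU dis cards0 subn0 mulnDr -(cardsID Z W) leq_add //.
  by apply: leq_trans cZ; rewrite subset_leq_card ?subsetIr.
have cross z z' : z \in A -> z' \in U -> ~~ Gam z z'.
  by move=> zA /UZ[z'W z'Z]; apply: contra z'Z; exact: nbrA.
move=> z z'; rewrite !inE => /orP[zA|zU] /orP[z'A|z'U].
- exact: indA.
- exact: cross.
- by rewrite Gam_sym cross.
- exact: indU.
Qed.

End ColourClass.

(** If no colour class is flexible, then [V] contains a set independent for the first
    colour, this one a set independent for the second colour, and so on.  Each step
    costs a factor [2 ^ 17], and the last set is independent in [F]. *)
Lemma flexible_pair (k L : nat) (chi : V -> V -> 'I_k) :
  (forall x y, chi x y = chi y x) -> #|V| <= 2 ^ L -> 8 * L.+1 + 1 <= s0 ->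
  (forall U : {set V}, {in U &, forall z z', ~~ F z z'} -> 2 ^ (17 * k) * #|U| < #|V|) ->
  exists c : 'I_k, flexible (fun x y => F x y && (chi x y == c)) L.+2.
Proof.
move=> chi_sym VL s0L dense; apply: contrapT => none.
have main cs : exists U : {set V}, #|V| <= 2 ^ (17 * size cs) * #|U| /\
    forall c, c \in cs -> {in U &, forall z z', ~~ (F z z' && (chi z z' == c))}.
  elim: cs => [|c cs [W [cW indW]]].
    by exists setT; rewrite muln0 cardsT mul1n.
  have [|||U UW [cU indU]] := @large_independent (fun x y => F x y && (chi x y == c)) _ _ L W VL s0L.
  - by move=> x y; rewrite F_sym chi_sym.
  - by move=> x y /andP[].
  - by move=> fl; apply: none; exists c.
  exists U; split.
    rewrite /= mulnS expnD -mulnA mulnCA; apply: leq_trans cW _.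
    by rewrite leq_mul2l cU orbT.
  move=> c'; rewrite inE => /orP[/eqP->//|c'cs] z z' zU z'U.
  by apply: indW => //; apply: (subsetP UW).
have [U [cU indU]] := main (enum 'I_k).
have := dense U; rewrite size_enum_ord in cU; rewrite ltnNge cU => h.
suff : false by []; apply: h => z z' zU z'U; apply/negP => Fz.
by have := indU (chi z z') (mem_enum _ _) z z' zU z'U; rewrite Fz eqxx.
Qed.

End Sparse.

(** * The gadget: a random graph *)
Section RandomGraph.
Variables (D N : nat).
Local Notation X := ('I_D * 'I_N)%type.
Implicit Types f : {ffun X -> 'I_N}.

(** Every vertex sends edges to [D] random vertices. *)
Definition graph_of f : rel 'I_N :=
  fun i j => (i != j) && [exists t, (f (t, i) == j) || (f (t, j) == i)].

Lemma graph_of_sym f : symmetric (graph_of f).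
Proof.
move=> i j; rewrite /graph_of eq_sym; congr (_ && _).
by apply: eq_existsb => t; rewrite orbC.
Qed.

Lemma graph_of_irr f : irreflexive (graph_of f).
Proof. by move=> i; rewrite /graph_of eqxx. Qed.

Lemma few_constrained (R : {set X}) (G : X -> {set 'I_N}) g :
  (forall x, x \in R -> #|G x| <= g) ->
  #|[set f : {ffun X -> 'I_N} | [forall (x | x \in R), f x \in G x]]| * N ^ #|R|
    <= g ^ #|R| * N ^ (D * N).
Proof.
move=> Gg; pose G' x := if x \in R then G x else setT.
have -> : #|[set f : {ffun X -> 'I_N} | [forall (x | x \in R), f x \in G x]]| = #|family G'|.
  apply: eq_card => f; rewrite inE; apply/forallP/familyP => h x; have := h x; rewrite /G'.
    by case: (x \in R); rewrite ?inE.
  by case: (x \in R).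
rewrite card_family foldrE big_image /=.
rewrite (bigID (mem R)) /=.
have h1 : \prod_(x | x \in R) #|G' x| <= g ^ #|R|.
  rewrite -prod_nat_const; apply: leq_prod => x xR; rewrite /G' xR; exact: Gg.
have h2 : \prod_(x | x \notin R) #|G' x| = N ^ #|~: R|.
  rewrite -prod_nat_const; apply: eq_big => [x|x xR]; first by rewrite inE.
  by rewrite /G' (negPf xR) cardsT card_ord.
rewrite h2 -mulnA -expnD [_ + #|R|]addnC cardsC card_prod !card_ord.
by rewrite leq_mul2r h1 orbT.
Qed.

Definition inner f (S : {set 'I_N}) := [set x : X | (x.2 \in S) && (f x \in S)].

Lemma pairs_inner f (S : {set 'I_N}) :
  #|[set p : 'I_N * 'I_N | [&& p.1 \in S, p.2 \in S & graph_of f p.1 p.2]]| <= 2 * #|inner f S|.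
Proof.
pose h1 (x : X) := (x.2, f x); pose h2 (x : X) := (f x, x.2).
apply: (@leq_trans #|h1 @: inner f S :|: h2 @: inner f S|).
  apply/subset_leq_card/subsetP=> -[i j]; rewrite inE /= => /and3P[iS jS /andP[_ /existsP[t]]].
  rewrite inE; case/orP => /eqP e; apply/orP; [left|right]; apply/imsetP.
    by exists (t, i); rewrite /h1 /= ?e // inE /= iS e.
  by exists (t, j); rewrite /h2 /= ?e // inE /= jS e.
apply: leq_trans (leq_card_setU _ _) _; rewrite mul2n -addnn.
by rewrite leq_add // leq_imset_card.
Qed.

Local Notation Omega := (N ^ (D * N)).

(** The union bound over the sets [S] of size [t] and the positions of [t + w] values
    inside [S], where [w] exceeds [t / 2]: the choice of [S] costs [N ^ t], the
    values gain [N ^ - (t + w)], and everything else is at most [(16 * Q ^ 3) ^ w]. *)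
Lemma few_dense_graphs s0 t : 0 < t -> t <= s0 -> 16 * (D * s0 ^ 2) ^ 3 <= N -> 0 < D ->
  #|[set f : {ffun X -> 'I_N} | [exists (S : {set 'I_N} | #|S| == t), 3 * t < 2 * #|inner f S|]]|
    * 4 ^ t <= Omega.
Proof.
move=> t0 ts NQ D0; set Q := D * s0 ^ 2 in NQ.
have Q0 : 0 < Q by rewrite muln_gt0 D0 expn_gt0 (leq_trans t0 ts).
have N0 : 0 < N by apply: leq_trans NQ; rewrite muln_gt0 /= expn_gt0 Q0.
have tQ : D * t * t <= Q by rewrite /Q -mulnA leq_mul2l -[s0 ^ 2]mulnn leq_mul ?orbT.
pose w := (t %/ 2).+1; pose r := t + w.
have [wt rw] : t <= 2 * w /\ r <= 3 * w by rewrite /r /w; clear; lia.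
pose T := [set S : {set 'I_N} | #|S| == t].
have cT : #|T| = 'C(N, t) by have := card_draws 'I_N t; rewrite card_ord.
pose Reps (S : {set 'I_N}) := [set Rep : {set X} | Rep \subset setX setT S & #|Rep| == r].
pose A (S : {set 'I_N}) (Rep : {set X}) :=
  [set f : {ffun X -> 'I_N} | [forall (x | x \in Rep), f x \in S]].
set bad := [set f | _].
have sub : bad \subset \bigcup_(S in T) \bigcup_(Rep in Reps S) A S Rep.
  apply/subsetP=> f; rewrite inE => /existsP[S /andP[St big]].
  have : r <= #|inner f S| by move: big; rewrite /r /w; clear; lia.
  case/subset_card_exists=> Rep RepS cRep.
  have RS x : x \in Rep -> (x.2 \in S) && (f x \in S) by move/(subsetP RepS); rewrite inE.
  apply/bigcupP; exists S; rewrite ?inE //; apply/bigcupP; exists Rep.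
    by rewrite inE cRep eqxx andbT; apply/subsetP=> x /RS/andP[xS _]; rewrite inE xS inE.
  by rewrite inE; apply/forallP=> x; apply/implyP=> /RS/andP[].
have h : #|bad| * N ^ r <= N ^ t * Q ^ r * Omega.
  apply: leq_trans (leq_mul (subset_leq_card sub) (leqnn _)) _.
  apply: leq_trans (leq_mul (card_bigcup_le _ _) (leqnn _)) _; rewrite big_distrl /=.
  apply: (@leq_trans (\sum_(S in T) (Q ^ r * Omega))); last first.
    by rewrite sum_nat_const cT mulnA leq_mul // leq_mul // bin_le_exp.
  apply: leq_sum => S; rewrite inE => /eqP St.
  apply: leq_trans (leq_mul (card_bigcup_le _ _) (leqnn _)) _; rewrite big_distrl /=.
  apply: (@leq_trans (\sum_(Rep in Reps S) (t ^ r * Omega))).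
    apply: leq_sum => Rep; rewrite inE => /andP[_ /eqP cRep]; rewrite -cRep.
    by apply: few_constrained => x _; rewrite St.
  rewrite sum_nat_const mulnA leq_mul //.
  have -> : #|Reps S| = 'C(D * t, r) by rewrite /Reps cards_draws cardsX cardsT card_ord St.
  apply: leq_trans (leq_mul (bin_le_exp _ _) (leqnn _)) _.
  by rewrite -expnMn leq_exp2r // /r addn_gt0 t0.
have Nw : Q ^ r * 4 ^ t <= N ^ w.
  apply: (@leq_trans ((16 * Q ^ 3) ^ w)); last by rewrite leq_exp2r.
  rewrite expnMn mulnC -(expnM Q) -[16]/(4 ^ 2) -expnM.
  by rewrite leq_mul // leq_pexp2l.
have p0 : 0 < N ^ t * Q ^ r by rewrite muln_gt0 !expn_gt0 N0 Q0.
rewrite -(leq_pmul2l p0); apply: leq_trans h.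
have -> : N ^ r = N ^ t * N ^ w by rewrite -expnD.
have := leq_mul (leqnn (#|bad| * N ^ t)) Nw.
move: (N ^ t) (Q ^ r) (4 ^ t) (N ^ w) #|bad| => a b c e g {}h; move: h; clear => h.
by apply: leq_trans (leq_trans h _); apply/eq_leq; lia.
Qed.

(** [(1 - 1 / y) ^ y <= 1 / 2], from the inequality of Bernoulli. *)
Lemma exp_half y : 0 < y -> 2 * y.-1 ^ y <= y ^ y.
Proof.
have bern a n : a ^ n + n * a ^ n.-1 <= a.+1 ^ n.
  elim: n => // -[|n] IH; first by rewrite expn0 expn1 mul1n addn1.
  rewrite [leqRHS]expnS; apply: leq_trans (leq_mul (leqnn _) IH).
  by rewrite /= !expnS; move: (a ^ n) => p; clear; nia.
case: y => // y _; have := bern y y.+1; rewrite /= mulSn addnA -expnS => h.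
apply: leq_trans h; rewrite !expnS; move: (y ^ y) => p; clear; nia.
Qed.

(** All of the [D * al = y * w] values at a set [A] of [al = 2 * N / y] vertices avoid
    [A], up to loops.  By [exp_half] this has probability at most [2 ^ - w], which
    beats the number of sets as [w] is [2 * N]. *)
Lemma few_sparse_graphs q al : 0 < q -> 1 < al -> N = q * al -> D = 4 * q ^ 2 ->
  4 * #|[set f : {ffun X -> 'I_N} | [exists (A : {set 'I_N} | #|A| == al),
     [forall (i | i \in A), forall (j | j \in A), ~~ graph_of f i j]]]| <= Omega.
Proof.
move=> q0 al1 Nq Dq; set bad := [set f | _].
pose T := [set A : {set 'I_N} | #|A| == al].
pose F (A : {set 'I_N}) := [set f : {ffun X -> 'I_N} |
  [forall (x | x \in setX setT A), f x \in x.2 |: ~: A]].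
have sub : bad \subset \bigcup_(A in T) F A.
  apply/subsetP=> f; rewrite inE => /existsP[A /andP[Aal /forallP ind]].
  apply/bigcupP; exists A; rewrite inE //; apply/forallP=> -[t i]; apply/implyP.
  rewrite inE /= => /andP[_ iA]; rewrite !inE; case: (boolP (f (t, i) \in A)) => fA.
    have := ind i; rewrite iA => /forallP/(_ (f (t, i))); rewrite fA /= /graph_of negb_and negbK.
    rewrite eq_sym orbF => /orP[->//|/existsPn/(_ t)]; by rewrite eqxx.
  by rewrite orbT.
pose y := 2 * q; pose w := 2 * q * al.
have y0 : 0 < y by rewrite muln_gt0.
have w0 : 0 < w by rewrite /w !muln_gt0 q0 (ltnW al1).
have yw0 : 0 < y * w by rewrite muln_gt0 y0.
have N0 : 0 < N by rewrite Nq muln_gt0 q0 ltnW.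
have cF A : A \in T -> #|F A| * 2 ^ w <= Omega.
  rewrite inE => /eqP Aal.
  have cR : #|setX [set: 'I_D] A| = y * w.
    by rewrite cardsX cardsT card_ord Aal Dq /y /w; clear; nia.
  have cG x : x \in setX [set: 'I_D] A -> #|x.2 |: ~: A| <= N - al + 1.
    move=> _; rewrite (leq_trans (leq_card_setU _ _)) // cards1 addnC leq_add2r.
    by have := cardsC A; rewrite card_ord Aal; clear; lia.
  have := few_constrained cG; rewrite cR => h.
  have step : (N - al + 1) * y <= N * y.-1.
    rewrite /y Nq; move: q0 al1; clear; case: q => // q' _ al1.
    have -> : (2 * q'.+1).-1 = (2 * q').+1 by lia.
    have -> : q'.+1 * al - al + 1 = q' * al + 1 by lia.
    by move: al1; clear; nia.
  have h2 : (N - al + 1) ^ (y * w) * y ^ (y * w) <= N ^ (y * w) * y.-1 ^ (y * w).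
    by rewrite -!expnMn leq_exp2r.
  have h3 : 2 ^ w * y.-1 ^ (y * w) <= y ^ (y * w).
    by rewrite (expnM y.-1) (expnM y y) -expnMn leq_exp2r ?exp_half //.
  have p1 : 0 < N ^ (y * w) by rewrite expn_gt0 N0.
  have p2 : 0 < y ^ (y * w) by rewrite expn_gt0 y0.
  have p3 : 0 < y.-1 ^ (y * w) by rewrite expn_gt0 /y; move: q0; clear; lia.
  rewrite -(leq_pmul2r p1) -(leq_pmul2r p3).
  move: h h2 h3; move: (N ^ (y * w)) (y ^ (y * w)) (y.-1 ^ (y * w)) p1 p2 p3 => a b c p1 p2 p3.
  move: ((N - al + 1) ^ (y * w)) #|F A| (2 ^ w) (Omega) => e f g W h h2 h3.
  have k1 : f * g * a * c <= f * a * b by move: (leq_mul (leqnn (f * a)) h3); clear; lia.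
  have k2 : f * a * b <= e * W * b by move: (leq_mul h (leqnn b)); clear; lia.
  have k3 : e * W * b <= W * a * c by move: (leq_mul h2 (leqnn W)); clear; lia.
  exact: leq_trans k1 (leq_trans k2 k3).
have cbad : #|bad| * 2 ^ w <= 2 ^ N * Omega.
  apply: leq_trans (leq_mul (subset_leq_card sub) (leqnn _)) _.
  apply: leq_trans (leq_mul (card_bigcup_le _ _) (leqnn _)) _; rewrite big_distrl /=.
  apply: (@leq_trans (\sum_(A in T) Omega)); first exact: leq_sum.
  rewrite sum_nat_const leq_mul2r; apply/orP; right.
  by have := card_draws 'I_N al; rewrite card_ord => ->; exact: bin_le_exp2.
have pN : 0 < 2 ^ N by rewrite expn_gt0.
rewrite -(leq_pmul2l pN); apply: leq_trans cbad.
rewrite mulnA mulnC leq_mul2l mulnC -[4]/(2 ^ 2) -expnD leq_pexp2l ?orbT //.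
by rewrite /w Nq; move: q0 al1; clear; nia.
Qed.

Lemma random_graph q al s0 : 0 < q -> 1 < al -> N = q * al -> D = 4 * q ^ 2 ->
  16 * (D * s0 ^ 2) ^ 3 <= N ->
  exists f : {ffun X -> 'I_N},
   (forall S : {set 'I_N}, #|S| <= s0 ->
     #|[set p : 'I_N * 'I_N | [&& p.1 \in S, p.2 \in S & graph_of f p.1 p.2]]| <= 3 * #|S|) /\
   (forall A : {set 'I_N}, {in A &, forall i j, ~~ graph_of f i j} -> #|A| < al).
Proof.
move=> q0 al1 Nq Dq NQ.
have N0 : 0 < N by rewrite Nq muln_gt0 q0 ltnW.
have D0 : 0 < D by rewrite Dq muln_gt0 expn_gt0 q0.
pose bad t := [set f : {ffun X -> 'I_N} |
  [exists (S : {set 'I_N} | #|S| == t), 3 * t < 2 * #|inner f S|]].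
pose Bad := \bigcup_(t in [set: 'I_s0]) bad t.+1.
pose Bad2 := [set f : {ffun X -> 'I_N} | [exists (A : {set 'I_N} | #|A| == al),
     [forall (i | i \in A), forall (j | j \in A), ~~ graph_of f i j]]].
have W0 : 0 < Omega by rewrite expn_gt0 N0.
have BadW : 3 * #|Bad| <= Omega.
  have h1 : #|Bad| <= \sum_(t < s0) #|bad t.+1|.
    apply: leq_trans (card_bigcup_le _ _) _; apply/eq_leq.
    by apply: eq_bigl => t; rewrite inE.
  have := @geometric_sum (fun t => #|bad t.+1|) s0 Omega.
  move=> /(_ (fun t ts => few_dense_graphs (ltn0Sn t) ts NQ D0)) h2.
  have p0 : 0 < 4 ^ s0 by rewrite expn_gt0.
  rewrite -(leq_pmul2r p0) (leq_trans _ (leq_trans (leq_addr _ _) h2)) //.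
  by rewrite mulnAC leq_mul2l h1 orbT.
have Bad2W : 4 * #|Bad2| <= Omega := few_sparse_graphs q0 al1 Nq Dq.
have [f] : exists f, f \notin Bad :|: Bad2.
  apply/existsP; rewrite -negb_forall; apply/negP=> /forallP all_bad.
  have : Omega <= #|Bad :|: Bad2|.
    rewrite -(_ : #|[set: {ffun X -> 'I_N}]| = Omega).
      by apply/subset_leq_card/subsetP=> f _; exact: all_bad.
    by rewrite cardsT card_ffun card_prod !card_ord.
  move/leq_trans/(_ (leq_card_setU Bad Bad2)).
  move: W0 BadW Bad2W; move: Omega #|Bad| #|Bad2| => a b c; clear; lia.
rewrite inE negb_or => /andP[f1 f2]; exists f; split=> [S Ss|A indA].
  apply: leq_trans (pairs_inner f S) _; rewrite leqNgt; apply: contra f1 => big.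
  case: (posnP #|S|) => S0.
    move: big; rewrite S0 (_ : inner f S = set0) ?cards0 //.
    by apply/setP=> x; rewrite (cards0_eq S0) !inE.
  have lt : #|S|.-1 < s0 by rewrite prednK.
  apply/bigcupP; exists (Ordinal lt); rewrite ?inE //= prednK //.
  by apply/existsP; exists S; rewrite eqxx.
rewrite ltnNge; apply: contra f2 => /subset_card_exists[A' A'A cA'].
rewrite inE; apply/existsP; exists A'; rewrite cA' eqxx /=.
apply/forallP=> i; apply/implyP=> iA; apply/forallP=> j; apply/implyP=> jA.
by apply: indA; exact: (subsetP A'A).
Qed.

End RandomGraph.

(** * The lower bound *)
Section CycleEdges.
Variables (n : nat) (n3 : 2 < n) (G : sgraph) (phi : cycle_graph n -> G).
Hypothesis phi_emb : induced_embedding phi.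

Lemma ordS_neq (i : 'I_n) : i != ordS i.
Proof.
apply/eqP=> /(congr1 val) /=; case: i => i /= lt_in.
by case: (ltngtP i.+1 n) => [h|h|h]; [rewrite modn_small // | | rewrite h modnn]; lia.
Qed.

Lemma cycle_adj_next (i : 'I_n) : cycle_adj i (ordS i).
Proof. by rewrite /cycle_adj ordS_neq eqxx. Qed.

Lemma cycle_edge (i : cycle_graph n) : [set phi i; phi (ordS i)] \in edges G.
Proof.
apply/imsetP; exists (phi i, phi (ordS i)) => //.
by rewrite inE /= phi_emb.2; exact: cycle_adj_next.
Qed.

Lemma card_cycle_edges :
  #|[set [set phi i; phi (ordS i)] | i : cycle_graph n]| = n.
Proof.
rewrite card_imset ?card_ord // => i j eq_ij.
have [phi_inj _] := phi_emb.
have : phi i \in [set phi j; phi (ordS j)] by rewrite -eq_ij set21.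
have : phi (ordS i) \in [set phi j; phi (ordS j)] by rewrite -eq_ij set22.
rewrite !inE !(inj_eq phi_inj) => h /orP[/eqP//|/eqP eq1].
case/orP: h => /eqP; last by move/ordS_inj.
rewrite {}eq1 => /(congr1 val) /=; case: j {eq_ij} => j /= lt_jn; rewrite -addn1 modnDml => e.
exfalso; move: e; rewrite addn1.
case: (ltngtP j.+2 n) => h; first by rewrite modn_small //; lia.
  have -> : j.+2 = 1 + n by lia.
  by rewrite modnDr modn_small; lia.
by rewrite h modnn; lia.
Qed.

End CycleEdges.

(** With two colours, splitting the edges evenly leaves fewer than [n] of them
    in each class. *)
Lemma ind_arrows_card_edges (G : sgraph) n k : 2 < n -> 1 < k ->
  ind_arrows G (cycle_graph n) k -> 2 * n <= #|edges G|.+1.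
Proof.
move=> n3 k2 arrows; rewrite leqNgt; apply/negP=> few.
have [A AE [cA cAC]] : exists2 A : {set {set G}}, A \subset edges G &
    #|A| < n /\ #|edges G :\: A| < n.
  case: (leqP n.-1 #|edges G|) => h; last first.
    by exists (edges G); rewrite // setDv cards0; lia.
  have [A AE cA] := subset_card_exists h.
  by exists A => //; rewrite cardsD (setIidPr AE) cA; lia.
pose chi (e : {set G}) : 'I_k :=
  if e \in A then Ordinal (ltnW k2) else Ordinal k2.
have [phi [emb [c mono]]] := arrows chi.
pose W := [set [set phi i; phi (ordS i)] | i : cycle_graph n].
have cW : #|W| = n by exact: card_cycle_edges.
have WE : W \subset edges G by apply/subsetP=> e /imsetP[i _ ->]; exact: cycle_edge.
have Wc e : e \in W -> chi e = c.
  by case/imsetP=> i _ ->; apply: mono; exact: cycle_adj_next.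
have WA (B : {set {set G}}) : #|B| < n -> exists2 e, e \in W & e \notin B.
  by move=> cB; apply/subsetPn; apply: contraL cB => /subset_leq_card; rewrite cW -leqNgt.
have [e eW eA] := WA A cA.
have [e' e'W e'A] := WA _ cAC.
have e'A' : e' \in A by move: e'A; rewrite inE (subsetP WE _ e'W) andbT negbK.
by have := Wc e eW; rewrite -(Wc e' e'W) /chi (negPf eA) e'A' => /(congr1 val).
Qed.

Lemma sum_degrees (G : sgraph) : \sum_(v : G) #|[set w | adj v w]| <= 2 * #|edges G|.
Proof.
pose P := [set p : G * G | adj p.1 p.2].
have -> : \sum_(v : G) #|[set w | adj v w]| = #|P|.
  transitivity (\sum_(v : G) \sum_(w : G | adj v w) 1).
    by apply: eq_bigr => v _; rewrite sum1dep_card.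
  by rewrite pair_big_dep /= sum1dep_card.
pose F (e : {set G}) := [set p in P | [set p.1; p.2] == e].
have sub : P \subset \bigcup_(e in edges G) F e.
  apply/subsetP=> p pP; apply/bigcupP; exists [set p.1; p.2]; last by rewrite inE pP eqxx.
  by apply/imsetP; exists p => //; rewrite inE in pP *.
apply: leq_trans (subset_leq_card sub) _; apply: leq_trans (card_bigcup_le _ _) _.
rewrite mulnC -sum_nat_const; apply: leq_sum => _ /imsetP[[a b] /= ab ->].
apply: leq_trans (_ : #|[set (a, b); (b, a)]| <= _); last by rewrite cards2; case: (_ == _).
apply/subset_leq_card/subsetP=> -[x y]; rewrite 3!inE /= => /andP[xy /eqP e].
have : x \in [set a; b] by rewrite -e set21.
have : y \in [set a; b] by rewrite -e set22.
have nxy : x != y by apply: contraTneq xy => ->; rewrite adj_irr.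
rewrite !inE => /orP[]/eqP ey /orP[]/eqP ex; move: nxy; rewrite ex ey ?eqxx // ?orbT //.
Qed.

Lemma greedy_colouring (G : sgraph) (T : finType) (W : {set G}) :
  (forall v, v \in W -> #|[set w | adj v w]| < #|T|) -> 0 < #|T| ->
  exists col : G -> T, {in W &, forall v w, adj v w -> col v != col w}.
Proof.
move=> degW /card_gt0P[t0 _]; elim: {W}#|W| {-2}W (leqnn #|W|) degW => [|s IH] W.
  by rewrite leqn0 cards_eq0 => /eqP-> _; exists (fun=> t0) => v w; rewrite inE.
case: (set_0Vmem W) => [-> _ _|[v vW] cW degW].
  by exists (fun=> t0) => v w; rewrite inE.
have [||col colP] := IH (W :\ v); first by have := cardsD1 v W; rewrite vW; lia.
  by move=> w /setD1P[_ /degW].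
have [t tP] : exists t, t \notin [set col w | w in [set w | adj v w]].
  apply/existsP; rewrite -negb_forall; apply/negP=> /forallP all_t.
  have := leq_trans (degW v vW) (leqnn _); rewrite ltnNge => /negP; apply.
  apply: leq_trans (leq_imset_card col _).
  by rewrite -cardsT; apply/subset_leq_card/subsetP=> x _; exact: all_t.
have tN w : adj v w -> col w != t.
  by move=> vw; apply: contraNneq tP => <-; apply: imset_f; rewrite inE.
exists (fun w => if w == v then t else col w) => x y xW yW xy.
case: (eqVneq x v) xy => [->|xv] xy; case: (eqVneq y v) xy => [->|yv] xy.
- by rewrite adj_irr in xy.
- by rewrite eq_sym tN.
- by rewrite tN // adj_sym.
by apply: colP; rewrite // !inE ?xv ?yv.
Qed.

Lemma odd_cycle_alternation n (b : 'I_n -> bool) :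
  odd n -> 2 < n -> ~ (forall i, b (ordS i) = ~~ b i).
Proof.
case: n b => [|n] b // n_odd n3 alt.
have bE m (lt_mn : m < n.+1) : b (Ordinal lt_mn) = b ord0 (+) odd m.
  elim: m lt_mn => [|m IH] lt_mn; first by rewrite addbF; congr b; exact: val_inj.
  have -> : Ordinal lt_mn = ordS (Ordinal (ltnW lt_mn)).
    by apply: val_inj; rewrite /= modn_small.
  by rewrite alt IH /= addbN.
have := alt ord_max; have -> : ordS ord_max = ord0 :> 'I_n.+1.
  by apply: val_inj; rewrite /= modnn.
have -> : ord_max = Ordinal (ltnSn n) by exact: val_inj.
by rewrite bE; move: n_odd; rewrite /= => /negPf->; rewrite addbF; case: (b _).
Qed.

(** Edges at vertices of degree at least [2 ^ m] get the last colour, so a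
    monochromatic cycle of that colour has a vertex cover among those few
    vertices.  The rest of the graph is properly coloured by the subsets of
    ['I_m], and an edge gets a point on which the subsets at its ends differ:
    each of these colours is a bipartite graph, which has no odd cycle. *)
Lemma ind_arrows_odd_cycle (G : sgraph) n m : odd n -> 2 < n ->
  ind_arrows G (cycle_graph n) m.+1 -> 2 ^ m * n <= 4 * #|edges G|.
Proof.
move=> n_odd n3 arrows; pose U := [set v : G | 2 ^ m <= #|[set w | adj v w]|].
have [||col colP] := @greedy_colouring G {set 'I_m} (~: U).
- by move=> v; rewrite -cardsT -powersetT card_powerset cardsT card_ord !inE -ltnNge.
- by apply/card_gt0P; exists set0.
pose chi (e : {set G}) : 'I_m.+1 :=
  if [disjoint e & U] then
    if [pick i : 'I_m | [exists x in e, exists y in e, (i \in col x) && (i \notin col y)]]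
    is Some i then widen_ord (leqnSn m) i else ord_max
  else ord_max.
have [phi [emb [c mono]]] := arrows chi.
have chiE i : chi [set phi i; phi (ordS i)] = c by apply: mono; exact: cycle_adj_next.
case: (eqVneq c ord_max) => [c_max|c_max]; last first.
  have [i0 i0E] : exists i0 : 'I_m, c = widen_ord (leqnSn m) i0.
    have := chiE (Ordinal (ltnW (ltnW n3))); rewrite /chi.
    by case: ifP => _ => [|h]; [case: pickP => [i _ <-|_ h]; first by exists i|];
       move: c_max; rewrite -h eqxx.
  exfalso; apply: (@odd_cycle_alternation n (fun i => i0 \in col (phi i))) => // i.
  have := chiE i; rewrite /chi i0E; case: ifP => _; last first.
    by move/(congr1 val)=> /= e; have := ltn_ord i0; rewrite -e ltnn.
  case: pickP => [i1 + /(congr1 val)/= e|_ /(congr1 val)/= e]; last first.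
    by have := ltn_ord i0; rewrite -e ltnn.
  rewrite (_ : i1 = i0); last exact: val_inj.
  move=> /exists_inP[x xe /exists_inP[y ye]].
  move: xe ye; rewrite !inE => /orP[]/eqP-> /orP[]/eqP-> /andP[].
  - by move=> ->.
  - by move=> -> /negPf->.
  - by move=> -> /negPf->.
  - by move=> ->.
have meet i : (phi i \in U) || (phi (ordS i) \in U).
  apply: contraT; rewrite negb_or => /andP[iU iSU].
  have := chiE i; rewrite c_max /chi disjoints_subset; case: ifP => [_|/negP[]]; last first.
    by apply/subsetP=> x /set2P[]->; rewrite in_setC.
  case: pickP => [i1 _ /(congr1 val)/= e|none _]; first by have := ltn_ord i1; rewrite e ltnn.
  have : col (phi i) != col (phi (ordS i)).
    apply: colP; rewrite ?in_setC //; rewrite emb.2; exact: cycle_adj_next.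
  have same x y : x \in [set phi i; phi (ordS i)] -> y \in [set phi i; phi (ordS i)] ->
      col x \subset col y.
    move=> xe ye; apply/subsetP=> t tx; apply: contraFT (none t) => ty.
    by apply/exists_inP; exists x => //; apply/exists_inP; exists y; rewrite // tx.
  by rewrite eqEsubset !same ?set21 ?set22.
have cover : n <= 2 * #|U|.
  pose I := [set i : cycle_graph n | phi i \in U].
  have : [set: cycle_graph n] \subset I :|: (fun i : 'I_n => ordS i) @^-1: I.
    by apply/subsetP=> i _; rewrite !inE; have := meet i; rewrite !inE.
  move/subset_leq_card; rewrite cardsT card_ord => /leq_trans-> //.
  have cI : #|I| <= #|U|.
    rewrite -(card_imset _ emb.1); apply/subset_leq_card/subsetP=> x /imsetP[i].
    by rewrite inE => ? ->.
  apply: leq_trans (leq_card_setU _ _) _; rewrite mul2n -addnn leq_add //.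
  rewrite (leq_trans _ cI) // -(card_imset _ (@ordS_inj n)).
  by apply/subset_leq_card/subsetP=> x /imsetP[i]; rewrite inE => ? ->.
have UE : 2 ^ m * #|U| <= 2 * #|edges G|.
  apply: leq_trans (sum_degrees G); rewrite mulnC -sum_nat_const.
  apply: (@leq_trans (\sum_(v in U) #|[set w | adj v w]|)).
    by apply: leq_sum => v; rewrite inE.
  by rewrite [leqRHS](bigID (mem U)) leq_addr.
move: cover UE; move: (2 ^ m) #|U| => a u; clear; nia.
Qed.

(** For [k] up to [3] the bound by the number of edges is the better one. *)
Lemma ind_arrows_exp_lower (G : sgraph) n k : odd n -> 2 < n -> 1 < k ->
  ind_arrows G (cycle_graph n) k -> 10 ^ k * n <= 9 ^ k * #|edges G|.
Proof.
move=> n_odd n3; case: k => [|[|[|[|k]]]] // _ arrows.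
- by have := ind_arrows_card_edges n3 (isT : 1 < 2) arrows; lia.
- by have := ind_arrows_card_edges n3 (isT : 1 < 3) arrows; lia.
have := ind_arrows_odd_cycle n_odd n3 arrows; move: #|edges G| => e.
have : 4 * 10 ^ k.+4 <= 9 ^ k.+4 * 2 ^ k.+3.
  elim: k {arrows} => // k IH; rewrite (expnS 10) (expnS 9) (expnS 2).
  by move: IH; move: (10 ^ _) (9 ^ _) (2 ^ _) => a b c; nia.
move: (10 ^ _) (9 ^ _) (2 ^ _) => a b c; clear => h1 h2.
have : 4 * (a * n) <= 4 * (b * e); last by rewrite leq_pmul2l.
by apply: (@leq_trans (b * c * n)); nia.
Qed.

(** * Gluing paths into an induced cycle *)

(** The paths [R t] run through the parts [W t] from the node [x t] to the node
    [x t.+1], cyclically.  Since every [R t] is induced, the parts meet at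
    nodes only, and every edge is inside a part, the union is an induced cycle. *)
Section Gluing.
Variables (V : finType) (adjV : rel V) (ell : nat) (W : nat -> {set V}).
Variables (x : nat -> V) (R : nat -> seq V).
Local Notation x0 := (x 0).
Hypothesis adjV_irr : irreflexive adjV.
Hypothesis adjV_sym : symmetric adjV.
Hypothesis ell_gt0 : 0 < ell.
Hypothesis x_wrap : x ell = x0.
Hypothesis x_inj : forall t t', t < ell -> t' < ell -> x t.+1 = x t'.+1 -> t = t'.
Hypothesis R_path : forall t, t < ell ->
  [/\ uniq (R t), 1 < size (R t), nth x0 (R t) 0 = x t & last x0 (R t) = x t.+1].
Hypothesis R_W : forall t, t < ell -> {subset R t <= W t}.
Hypothesis W_meet : forall t t' u, t < ell -> t' < ell -> t != t' ->
  u \in W t -> u \in W t' -> u = x t \/ u = x t.+1.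
Hypothesis R_adj : forall t i, t < ell -> i.+1 < size (R t) ->
  adjV (nth x0 (R t) i) (nth x0 (R t) i.+1).
Hypothesis R_induced : forall t i j, t < ell -> i < j -> j < size (R t) ->
  adjV (nth x0 (R t) i) (nth x0 (R t) j) -> j = i.+1.
Hypothesis adjV_W : forall t t' u v, t < ell -> t' < ell -> u \in W t -> v \in W t' ->
  adjV u v -> exists2 s, s < ell & (u \in W s) && (v \in W s).

Definition step u v := exists t i, [/\ t < ell, i.+1 < size (R t),
  u = nth x0 (R t) i & v = nth x0 (R t) i.+1].

(** Without its first vertex, each path contributes the node at its end, so every node
    is listed once. *)
Definition glued m := flatten [seq behead (R t) | t <- iota 0 m].

Lemma gluedS m : glued m.+1 = glued m ++ behead (R m).
Proof. by rewrite /glued -addn1 iotaD map_cat flatten_cat /= cats0. Qed.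

Lemma R_cons t : t < ell -> R t = x t :: behead (R t).
Proof. by by move=> /R_path[_]; case: (R t) => //= a s _ ->. Qed.

Lemma mem_glued m u : m <= ell -> u \in glued m ->
  exists t, [/\ t < m, u \in R t & u != x t].
Proof.
move=> mell /flattenP[s /mapP[t]]; rewrite mem_iota add0n => tm -> {s} uR; exists t.
have [uRt _ _ _] := R_path (leq_trans tm mell); rewrite (R_cons (leq_trans tm mell)) in uRt *.
by split; rewrite // ?inE ?uR ?orbT //; apply: contraTneq uR => ->; case/andP: uRt.
Qed.

Lemma glued_path m : m <= ell ->
  path (fun u v => `[< step u v >]) x0 (glued m) /\ last x0 (glued m) = x m.
Proof.
elim: m => [|m IH] // mell; have [IH1 IH2] := IH (ltnW mell).
rewrite gluedS cat_path last_cat IH1 {}IH2 /=; split; last first.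
  have [_ _ _ l] := R_path mell; by rewrite -l [in RHS]R_cons.
apply/(pathP x0) => i; rewrite size_behead => isz; apply/asboolP; exists m, i.
rewrite -R_cons // nth_behead; split=> //; by move: isz; case: (size _) => // n; clear; lia.
Qed.

Lemma glued_uniq m : m <= ell -> uniq (glued m).
Proof.
elim: m => // m IH mell; rewrite gluedS cat_uniq IH ?(ltnW mell) //=.
have [um _ _ _] := R_path mell; have := um; rewrite {1}R_cons //= => /andP[xR ->].
rewrite andbT; apply/hasPn=> u uR /=; apply/negP=> /(mem_glued (ltnW mell))[t [tm uRt ut]].
have tell := ltn_trans tm mell.
have uRm : u \in R m by rewrite R_cons // inE uR orbT.
have ntm : t != m by rewrite neq_ltn tm.
have [eu|eu] := W_meet tell mell ntm (R_W tell uRt) (R_W mell uRm).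
  by rewrite eu eqxx in ut.
have [eu'|eu'] := W_meet mell tell (negbT (gtn_eqF tm)) (R_W mell uRm) (R_W tell uRt).
  by rewrite -eu' uR in xR.
have := x_inj tell mell; rewrite -eu -eu' => /(_ erefl) e; by rewrite e ltnn in tm.
Qed.

Lemma size_glued m : size (glued m) = \sum_(t < m) (size (R t)).-1.
Proof.
elim: m => [|m IH]; first by rewrite big_ord0.
by rewrite gluedS size_cat IH big_ord_recr /= size_behead.
Qed.

(** A vertex determines its successor: the hypergraph edges of the ring share
    only end vertices of consecutive paths, and an end vertex is the last one
    of one path and the first one of the next. *)
Lemma step_fun u v v' : step u v -> step u v' -> v = v'.
Proof.
move=> [t [i [tl il eu ->]]] [t' [i' [tl' il' eu' ->]]].
have uR : u \in R t by rewrite eu mem_nth // ltnW.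
have uR' : u \in R t' by rewrite eu' mem_nth // ltnW.
case: (eqVneq t t') => [ett|ntt].
  subst t'; have [un _ _ _] := R_path tl.
  congr nth; congr S; apply/eqP; rewrite -(nth_uniq x0 _ _ un) ?(ltnW il) ?(ltnW il') //.
  by rewrite -eu -eu'.
(* the last vertex of a path has no successor in it, so [u] is [x t] and [x t'] *)
have first s j : s < ell -> j.+1 < size (R s) -> u = nth x0 (R s) j -> u != x s.+1.
  move=> sl jl ->; have [un s1 _ <-] := R_path sl.
  rewrite -nth_last nth_uniq ?(ltnW jl) // ?prednK ?(ltnW s1) //.
  by move: jl; clear; lia.
have ut : u = x t.
  have [//|e] := W_meet tl tl' ntt (R_W tl uR) (R_W tl' uR').
  by have := first t i tl il eu; rewrite e eqxx.
have ut' : u = x t'.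
  have [//|e] := W_meet tl' tl (negbT (etrans (eq_sym _ _) (negbTE ntt))) (R_W tl' uR') (R_W tl uR).
  by have := first t' i' tl' il' eu'; rewrite e eqxx.
case/eqP: ntt.
have xx s : s < ell -> x s = x (if s is s'.+1 then s' else ell.-1).+1.
  by case: s => //= _; rewrite prednK.
have lt_pred s : s < ell -> (if s is s'.+1 then s' else ell.-1) < ell.
  by case: s => [|s] sl; [rewrite prednK | exact: ltnW].
have := x_inj (lt_pred t tl) (lt_pred t' tl'); rewrite -!xx // -ut -ut' => /(_ erefl).
move: tl tl'; clear; case: t t' => [|t] [|t'] //=; lia.
Qed.

Lemma step_adj u v : step u v -> adjV u v.
Proof. by move=> [t [i [tl il -> ->]]]; exact: R_adj. Qed.

Lemma adj_step t u v : t < ell -> u \in R t -> v \in R t -> adjV u v -> step u v \/ step v u.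
Proof.
move=> tl /(nthP x0)[i il <-] /(nthP x0)[j jl <-] uv.
case: (ltngtP i j) => ij; last by rewrite ij adjV_irr in uv.
  by have e := R_induced tl ij jl uv; left; exists t, i; split; rewrite -?e.
by rewrite adjV_sym in uv; have e := R_induced tl ij il uv; right; exists t, j; split; rewrite -?e.
Qed.

Lemma glued_cycle : exists cyc : seq V,
  [/\ uniq cyc, size cyc = \sum_(t < ell) (size (R t)).-1,
    {in cyc, forall u, step u (next cyc u)} &
    {in cyc &, forall u v, adjV u v = (v == next cyc u) || (u == next cyc v)}].
Proof.
exists (glued ell); have [pth l] := glued_path (leqnn ell).
have cyc : cycle (fun u v => `[< step u v >]) (glued ell).
  by rewrite (cycle_path x0) l x_wrap.
have nextP u : u \in glued ell -> step u (next (glued ell) u).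
  by move=> /(next_cycle cyc)/asboolP.
split=> [||//|u v ug vg]; [exact: glued_uniq|exact: size_glued|].
apply/idP/orP; last first.
  case=> /eqP->; first by apply: step_adj; exact: nextP.
  by rewrite adjV_sym; apply: step_adj; exact: nextP.
move=> uv; have [t [tl ut _]] := mem_glued (leqnn _) ug.
have [t' [tl' vt _]] := mem_glued (leqnn _) vg.
have [s sl /andP[us vs]] := adjV_W tl tl' (R_W tl ut) (R_W tl' vt) uv.
have toR w r : r < ell -> w \in R r -> w \in W s -> w \in R s.
  move=> rl wr ws; case: (eqVneq s r) => [->//|nsr].
  have [_ s1 f l'] := R_path sl.
  have [->|->] := W_meet sl rl nsr ws (R_W rl wr).
    by rewrite -f mem_nth // ltnW.
  by rewrite -l' -nth_last mem_nth // prednK // ltnW.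
case: (adj_step sl (toR u t tl ut us) (toR v t' tl' vt vs) uv) => st.
  by left; apply/eqP; apply: step_fun st (nextP u ug).
by right; apply/eqP; apply: step_fun st (nextP v vg).
Qed.

End Gluing.

Lemma cycle_embedding (G : sgraph) k (chi : {set G} -> 'I_k) c (cyc : seq G) n :
  2 < n -> uniq cyc -> size cyc = n ->
  {in cyc &, forall u v, adj u v = (v == next cyc u) || (u == next cyc v)} ->
  {in cyc, forall u, chi [set u; next cyc u] = c} ->
  exists phi : cycle_graph n -> G, induced_embedding phi /\ monochromatic chi phi.
Proof.
move=> n3 uc sc adjc col.
have [u0 _] : exists u0, u0 \in cyc.
  by case: cyc sc {uc adjc col} => [|u s] sc; [rewrite -sc in n3 | exists u; rewrite mem_head].
pose phi (i : cycle_graph n) := nth u0 cyc (i : 'I_n).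
have phic i : phi i \in cyc by rewrite mem_nth ?sc //; exact: ltn_ord.
have phi_inj : injective phi.
  move=> i j /eqP; have [li lj] := (ltn_ord (i : 'I_n), ltn_ord (j : 'I_n)).
  by rewrite /phi nth_uniq ?sc // => /eqP/val_inj.
have phiS : forall i : 'I_n, next cyc (phi i) = phi (ordS i).
  move=> i.
  have lt_in := ltn_ord i; rewrite next_nth phic /phi index_uniq ?sc //=.
  move: (nat_of_ord i) lt_in => {}i lt_in.
  case: cyc sc {uc adjc col phi phic phi_inj} => [|y s] /= sc; first by rewrite -sc in lt_in.
  case: (ltngtP i.+1 n) => h; last by rewrite h modnn /= nth_default // -ltnS sc h.
    by rewrite modn_small //=; apply: set_nth_default; rewrite -ltnS sc.
  by move: h; rewrite ltnNge lt_in.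
exists phi; split.
  split=> // i j; rewrite adjc // !phiS !(inj_eq phi_inj) /= /cycle_adj.
  by case: (eqVneq i j) => [->|//]; rewrite orbb; exact/negbTE/ordS_neq.
exists c => i j /andP[_ /orP[]/eqP->]; last rewrite setUC.
  by rewrite -phiS col.
by rewrite -phiS col.
Qed.

(** * The host graph *)
Lemma ipath_rev (V : finType) (F Gam : rel V) x y P : symmetric F -> symmetric Gam ->
  ipath F Gam x y P -> ipath F Gam y x (rev P).
Proof.
move=> F_sym Gam_sym [uP P0 hx ly [gP iP]].
have nth_rev' i : i < size P -> nth y (rev P) i = nth x P (size P - i.+1).
  by move=> lt; rewrite nth_rev //; apply: set_nth_default; move: lt; clear; lia.
split; rewrite ?rev_uniq ?size_rev //.
- by rewrite nth_rev' // subn1 nth_last.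
- rewrite -nth_last size_rev ?prednK // nth_rev' ?prednK //.
  by rewrite subnn.
split=> [i lt|i j ij jP].
  rewrite !nth_rev' ?(ltnW lt) // Gam_sym.
  have -> : size P - i.+1 = (size P - i.+2).+1 by move: lt; clear; lia.
  by apply: gP; move: lt; clear; lia.
rewrite !nth_rev' ?(ltn_trans ij) // F_sym => /iP e.
by have := e _ _; move: ij jP; clear; lia.
Qed.

Lemma sum_ltn_ord l j : j <= l -> \sum_(t < l) (t < j) = j.
Proof.
move=> jl; rewrite -(subnKC jl).
rewrite big_split_ord /= -[RHS]addn0; congr (_ + _).
  rewrite -[RHS](card_ord j) -sum1_card; apply: eq_bigr => i _; by rewrite ltn_ord.
by rewrite big1 // => i _; rewrite ltnNge leq_addr.
Qed.

Section Host.
Variables (N m M' : nat) (F : rel 'I_N).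
Variables (f : {ffun 'I_m * 'I_N -> 'I_M'.+1}) (I : {set 'I_m}).
Hypothesis F_sym : symmetric F.
Hypothesis F_irr : irreflexive F.
Local Notation V := ('I_N * 'I_M'.+1)%type.
Local Notation E := {i : 'I_m | i \in I}.

(** A copy of [F] on every hyperedge in [I]; the first coordinate of a vertex, its
    class, is its name in [F]. *)
Definition host_adj : rel V :=
  fun u v => F u.1 v.1 && [exists i in I, (u \in hedge f i) && (v \in hedge f i)].

Lemma host_sym : symmetric host_adj.
Proof.
move=> u v; rewrite /host_adj F_sym; congr (_ && _).
by apply: eq_existsb => i; rewrite [(v \in _) && _]andbC.
Qed.

Lemma host_irr : irreflexive host_adj.
Proof. by move=> u; rewrite /host_adj F_irr. Qed.

Definition host_graph := SGraph host_sym host_irr.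

Definition place (e : 'I_m) a : V := (a, f (e, a)).

Lemma place_hedge e a : place e a \in hedge f e.
Proof. by rewrite mem_hedge. Qed.

Lemma hedge_place e u : u \in hedge f e -> u = place e u.1.
Proof. by case: u => a v; rewrite mem_hedge => /eqP <-. Qed.

Lemma host_adj_place e a b : e \in I -> host_adj (place e a) (place e b) = F a b.
Proof.
move=> eI; rewrite /host_adj /= andb_idr // => _.
by apply/exists_inP; exists e => //; rewrite !place_hedge.
Qed.

Lemma card_host_edges : #|edges host_graph| <= m * N ^ 2.
Proof.
pose h (x : 'I_m * ('I_N * 'I_N)) : {set host_graph} := [set place x.1 x.2.1; place x.1 x.2.2].
apply: (@leq_trans #|[set h x | x in [set: 'I_m * ('I_N * 'I_N)]]|); last first.
  apply: leq_trans (leq_imset_card _ _) _.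
  by rewrite cardsT !card_prod !card_ord leqnn.
apply/subset_leq_card/subsetP=> e /imsetP[[u v]]; rewrite inE /= => uv ->.
case/andP: uv => _ /exists_inP[i _ /andP[ui vi]].
apply/imsetP; exists (i, (u.1, v.1)); rewrite ?inE // /h /=.
by rewrite -(hedge_place ui) -(hedge_place vi).
Qed.

Section Ring.
Variables (k : nat) (chi : {set host_graph} -> 'I_k) (c : 'I_k) (x y : 'I_N).
Variables (P Q : 'I_m -> seq 'I_N) (p : nat) (J : {set E}).

Definition port (b : bool) (e : E) : V := place (val e) (if b then y else x).
Definition edge_vs (e : E) := hedge f (val e).
Definition coloured (e : 'I_m) : rel 'I_N :=
  fun a a' => F a a' && (chi [set (place e a : host_graph); place e a'] == c).

Hypothesis p_gt0 : 0 < p.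
Hypothesis P_path : forall e, e \in J -> ipath F (coloured (val e)) x y (P (val e)) /\ size (P (val e)) = p.+1.
Hypothesis Q_path : forall e, e \in J -> ipath F (coloured (val e)) x y (Q (val e)) /\ size (Q (val e)) = p.+2.

Lemma coloured_sym e : symmetric (coloured e).
Proof. by move=> a a'; rewrite /coloured F_sym setUC. Qed.

Section Cycle.
Variables (root : E) (b : bool) (C : seq E).
Hypothesis hC : hypercycle edge_vs J port root b C.
Hypothesis C_gt2 : 2 < size C.
Local Notation ell := (size C).

Definition node t := port (b (+) odd t) (nth root C (t %% ell)).

Lemma odd_mod t : odd (t %% ell) = odd t.
Proof. by rewrite [in RHS](divn_eq t ell) oddD oddM (negPf (hc_even hC)) andbF. Qed.

Lemma node_inj t t' : node t = node t' -> t %% ell = t' %% ell.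
Proof.
have ell0 : 0 < ell by apply: leq_trans C_gt2.
move=> e; apply: (hc_node hC); rewrite ?ltn_mod // !odd_mod; exact: e.
Qed.

Lemma node_entry t : t < ell -> port (b (+) odd t) (nth root C t) = node t.
Proof. by move=> tl; rewrite /node modn_small. Qed.

Lemma node_exit t : t < ell -> port (b (+) odd t.+1) (nth root C t) = node t.+1.
Proof. by move=> tl; rewrite (hc_link hC tl). Qed.

(** The two ports of a hyperedge are consecutive nodes of the cycle.  As nodes do not
    repeat, a repeated hyperedge is possible in a cycle of length two only. *)
Lemma hyperedges_neq t t' : t < t' -> t' < ell -> nth root C t <> nth root C t'.
Proof.
move=> tt' t'l e; have tl := ltn_trans tt' t'l.
case: (eqVneq (odd t) (odd t')) => [eo|/negPf no].
  have := node_entry tl; rewrite e eo node_entry // => /node_inj.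
  by rewrite !modn_small // => ett; rewrite ett ltnn in tt'.
have eo : odd t.+1 = odd t' by move: no; rewrite /=; case: (odd t); case: (odd t').
have eo' : odd t'.+1 = odd t by move: no; rewrite /=; case: (odd t); case: (odd t').
have e1 : t' = t.+1.
  have := node_exit tl; rewrite e eo node_entry // => /node_inj.
  by rewrite !modn_small // (leq_ltn_trans tt' t'l).
have := node_exit t'l; rewrite -e eo' node_entry // => /node_inj.
rewrite (modn_small tl) {}e1 in t'l *; move: t'l C_gt2; clear => t'l C_gt2.
case: (ltngtP t.+2 ell) => h; first by rewrite modn_small //; lia.
  by lia.
by rewrite h modnn; lia.
Qed.

(** The longer path is used in the first [j] hyperedges; a hyperedge entered by its
    second port is traversed backwards. *)
Definition route j t := let S := if t < j then Q (val (nth root C t)) else P (val (nth root C t)) in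
  if b (+) odd t then rev S else S.

Lemma routeP j t : t < ell ->
  ipath F (coloured (val (nth root C t))) (if b (+) odd t then y else x)
    (if b (+) odd t.+1 then y else x) (route j t) /\
  size (route j t) = (p + (t < j)).+1.
Proof.
move=> tl; have eJ := hc_J hC (mem_nth root tl).
set e := nth root C t in eJ *.
have [S SP sS] : exists2 S, ipath F (coloured (val e)) x y S /\ size S = (p + (t < j)).+1 &
    (if t < j then Q (val e) else P (val e)) = S.
  case: (t < j); eexists; rewrite ?addn1 ?addn0 //; [exact: Q_path|exact: P_path].
have [S1 S2] := SP; rewrite /route -/e sS /= addbN; case: (b (+) odd t); rewrite ?size_rev //.
by split=> //; apply: ipath_rev => //; exact: coloured_sym.
Qed.

(** An edge of the host graph between two routes lies in some hyperedge [h].  If [h] is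
    not in the cycle, it touches the cycle at most once, which is absurd; so the
    edge is inside one hyperedge of the cycle, where the route is induced. *)
Lemma ring_cycle j : j <= ell -> exists phi : cycle_graph (ell * p + j) -> host_graph,
  induced_embedding phi /\ monochromatic chi phi.
Proof.
move=> jl; have ell0 : 0 < ell by apply: leq_trans C_gt2.
pose R t : seq V := [seq place (val (nth root C t)) a | a <- route j t].
pose W t := edge_vs (nth root C t).
have CI t : val (nth root C t) \in I by exact: valP.
have RE t i z : t < ell -> i < size (R t) ->
    nth (node 0) (R t) i = place (val (nth root C t)) (nth z (route j t) i).
  by move=> tl; rewrite size_map => il; rewrite (nth_map z).
have [||||||||cyc [u_cyc s_cyc next_step adj_cyc]] :=
  @glued_cycle V host_adj ell W node R host_irr host_sym ell0.
- by rewrite /node modnn mod0n (negPf (hc_even hC)).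
- move=> t t' tl tl' /node_inj.
  case: (ltngtP t.+1 ell) tl => // h _; case: (ltngtP t'.+1 ell) tl' => // h' _.
  + by rewrite !modn_small // => -[].
  + by rewrite modn_small // h' modnn.
  + by rewrite h modnn modn_small.
  + by move=> _; move: h h'; clear; lia.
- move=> t tl; have [[uS S0 h l _] sS] := routeP j tl.
  have Rs : 0 < size (R t) by rewrite size_map.
  split.
  + by rewrite map_inj_uniq // => a a' [].
  + by rewrite size_map sS ltnS addn_gt0 p_gt0.
  + by rewrite (RE t 0 (if b (+) odd t then y else x) tl Rs) h -node_entry.
  + rewrite -nth_last (RE t _ (if b (+) odd t then y else x) tl) ?prednK //.
    by rewrite size_map nth_last l -node_exit.
- by move=> t tl u /mapP[a _ ->]; exact: place_hedge.
- move=> t t' u tl tl' ntt' ut ut'.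
  have ne : nth root C t != nth root C t'.
    apply/eqP; move: ntt'; rewrite neq_ltn => /orP[h|h]; first exact: hyperedges_neq.
    by move/esym; exact: hyperedges_neq.
  have [b' ->] := hc_meet hC (mem_nth root tl) (mem_nth root tl') ne ut ut'.
  case: (eqVneq b' (b (+) odd t)) => [->|nb]; first by left; exact: node_entry.
  right; rewrite -node_exit //=; congr port; move: nb; clear.
  by case: b'; case: b; case: (odd t).
- move=> t i tl il; have [[_ _ _ _ [gS _]] _] := routeP j tl.
  rewrite !(RE t _ (if b (+) odd t then y else x) tl) ?(ltnW il) // host_adj_place //.
  by rewrite size_map in il; have /andP[] := gS i il.
- move=> t i i' tl ii' il; have [[_ _ _ _ [_ iS]] _] := routeP j tl.
  rewrite !(RE t _ (if b (+) odd t then y else x) tl) ?(ltn_trans ii') // host_adj_place //.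
  by rewrite size_map in il; exact: iS.
- move=> t t' u v tl tl' ut vt uv; have := uv; case/andP=> _ /exists_inP[i iI /andP[ui vi]].
  pose h : E := exist _ i iI; case: (boolP (h \in C)) => hCC.
    by exists (index h C); rewrite ?index_mem // /W nth_index // ui vi.
  have uv' := hc_out hC hCC (mem_nth root tl) (mem_nth root tl') ui ut vi vt.
  by rewrite uv' host_irr in uv.
apply: (@cycle_embedding host_graph k chi c cyc) => //.
- by rewrite (leq_trans C_gt2) // (leq_trans _ (leq_addr _ _)) // leq_pmulr.
- rewrite s_cyc (eq_bigr (fun t : 'I_ell => p + (t < j))) => [|t _].
    by rewrite big_split /= sum_nat_const card_ord sum_ltn_ord.
  by rewrite size_map; have [_ ->] := routeP j (ltn_ord t).
move=> u /next_step[t [i [tl il eu ->]]]; rewrite eu.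
have [[_ _ _ _ [gS _]] _] := routeP j tl.
rewrite !(RE t _ (if b (+) odd t then y else x) tl) ?(ltnW il) //.
by rewrite size_map in il; have /andP[_ /eqP] := gS i il.
Qed.

End Cycle.
End Ring.
End Host.

(** Delete the hyperedges at a port that has fewer than [d] of them.  This removes a
    port, so the average degree of the ports stays above [d]. *)
Lemma core_exists (E V : finType) (pt : bool -> E -> V) (J0 : {set E}) d :
  d * (#|pt false @: J0| + #|pt true @: J0|) < #|J0| ->
  exists J : {set E}, [/\ J \subset J0, J != set0 &
    forall e b, e \in J -> d <= #|[set e' in J | pt b e' == pt b e]|].
Proof.
elim/ltn_ind: {J0}#|J0| {-2}J0 (erefl #|J0|) => s IH J0 sJ0 dense.
have J0n0 : J0 != set0 by rewrite -card_gt0 (leq_ltn_trans _ dense).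
case: (pselect (forall e b, e \in J0 -> d <= #|[set e' in J0 | pt b e' == pt b e]|)) => [h|].
  by exists J0.
move/existsNP=> [e /existsNP[b /not_implyP[eJ /negP]]]; rewrite -ltnNge => few.
set S := [set e' in J0 | _] in few.
have SJ : S \subset J0 by apply/subsetP=> z; rewrite inE => /andP[].
have cJ : #|J0 :\: S| = #|J0| - #|S| by rewrite cardsD (setIidPr SJ).
have lt : #|J0 :\: S| < s.
  rewrite cJ -sJ0; have : 0 < #|S| by apply/card_gt0P; exists e; rewrite inE eJ eqxx.
  by have := subset_leq_card SJ; clear; lia.
have p1 : #|pt b @: (J0 :\: S)| < #|pt b @: J0|.
  apply/proper_card/properP; split; first exact/imsetS/subsetDl.
  exists (pt b e); first exact: imset_f.
  apply/imsetP=> -[e']; rewrite !inE => /andP[/nandP[/negP//|n1] e'J] e1.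
  by rewrite e1 eqxx in n1.
have p2 : #|pt (~~ b) @: (J0 :\: S)| <= #|pt (~~ b) @: J0|.
  by apply/subset_leq_card/imsetS/subsetDl.
have ports (A : {set E}) :
    #|pt false @: A| + #|pt true @: A| = #|pt b @: A| + #|pt (~~ b) @: A|.
  by case: b {S few SJ cJ lt p1 p2}; rewrite //= addnC.
have [|J [JJ0 Jn0 degJ]] := IH _ lt _ erefl.
  rewrite cJ -sJ0 in dense lt *; move: dense; rewrite !ports; move: p1 p2 few.
  move: #|S| #|J0| #|pt b @: J0| #|pt _ @: J0| #|pt b @: _| #|pt _ @: _|; clear.
  by move=> a j x y x' y'; nia.
by exists J; split=> //; apply: subset_trans JJ0 (subsetDl _ _).
Qed.

(** * The host graph arrows the cycle *)
Section Arrows.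
Variables (N m M' k L s d g n h : nat) (F : rel 'I_N).
Variables (f : {ffun 'I_m * 'I_N -> 'I_M'.+1}) (I : {set 'I_m}).
Hypothesis F_sym : symmetric F.
Hypothesis F_irr : irreflexive F.
Local Notation V := ('I_N * 'I_M'.+1)%type.
Local Notation E := {i : 'I_m | i \in I}.
Local Notation vs := (@edge_vs N m M' f I).
Hypothesis F_flexible : forall chi : 'I_N -> 'I_N -> 'I_k, (forall a b, chi a b = chi b a) ->
  exists c, flexible F (fun a b => F a b && (chi a b == c)) L.+2.
Hypothesis I_sparse : forall S : {set 'I_m}, S \subset I -> #|S| <= s ->
  4 * N.-1 * #|S| <= 4 * #|covered (hedge f) S| + #|S|.
Hypothesis I_girth : forall S : {set 'I_m}, S \subset I -> 0 < #|S| <= g ->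
  N.-1 * #|S| < #|covered (hedge f) S|.
Hypothesis N_gt2 : 2 < N.
Hypothesis d_big : 72 + 48 * N ^ 2 < d.
Hypothesis I_big : d * (2 * M'.+1) * (k * (N * N) * L.+1) < #|I|.
Hypothesis h_small : 2 ^ h.+1 <= N.
Hypothesis h_N : h.+2 <= N.
Hypothesis g_big : 2 * (h.+2 + h.+2) < g.
Hypothesis lengths : forall p, 0 < p -> p <= L -> exists u, [/\ 0 < u,
  72 * N * (N ^ h.+2 * (N ^ h.+2 * (N ^ h * u))) + 14 <= s,
  2 * M'.+1 * 2 ^ h.+2 < N ^ h.+1 * (N ^ h.+2 * (N ^ h.+2 * (N ^ h * u))) &
  forall l, 2 * (N * (N ^ h * u)) <= l + 6 * (N ^ h * u) + 2 ->
    l <= 2 * (N * (N ^ h * u)) + 4 * (N ^ h * u) + 2 + 2 * (h.+2 + h.+2) ->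
    [/\ 2 < l, l * p <= n & n <= l * p.+1]].

Lemma covered_val (S : {set E}) : covered vs S = covered (hedge f) (val @: S).
Proof. by rewrite /covered big_imset //= => e e' _ _; exact: val_inj. Qed.

Lemma val_sub (S : {set E}) : val @: S \subset I.
Proof. by apply/subsetP=> _ /imsetP[e _ ->]; exact: valP. Qed.

Lemma card_val (S : {set E}) : #|val @: S| = #|S|.
Proof. by rewrite card_imset //; exact: val_inj. Qed.

Lemma vs_sparse (S : {set E}) : #|S| <= s ->
  4 * N.-1 * #|S| <= 4 * #|covered vs S| + #|S|.
Proof. by rewrite covered_val -card_val; apply: I_sparse; exact: val_sub. Qed.

Lemma vs_girth (S : {set E}) : 0 < #|S| <= g -> N.-1 * #|S| < #|covered vs S|.
Proof. by rewrite covered_val -card_val; apply: I_girth; exact: val_sub. Qed.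

Lemma vs_linear (e e' : E) : e != e' ->
  {in [predI vs e & vs e'] &, forall u u', u = u'}.
Proof.
move=> ne u u'; rewrite !inE => /andP[ue ue'] /andP[u'e u'e'].
apply/eqP/negPn/negP => nu.
have := @vs_girth [set e; e']; rewrite cards2 ne /= => /(_ (leq_trans _ g_big)).
have g2 : 1 < 2 * (h.+2 + h.+2) by clear; lia.
move=> /(_ (ltnW g2)).
have -> : covered vs [set e; e'] = vs e :|: vs e'.
  by rewrite covU1 /covered big_set1.
have := card_setD_contact2 nu ue u'e ue' u'e'; rewrite cardsU cardsD.
rewrite !card_hedge; move: N_gt2; clear; move: #|_ :&: _| => x; lia.
Qed.

(** The longer path [Q] has at least two vertices, so its ends are distinct, and
    therefore [P] has an edge. *)
Lemma flexible_type (chi : 'I_N -> 'I_N -> 'I_k) : (forall a b, chi a b = chi b a) ->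
  exists c x y P Q, let Gam := fun a b => F a b && (chi a b == c) in
  [/\ 0 < (size P).-1 <= L, x != y, ipath F Gam x y P, ipath F Gam x y Q & size Q = (size P).+1].
Proof.
move=> /F_flexible[c [x [y [P [Q [pP pQ sQ QL]]]]]]; exists c, x, y, P, Q; split=> //.
- case: pP pQ => [_ P0 hP lP _] [uQ _ hQ lQ _]; apply/andP; split; last by move: sQ QL; clear; lia.
  rewrite lt0n; apply/eqP => s1; have {s1} s1 : size P = 1 by move: P0 s1; clear; lia.
  have yx : y = x by rewrite -lP -nth_last s1 hP.
  move: lQ; rewrite -nth_last sQ s1 /= yx -[RHS]hQ => /eqP.
  by rewrite nth_uniq // sQ s1.
apply/eqP => xy.
case: pP pQ => [uP P0 hP lP _] [uQ _ hQ lQ _].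
have : nth x P (size P).-1 = nth x P 0 by rewrite nth_last lP -xy.
move/eqP; rewrite nth_uniq // ?prednK // => /eqP s1.
have {s1} s1 : size P = 1 by move: P0 s1; clear; lia.
move: lQ; rewrite -nth_last sQ s1 /= -xy -[RHS]hQ => /eqP.
by rewrite nth_uniq // sQ s1.
Qed.

Local Notation T := ('I_k * ('I_N * 'I_N) * 'I_L.+1)%type.

(** A hyperedge has one of [k * N ^ 2 * L.+1] types: colour, ends and length of the
    paths.  The core of the most frequent type provides the hypercycle. *)
Lemma host_ind_arrows : ind_arrows (host_graph f I F_sym F_irr) (cycle_graph n) k.
Proof.
move=> chi.
pose chie (e : 'I_m) a b := chi [set place f e a; place f e b].
have chie_sym e a b : chie e a b = chie e b a by rewrite /chie setUC.
pose good (e : 'I_m) (z : T * (seq 'I_N * seq 'I_N)) :=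
  let Gam := coloured chi z.1.1.1 e in
  [/\ 0 < z.1.2, z.1.1.2.1 != z.1.1.2.2,
    ipath F Gam z.1.1.2.1 z.1.1.2.2 z.2.1 /\ size z.2.1 = (z.1.2 : 'I_L.+1).+1 &
    ipath F Gam z.1.1.2.1 z.1.1.2.2 z.2.2 /\ size z.2.2 = (z.1.2 : 'I_L.+1).+2].
have /boolp.choice[ty tyP] : forall e, exists z, good e z.
  move=> e.
  have [c [x [y [P [Q [/andP[p0 pL] xy pP pQ sQ]]]]]] := flexible_type (chie_sym e).
  exists ((c, (x, y), inord (size P).-1), (P, Q)); rewrite /good /= inordK //.
  have sP : size P = (size P).-1.+1 by move: p0; clear; lia.
  by rewrite -sP sQ.
have [tau big] : exists tau : T, d * (2 * M'.+1) < #|[set e : E | (ty (val e)).1 == tau]|.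
  apply: contrapT => none.
  have : #|I| <= d * (2 * M'.+1) * (k * (N * N) * L.+1).
    have -> : #|I| = \sum_(tau : T) #|[set e : E | (ty (val e)).1 == tau]|.
      rewrite -[LHS](card_sig (mem I)) -sum1_card (partition_big (fun e : E => (ty (val e)).1) xpredT) //=.
      by apply: eq_bigr => tau _; rewrite sum1dep_card.
    have -> : k * (N * N) * L.+1 = #|{: T}| by rewrite !card_prod !card_ord.
    rewrite mulnC -sum_nat_const; apply: leq_sum => tau _.
    by rewrite leqNgt; apply/negP => big; apply: none; exists tau.
  by rewrite leqNgt I_big.
case: tau big => -[c [x y]] p; set J0 := [set e | _] => big.
have J0P e : e \in J0 -> (ty (val e)).1 = (c, (x, y), p) by rewrite inE => /eqP.
pose pt := port f (I := I) x y.
have ptM b : #|pt b @: J0| <= M'.+1.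
  rewrite -[leqRHS]mul1n -(cards1 (if b then y else x)) -[X in _ * X](card_ord M'.+1) -cardsT -cardsX.
  by apply/subset_leq_card/subsetP=> _ /imsetP[e _ ->]; rewrite !inE eqxx.
have [|J [JJ0 /set0Pn[root rJ] degJ]] := @core_exists E V pt J0 d.
  apply: leq_ltn_trans big; rewrite leq_mul2l; apply/orP; right.
  by rewrite mulSn mul1n; apply: leq_add; exact: ptM.
have JP e : e \in J -> good (val e) ((c, (x, y), p), (ty (val e)).2).
  by move=> /(subsetP JJ0)/J0P <-; have := tyP (val e); case: (ty (val e)).
have [p0 xy _ _] := JP root rJ; rewrite /= in p0 xy.
have [u [u0 us uM lenP]] := lengths p0 (ltn_ord p).
have [] := @hypercycle_exists E V vs N.-1 J pt root _ _ _ vs_linear d s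
  (fun e b eJ => degJ e b eJ) vs_sparse N N_gt2 d_big rJ g vs_girth (setX [set x; y] setT) u h.
- by move=> e; rewrite card_hedge prednK // (ltn_trans _ N_gt2).
- by move=> b e; exact: place_hedge.
- by move=> e e'; apply: contraNneq xy => -[->].
- by move=> b e; rewrite !inE /= andbT; case: b; rewrite eqxx ?orbT.
- exact: u0.
- exact: h_small.
- exact: h_N.
- exact: us.
- by rewrite cardsX cardsT card_ord cards2 xy.
- exact: g_big.
move=> b [C [hC C_ge C_le]].
have [C2 pn np] := lenP _ C_ge C_le.
have jC : n - size C * p <= size C.
  by move: np pn; rewrite mulnS; move: (size C * p) (size C); clear; lia.
have [PJ QJ] : (forall e, e \in J -> ipath F (coloured chi c (val e)) x y (ty (val e)).2.1 /\
    size (ty (val e)).2.1 = p.+1) /\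
  (forall e, e \in J -> ipath F (coloured chi c (val e)) x y (ty (val e)).2.2 /\
    size (ty (val e)).2.2 = p.+2) by split=> e /JP[].
have := ring_cycle (P := fun e => (ty e).2.1) (Q := fun e => (ty e).2.2) p0 PJ QJ hC C2 jC.
by rewrite subnKC.
Qed.

End Arrows.

(** * Choice of the parameters *)
Lemma mul_le_expn b k : 1 < b -> 0 < k -> b * k <= b ^ k.
Proof. by move=> b1; case: k => // k _; rewrite expnS leq_mul // ltn_expl. Qed.

(** The hypercycle has about [2 * N ^ 48 * u] hyperedges, with a relative error
    [O(1 / N)].  With [u] about [n / ((2 * p + 1) * N ^ 48)] this is
    [n / (p + 1 / 2)], halfway between the two extremes that are allowed; the margin
    is a proportion of order [1 / p], and [p] is small compared with [N]. *)
Lemma ring_lengths N L n p : 2000 * L.+1 <= N -> 2 ^ 51 <= N -> N ^ 50 <= n ->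
  0 < p -> p <= L -> exists u, [/\ 0 < u,
  72 * N * (N ^ 49 * (N ^ 49 * (N ^ 47 * u))) + 14 <= N ^ 99 * n,
  2 * (N ^ 143 * n) * 2 ^ 49 < N ^ 48 * (N ^ 49 * (N ^ 49 * (N ^ 47 * u))) &
  forall l, 2 * (N * (N ^ 47 * u)) <= l + 6 * (N ^ 47 * u) + 2 ->
    l <= 2 * (N * (N ^ 47 * u)) + 4 * (N ^ 47 * u) + 2 + 2 * (49 + 49) ->
    [/\ 2 < l, l * p <= n & n <= l * p.+1]].
Proof.
move=> N_L N_big n_big p0 pL; set c := (2 * p).+1 * N ^ 48.
have N0 : 0 < N by move: N_L; clear; lia.
have c0 : 0 < c by rewrite muln_gt0 expn_gt0 N0.
have [u_N u_lo u_hi] : [/\ N <= n %/ c, n %/ c * c <= n & n < (n %/ c).+1 * c].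
  rewrite leq_divM ltn_ceil // leq_divRL // /c; split=> //; apply: leq_trans n_big.
  rewrite (expnD N 2 48) mulnA leq_mul2r; apply/orP; right.
  by rewrite -[N ^ 2]mulnn leq_mul //; move: N_L pL; clear; lia.
move: (n %/ c) u_N u_lo u_hi => u u_N u_lo u_hi; exists u.
set sigma := N ^ 47 * u.
have sigma_c : N * sigma * (2 * p).+1 = u * c.
  by rewrite /sigma /c (expnS N 47); move: (N ^ 47); clear=> B; lia.
have sigma_B : N ^ 48 <= sigma by rewrite /sigma expnSr leq_mul2l u_N orbT.
have sigma0 : 0 < sigma by apply: leq_trans sigma_B; rewrite expn_gt0 N0.
have n_lo : N * sigma * (2 * p).+1 <= n by rewrite sigma_c.
have n_hi : n < N * sigma * (2 * p).+1 + sigma * (2 * p).+1.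
  rewrite sigma_c; apply: leq_trans u_hi _; rewrite mulSn addnC leq_add2l /c mulnC.
  by rewrite leq_mul2r sigma_B orbT.
have u0 : 0 < u by apply: leq_trans u_N.
clearbody sigma; clear sigma_B sigma_c u_N u_lo u_hi c0.
have n_hi' : n <= N * (N * sigma).
  apply: leq_trans (ltnW n_hi) _; move: N_L pL; clear => N_L pL.
  have : N * sigma * (2 * p).+2 <= N * sigma * N by rewrite leq_mul //; lia.
  have : (2 * p).+1 * sigma <= N * sigma by rewrite leq_mul //; lia.
  by lia.
have h86 : 86 * sigma <= n.
  apply: leq_trans n_lo; rewrite -[leqLHS]muln1 leq_mul // leq_mul2r.
  by apply/orP; right; move: N_L; clear; lia.
split=> //.
- have -> : N ^ 99 = N * (N ^ 49 * N ^ 49).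
    by rewrite -(expnD N 49 49) -(expnS N 98).
  have : 0 < N ^ 49 by rewrite expn_gt0 N0.
  move: (N ^ 49) h86 N0 sigma0; clear => B h86 N0 sigma0 B0.
  have : N * (B * B) * (86 * sigma) <= N * (B * B) * n by rewrite leq_mul.
  have : 0 < N * (B * B) * sigma by rewrite !muln_gt0 N0 B0.
  by lia.
- have -> : N ^ 143 = N ^ 45 * (N ^ 49 * N ^ 49).
    by rewrite -(expnD N 49 49) -(expnD N 45 98).
  have -> : N ^ 48 = N ^ 45 * (N * (N * N)) by rewrite (expnD N 45 3) !expnS muln1.
  have [A0 B0] : 0 < N ^ 45 /\ 0 < N ^ 49 by rewrite !expn_gt0 N0.
  rewrite (expnD 2 2 49) in N_big; move: (2 ^ 49) N_big => w.
  move: (N ^ 49) (N ^ 45) A0 B0 n_hi' N0 sigma0; clear => B A A0 B0 h N0 sigma0 w_N.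
  have step : 2 * n * w < N * (N * (N * sigma)).
    have : w * n <= w * (N * (N * sigma)) by rewrite leq_mul.
    have : 2 ^ 2 * w * (N * (N * sigma)) <= N * (N * (N * sigma)) by rewrite leq_mul.
    have : 0 < N * (N * (N * sigma)) by rewrite !muln_gt0 N0.
    by lia.
  have : A * (B * B) * (2 * n * w) < A * (B * B) * (N * (N * (N * sigma))).
    by rewrite ltn_pmul2l // !muln_gt0 A0 B0.
  by lia.
move=> l l_lo l_hi; move: N_L pL l_lo l_hi n_lo n_hi p0 sigma0; clear.
move=> N_L pL l_lo l_hi n_lo n_hi p0 sigma0.
have s202 : 202 * (p * sigma) <= N * sigma by rewrite mulnA leq_mul //; lia.
have s8 : (2 * p).+1 * sigma + 8 * (p.+1 * sigma) <= N * sigma.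
  by rewrite mulnA -mulnDl leq_mul //; lia.
have s9 : 100 * sigma <= N * sigma by rewrite leq_mul //; lia.
split; first by lia.
  have : l * p <= (2 * (N * sigma) + 202 * sigma) * p by rewrite leq_mul //; lia.
  by lia.
have : (2 * (N * sigma)) * p.+1 <= (l + 8 * sigma) * p.+1 by rewrite leq_mul //; lia.
by lia.
Qed.

(** The factor [2 ^ (17 * k)] of [flexible_pair] prescribes [q].  By
    [random_graph], [N] has to exceed certain powers of [q] and [s0], where [s0] is
    itself linear in [L]; this holds for [L = 200 * k]. *)
Lemma flexible_gadget k (L := 200 * k) (N := 2 ^ L) : 0 < k ->
  exists F : rel 'I_N, [/\ symmetric F, irreflexive F &
    forall chi : 'I_N -> 'I_N -> 'I_k, (forall a b, chi a b = chi b a) ->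
    exists c, flexible F (fun a b => F a b && (chi a b == c)) L.+2].
Proof.
move=> k0; pose q := 2 ^ (17 * k); pose al := 2 ^ (183 * k); pose s0 := 8 * L.+1 + 1.
have q0 : 0 < q by rewrite expn_gt0.
have Nq : N = q * al by rewrite /N /q /al -expnD -mulnDl.
have al1 : 1 < al by rewrite /al -{1}(expn0 2) ltn_exp2l // muln_gt0.
have s0_le : s0 <= 2 ^ (11 * k).
  rewrite expnM; apply: leq_trans (mul_le_expn _ k0); rewrite ?ltn_exp2l //.
  have -> : 2 ^ 11 = 2048 by [].
  by rewrite /s0 /L; move: k0; clear; lia.
have small : 16 * (4 * q ^ 2 * s0 ^ 2) ^ 3 <= N.
  apply: (@leq_trans (2 ^ 4 * (2 ^ 2 * q ^ 2 * (2 ^ (11 * k)) ^ 2) ^ 3)).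
    by rewrite leq_mul // leq_exp2r // leq_mul // leq_exp2r.
  rewrite /q /N -!expnM -!expnD -expnM -expnD leq_pexp2l // /L; move: k0; clear; lia.
have [f [sparse dense]] := random_graph q0 al1 Nq erefl small.
exists (graph_of f); split; [exact: graph_of_sym|exact: graph_of_irr|].
move=> chi chi_sym.
apply: (@flexible_pair _ _ s0 (@graph_of_sym _ _ f) (@graph_of_irr _ _ f) sparse k L chi) => //.
  by rewrite card_ord.
by move=> U /dense cU; rewrite card_ord [X in _ < X]Nq ltn_pmul2l.
Qed.

(** The exponents come from two competing requirements.  By [sparse_hypergraph] the
    vertex classes have to be larger than the sets controlled by sparsity, by a
    power of [N]; here [M = N ^ 143 * n] and [s = N ^ 99 * n], that is [N ^ 44].
    The trees of [hypercycle_exists] must not exceed [s], but the number of end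
    nodes, larger than the trees by the factor [N ^ h] approximately, has to exceed
    [2 * M].  This determines [h = 47], and with it the girth [197]. *)
Lemma ind_arrows_linear k : 0 < k -> exists n0, forall n, n0 <= n ->
  exists G, ind_arrows G (cycle_graph n) k /\ #|edges G| <= 2 ^ (200 * 153 * k) * n.
Proof.
move=> k0; have [F [F_sym F_irr F_flex]] := flexible_gadget k0.
set L := 200 * k in F F_sym F_irr F_flex; set N := 2 ^ L in F F_sym F_irr F_flex.
have N_L : 2000 * L.+1 <= N.
  apply: (@leq_trans (2 ^ 19 * k)).
    apply: (@leq_trans (2 ^ 11 * (2 ^ 8 * k))); last by rewrite mulnA -expnD.
    by apply: leq_mul => //; rewrite /L; have -> : 2 ^ 8 = 256 by []; move: k0; clear; lia.
  apply: leq_trans (mul_le_expn _ k0) _; first by rewrite -{1}(expn0 2) ltn_exp2l.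
  by rewrite -expnM /N leq_pexp2l // /L leq_mul2r orbT.
have N_51 : 2 ^ 51 <= N by rewrite /N leq_pexp2l // /L; move: k0; clear; lia.
have kN : k <= N by apply: leq_trans N_L; rewrite /L; clear; lia.
have NE : 2 ^ (200 * 153 * k) = N ^ 153 by rewrite /N /L -expnM mulnAC.
rewrite {}NE; clearbody N.
have N2000 : 2000 <= N by apply: leq_trans N_L; rewrite leq_pmulr.
have N0 : 0 < N by apply: leq_trans N2000.
exists (N ^ 50 + 4 * (197 * (16 * N ^ 8 * N) ^ 197)) => n n_big.
have nN50 : N ^ 50 <= n by apply: leq_trans n_big; rewrite leq_addr.
have n0 : 0 < n by apply: leq_trans nN50; rewrite expn_gt0 N0.
pose M' := (N ^ 143 * n).-1.
have M_E : M'.+1 = N ^ 143 * n by rewrite prednK // muln_gt0 expn_gt0 N0.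
pose m := N ^ 8 * M'.+1.
have [|||f [I [I_big I_sp]]] := @sparse_hypergraph N m M' (N ^ 8) (N ^ 99 * n) 197 erefl N0.
- by rewrite expn_gt0 N0.
- rewrite M_E mulnAC leq_mul2r -mulnA -(expnD N 8 2).
  apply/orP; right; apply: (@leq_trans (N ^ 99 * (N * N ^ 10) ^ 4)).
    rewrite leq_mul2l; apply/orP; right; rewrite leq_exp2r // leq_mul2r.
    by apply/orP; right; apply: leq_trans N2000.
  by rewrite -expnS -expnM -expnD.
- apply: leq_trans (leq_trans (leq_addl _ _) n_big) _.
  by rewrite /m M_E mulnA leq_pmull // muln_gt0 !expn_gt0 N0.
exists (host_graph f I F_sym F_irr); split; last first.
  apply: leq_trans (card_host_edges _ _ _ _) _; apply/eq_leq.
  rewrite /m M_E; have -> : N ^ 153 = N ^ 8 * N ^ 143 * N ^ 2 by rewrite -!expnD.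
  by move: (N ^ 8) (N ^ 143) (N ^ 2); clear=> a b c; lia.
apply: (@host_ind_arrows N m M' k L (N ^ 99 * n) (N ^ 3) 197 n 47).
- exact: F_flex.
- by move=> S /I_sp[].
- by move=> S /I_sp[].
- by apply: leq_trans N2000.
- by rewrite !expnS !muln1; move: N2000; clear; nia.
- have : 4 * N ^ 5 * (k * L.+1) * M'.+1 < m.
    rewrite /m ltn_pmul2r //; have -> : N ^ 8 = N ^ 5 * (N * (N * N)) by rewrite (expnD N 5 3) !expnS muln1.
    have : 0 < N ^ 5 by rewrite expn_gt0 N0.
    move: (N ^ 5) kN N_L N2000; clear => A kN N_L N2000 A0.
    have h : k * L.+1 <= N * N by rewrite leq_mul //; move: N_L; clear; lia.
    have h1 : 4 * A * (k * L.+1) <= 4 * A * (N * N) by rewrite leq_mul.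
    have h2 : 4 * (A * (N * N)) < N * (A * (N * N)).
      by rewrite ltn_pmul2r ?muln_gt0 ?A0; move: N2000; clear; lia.
    by move: h1 h2; clear; lia.
  move/leq_trans/(_ I_big) => lt; rewrite -(ltn_pmul2l (isT : 0 < 2)); apply: leq_trans lt.
  have -> : N ^ 5 = N ^ 3 * (N * N) by rewrite (expnD N 3 2) !expnS muln1.
  by rewrite ltnS; apply/eq_leq; move: (N ^ 3); clear; lia.
- by apply: leq_trans N_51; rewrite leq_exp2l.
- by apply: leq_trans N2000.
- by [].
move=> p p0 pL; rewrite M_E; exact: (ring_lengths N_L N_51 nN50 p0 pL).
Qed.

Lemma ind_size_ramsey_spec (G H : sgraph) k : ind_arrows G H k ->
  exists2 G' : sgraph, ind_arrows G' H k /\ ind_size_ramsey H k = #|edges G'|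
    & #|edges G'| <= #|edges G|.
Proof.
move=> GH; pose P m := `[< exists G' : sgraph, ind_arrows G' H k /\ #|edges G'| = m >].
have exP : exists m, P m by exists #|edges G|; apply/asboolP; exists G.
case: (ex_minnP exP) => m /asboolP[G' [G'H G'm]] min_m.
exists G'; last by rewrite G'm; apply: min_m; apply/asboolP; exists G.
split=> //; apply: ind_size_ramseyE; split; first by exists G'.
by move=> G'' G''H; rewrite G'm; apply: min_m; apply/asboolP; exists G''.
Qed.

Import Order.TTheory GRing.Theory Num.Theory.
Local Open Scope ring_scope.

(** [expR x <= 10 / 9] at [x = 1 / 10] follows from [1 - x <= expR (- x)]. *)
Lemma expR_tenth_le (R : realType) k : expR ((10%:R)^-1 * k%:R) * 9%:R ^+ k <= 10%:R ^+ k :> R.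
Proof.
rewrite expRM_natr -exprMn lerXn2r ?nnegrE ?mulr_ge0 ?expR_ge0 ?ler0n //.
set x : R := 10%:R^-1.
have : expR x * (1 - x) <= 1 by rewrite -[leRHS](expRxMexpNx_1 x) ler_pM2l ?expR_gt0 ?expR_ge1Dx.
move/(ler_wpM2r (ler0n R 10)); rewrite mul1r; apply: le_trans.
by rewrite -mulrA ler_pM2l ?expR_gt0 // mulrBl mul1r mulVf ?pnatr_eq0 // lerBrDr natr1.
Qed.

Theorem theorem1p3 (R : realType) :
  exists c C : R, 0 < c /\ 0 < C /\
    forall k : nat, (2 <= k)%N ->
      exists n0 : nat, forall n : nat, odd n -> (n0 <= n)%N ->
        expR (c * k%:R) * n%:R <= (ind_size_ramsey (cycle_graph n) k)%:R /\
        (ind_size_ramsey (cycle_graph n) k)%:R <= expR (C * k%:R) * n%:R.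
Proof.
exists (10%:R)^-1, (200%:R * 153%:R); split; first by rewrite invr_gt0 ltr0n.
split; first by rewrite mulr_gt0 ?ltr0n.
move=> k k2; have [n0 n0P] := ind_arrows_linear (ltnW k2).
exists (maxn n0 3) => n n_odd; rewrite geq_max => /andP[/n0P[G [GH G_le]] n3].
have [G' [G'H ->] G'G] := ind_size_ramsey_spec GH.
have lower := ind_arrows_exp_lower n_odd n3 k2 G'H.
have upper := leq_trans G'G G_le; move: lower upper; move: #|edges G'| => e lower upper.
split.
  have p9 : 0 < 9%:R ^+ k :> R by rewrite exprn_gt0 ?ltr0n.
  rewrite -(ler_pM2l p9) mulrA [_ * expR _]mulrC.
  apply: le_trans (_ : 10%:R ^+ k * n%:R <= _).
    by rewrite ler_wpM2r ?ler0n ?expR_tenth_le.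
  by rewrite -!natrX -!natrM ler_nat.
apply: le_trans (_ : (2 ^ (200 * 153 * k) * n)%:R <= _); first by rewrite ler_nat.
rewrite natrM ler_wpM2r ?ler0n // natrX -!natrM -[(_ * k)%:R]mulr1 expRM_natl.
rewrite lerXn2r ?nnegrE ?expR_ge0 ?ler0n //.
exact: expR_ge1Dx.
Qed.
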